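(* In the setting below, suppose $S$ is a Polish space and consider an invariant RTP with marginal distribution $\mu$. (a) If the RTP is endogenous, then bivariate uniqueness holds for $\mu$. (b) Conversely, if bivariate uniqueness holds for $\mu$ and $T^{(2)}$ is continuous with respect to weak convergence on the set of probability measures on $S\times S$ with both marginals equal to $\mu$, then the RTP is endogenous. (c) The RTP is endogenous if and only if $(T^{(2)})^n(\mu\otimes\mu)\to\mu^{\nearrow}$ weakly as $n\to\infty$, where $(T^{(2)})^n$ is the $n$-th iterate of $T^{(2)}$.
   Context: Setting. Let $(S,\mathcal S)$ and $(\Theta,\mathcal T)$ be measurable spaces and $\Theta^*=\Theta\times\bigsqcup_{0\le m\le\infty}S^m$ (disjoint union; $S^0$ a single point, $S^\infty$ the countable product). Let $g:\Theta^*\to S$ be measurable and $\nu$ a probability measure on $\Theta\times\{0,1,2,\dots,\infty\}$. Write $i\le^* N$ to mean $i\le N$ if $N<\infty$ and $i<\infty$ if $N=\infty$. The induced map $T$ sends a probability measure $\mu$ on $S$ to the law of $g(\xi,X_i,1\le i\le^*N)$, where $(\xi,N)\sim\nu$ and $(X_i)_{i\ge1}$ are i.i.d. with law $\mu$, independent of $(\xi,N)$. A fixed point is a $\mu$ with $T(\mu)=\mu$. Let $\mathbb T$ be the set of finite words $\mathbf i=i_1\cdots i_d$ of positive integers (the empty word $\emptyset$ is the root, $\mathrm{gen}(\mathbf i)=d$, the children of $\mathbf i$ are $\mathbf ij$, $j\ge1$), and let $(\xi_{\mathbf i},N_{\mathbf i})$, $\mathbf i\in\mathbb T$, be i.i.d.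 with law $\nu$. An invariant recursive tree process (RTP) with marginal $\mu$ is a family of $S$-valued random variables $(X_{\mathbf i})_{\mathbf i\in\mathbb T}$ defined on the same probability space such that: each $X_{\mathbf i}$ has law $\mu$; $X_{\mathbf i}=g(\xi_{\mathbf i},X_{\mathbf ij},1\le j\le^*N_{\mathbf i})$ a.s. for every $\mathbf i$; and for every $d$ the variables $\{X_{\mathbf i}:\mathrm{gen}(\mathbf i)=d\}$ are i.i.d. and independent of $\{(\xi_{\mathbf i},N_{\mathbf i}):\mathrm{gen}(\mathbf i)<d\}$. The RTP is endogenous if $X_\emptyset$ is measurable with respect to $\mathcal G=\sigma((\xi_{\mathbf i},N_{\mathbf i}),\mathbf i\in\mathbb T)$. Bivariate map: $T^{(2)}$ sends a probability measure $\mu^{(2)}$ on $S\times S$ to the law of $\big(g(\xi,X_i^{(1)},1\le i\le^*N),\,g(\xi,X_i^{(2)},1\le i\le^*N)\big)$, where $(X_i^{(1)},X_i^{(2)})$, $i\ge1$, are i.i.d. with law $\mu^{(2)}$, independent of $(\xi,N)\sim\nu$ (the same $(\xi,N)$ is used in both coordinates). For $\mu$ on $S$, $\mu^{\nearrow}$ is the law of $(X,X)$ with $X\sim\mu$, and $\mu\otimes\mu$ is the product measure. For a fixed point $\mu$ of $T$, bivariate uniqueness holds if $\mu^{\nearrow}$ is the unique fixed point of $T^{(2)}$ among probability measures on $S\times S$ with both marginals equal to $\mu$.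
   Formalization: Endogenous is read up to null sets: X_∅ equals almost surely a G-measurable variable; with literal G-measurability, (b) and the converse in (c) fail after changing X_∅ on a null event. *)

(* Defs.v *)
From HB Require Import structures.
From mathcomp Require Import all_boot all_order all_algebra.
From mathcomp Require Import all_classical all_reals all_analysis.
Set Implicit Arguments. Unset Strict Implicit. Unset Printing Implicit Defensive.
Import Order.TTheory GRing.Theory Num.Theory.
Import numFieldTopology.Exports numFieldNormedType.Exports.
Local Open Scope classical_set_scope.
Local Open Scope ring_scope.

Definition borel (S : ptopologicalType) : Type := S.
HB.instance Definition _ (S : ptopologicalType) := PointedTopological.on (borel S).
Section borel_inst.
Variable S : ptopologicalType.
HB.instance Definition _ := @isMeasurable.Build default_measure_display
  (borel S) <<s @open (borel S) >> (@sigma_algebra0 _ setT (@open (borel S)))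
  (@sigma_algebraC _ (@open (borel S)))
  (@sigma_algebra_bigcup _ setT (@open (borel S))).
End borel_inst.

Definition seqS (S : ptopologicalType) : Type := nat -> borel S.
Definition coord_sets (S : ptopologicalType) : set (set (seqS S)) :=
  \bigcup_(i in [set: nat]) preimage_set_system [set: seqS S] (fun x : seqS S => x i) measurable.
HB.instance Definition _ (S : ptopologicalType) := Pointed.copy (seqS S) (nat -> borel S).
Section seqS_inst.
Variable S : ptopologicalType.
HB.instance Definition _ := @isMeasurable.Build default_measure_display
  (seqS S) <<s @coord_sets S >> (@sigma_algebra0 _ setT (@coord_sets S))
  (@sigma_algebraC _ (@coord_sets S))
  (@sigma_algebra_bigcup _ setT (@coord_sets S)).
End seqS_inst.

Definition natinf : Type := option nat.
HB.instance Definition _ := Pointed.copy natinf (option nat).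
HB.instance Definition _ := @isMeasurable.Build default_measure_display
  natinf discrete_measurable discrete_measurable0
  discrete_measurableC discrete_measurableU.

Definition polish (R : realType) (S : topologicalType) : Prop :=
  (exists D : set S, countable D /\ closure D = [set: S]) /\
  exists dist : S -> S -> R,
    [/\ (forall x y, dist x y = 0 <-> x = y),
        (forall x y, dist x y = dist y x),
        (forall x y z, dist x z <= dist x y + dist y z),
        (forall x, nbhs x = filter_from [set e : R | 0 < e] (fun e => [set y | dist x y < e]))
      & (forall u : nat -> S,
           (forall e : R, 0 < e -> exists M : nat, forall m n, (M <= m)%N -> (M <= n)%N -> dist (u m) (u n) < e) ->
           exists l : S, u @ \oo --> l)].

(* child index j : nat (0-based) of a vertex stands for the child j+1;
   lt_star j N  <->  j+1 <=* N *)
Definition lt_star (j : nat) (N : natinf) : Prop :=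
  match N with Some n => (j < n)%N | None => True end.

(* g : Theta* -> S, encoded as a function of (xi, N, (x_j)_j) depending only on x_j, j+1 <=* N *)
Definition g_local {Theta : Type} {S : ptopologicalType}
  (g : Theta -> natinf -> (nat -> borel S) -> borel S) : Prop :=
  forall th n (x y : nat -> borel S), (forall j, lt_star j n -> x j = y j) -> g th n x = g th n y.

Definition g_measurable {dT} {Theta : measurableType dT} {S : ptopologicalType}
  (g : Theta -> natinf -> (nat -> borel S) -> borel S) : Prop :=
  forall n : natinf, measurable_fun [set: Theta * seqS S] (fun p : Theta * seqS S => g p.1 n p.2).

Section prob_defs.
Context {R : realType} {dO : measure_display} {Omega : measurableType dO}.
Local Open Scope ereal_scope.

Definition has_law {dT} {T : measurableType dT} (P : probability Omega R) (X : Omega -> T)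
  (m : set T -> \bar R) : Prop :=
  measurable_fun [set: Omega] X /\ forall A, measurable A -> P (X @^-1` A) = m A.

Definition sigma_of {dT} {T : measurableType dT} (X : Omega -> T) : set (set Omega) :=
  [set X @^-1` A | A in measurable].

Definition mutual_indep {I : eqType} (P : probability Omega R) (F : I -> set (set Omega)) : Prop :=
  forall (J : seq I) (A : I -> set Omega), uniq J -> (forall j, j \in J -> F j (A j)) ->
    P [set w | forall j, j \in J -> A j w] = \prod_(j <- J) P (A j).

Definition trivial_sigma : set (set Omega) := [set A | A = set0 \/ A = setT].
End prob_defs.

(* vertices of the tree: finite words over nat; letter j stands for child j+1 *)
Definition word := seq nat.

Section RTP.
Context {R : realType} {dO : measure_display} {Omega : measurableType dO}
  {dT : measure_display} {Theta : measurableType dT} {S : ptopologicalType}.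
Local Open Scope ereal_scope.

Definition xiN (xi : word -> Omega -> Theta) (N : word -> Omega -> natinf) (w : word) :
  Omega -> Theta * natinf := fun om => (xi w om, N w om).

Definition G_lt (xi : word -> Omega -> Theta) (N : word -> Omega -> natinf) (d : nat) :
  set (set Omega) := <<s \bigcup_(w in [set w : word | (size w < d)%N]) sigma_of (xiN xi N w) >>.

Definition G_all (xi : word -> Omega -> Theta) (N : word -> Omega -> natinf) :
  set (set Omega) := <<s \bigcup_(w in [set: word]) sigma_of (xiN xi N w) >>.

Definition invariant_RTP (P : probability Omega R) (nu : probability (Theta * natinf)%type R)
  (g : Theta -> natinf -> (nat -> borel S) -> borel S) (mu : probability (borel S) R)
  (xi : word -> Omega -> Theta) (N : word -> Omega -> natinf) (X : word -> Omega -> borel S) : Prop :=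
  [/\ (forall w, has_law P (xiN xi N w) nu),
      mutual_indep P (fun w : word => sigma_of (xiN xi N w)),
      (forall w, has_law P (X w) mu),
      (forall w, {ae P, forall om, X w om = g (xi w om) (N w om) (fun j => X (rcons w j) om)})
    & (forall d : nat, mutual_indep P (fun o : option word =>
          match o with
          | None => G_lt xi N d
          | Some w => if size w == d then sigma_of (X w) else trivial_sigma
          end))].

Definition endogenous (P : probability Omega R)
  (xi : word -> Omega -> Theta) (N : word -> Omega -> natinf) (X : word -> Omega -> borel S) : Prop :=
  exists Y : Omega -> borel S,
    (forall A, measurable A -> G_all xi N (Y @^-1` A)) /\ {ae P, forall om, X [::] om = Y om}.
End RTP.

Section bivariate.
Context {R : realType} {dT : measure_display} {Theta : measurableType dT} {S : ptopologicalType}.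
Local Open Scope ereal_scope.

Definition T2_image (nu : probability (Theta * natinf)%type R)
  (g : Theta -> natinf -> (nat -> borel S) -> borel S)
  (m2 m2' : set (borel S * borel S)%type -> \bar R) : Prop :=
  exists (dO : measure_display) (Omega : measurableType dO) (Q : probability Omega R)
    (xi : Omega -> Theta) (N : Omega -> natinf) (Y : nat -> Omega -> (borel S * borel S)%type),
    [/\ has_law Q (fun om => (xi om, N om)) nu,
        (forall j, has_law Q (Y j) m2),
        mutual_indep Q (fun o : option nat =>
          match o with None => sigma_of (fun om => (xi om, N om)) | Some j => sigma_of (Y j) end)
      & has_law Q (fun om => (g (xi om) (N om) (fun j => (Y j om).1),
                              g (xi om) (N om) (fun j => (Y j om).2))) m2'].

Definition diag_law (mu : probability (borel S) R) : set (borel S * borel S)%type -> \bar R :=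
  pushforward mu (fun x : borel S => (x, x)).

Definition meas_eq (m m' : set (borel S * borel S)%type -> \bar R) : Prop :=
  forall A, measurable A -> m A = m' A.

Definition marginals_eq (mu : probability (borel S) R) (m2 : set (borel S * borel S)%type -> \bar R) : Prop :=
  forall A : set (borel S), measurable A -> m2 (A `*` [set: borel S]) = mu A /\ m2 ([set: borel S] `*` A) = mu A.

Definition weak_cvg (ms : nat -> set (borel S * borel S)%type -> \bar R) (m : set (borel S * borel S)%type -> \bar R) : Prop :=
  forall f : (borel S * borel S)%type -> R, continuous f -> (exists M : R, forall x, (`|f x| <= M)%R) ->
    (fun n => \int[ms n]_x (f x)%:E) @ \oo --> \int[m]_x (f x)%:E.

Definition bivariate_uniqueness (nu : probability (Theta * natinf)%type R)
  (g : Theta -> natinf -> (nat -> borel S) -> borel S) (mu : probability (borel S) R) : Prop :=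
  T2_image nu g (diag_law mu) (diag_law mu) /\
  forall m2 : probability (borel S * borel S)%type R, marginals_eq mu m2 ->
    T2_image nu g m2 m2 -> meas_eq m2 (diag_law mu).

Definition T2_weak_continuous (nu : probability (Theta * natinf)%type R)
  (g : Theta -> natinf -> (nat -> borel S) -> borel S) (mu : probability (borel S) R) : Prop :=
  forall (ms ms' : nat -> probability (borel S * borel S)%type R) (m m' : probability (borel S * borel S)%type R),
    (forall k, marginals_eq mu (ms k)) -> marginals_eq mu m ->
    (forall k, T2_image nu g (ms k) (ms' k)) -> T2_image nu g m m' ->
    weak_cvg (fun k => ms k) m -> weak_cvg (fun k => ms' k) m'.

Definition T2_iterates_cvg (nu : probability (Theta * natinf)%type R)
  (g : Theta -> natinf -> (nat -> borel S) -> borel S) (mu : probability (borel S) R) : Prop :=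
  forall ms : nat -> probability (borel S * borel S)%type R,
    meas_eq (ms 0%N) (mu \x mu) ->
    (forall n, T2_image nu g (ms n) (ms n.+1)) ->
    weak_cvg (fun n => ms n) (diag_law mu).
End bivariate.

(* Main.v *)
Require Import Defs.
From HB Require Import structures.
From mathcomp Require Import all_boot all_order all_algebra.
From mathcomp Require Import all_classical all_reals all_analysis.
From mathcomp Require Import measurable_realfun ring lra.
Import Order.TTheory GRing.Theory Num.Theory.
Import numFieldTopology.Exports numFieldNormedType.Exports.
Local Open Scope classical_set_scope.
Local Open Scope ring_scope.

(** Grow a tree of depth n whose level-n leaves are i.i.d. pairs of law m: the root
    pair (Y1, Y2) has law (T2)^n m, and if m has marginals mu then the innovations
    above level n have the same joint law with Y1, or with Y2, as with the root X of
    the RTP. When the RTP is endogenous, the event that X lies in A is approximated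
    by an event on finitely many generations, hence so are the events for Y1 and Y2,
    and (T2)^n m (A x A^c) tends to 0: this gives (a) and one half of (c).
    Conversely take the leaves (X_w(om), X_w(om')) on Omega x Omega. Convergence of
    (T2)^n (mu x mu) to the diagonal law says that Y2(om, om') is close to the root
    X(om), and freezing om' turns Y2 into a function of the innovations.
    For (b), (T2)^n (mu x mu) (A x B) is the mean of the product of the conditional
    probabilities of A and of B given n generations, so it converges because
    martingale increments are orthogonal. The limit is realized, together with an
    i.i.d. sequence, by nested subintervals of [0, 1]; by continuity it is a fixed
    point of T2, hence the diagonal law, and (c) applies. *)

Set Implicit Arguments.
Unset Strict Implicit.
Unset Printing Implicit Defensive.

(** * Independence and cylinder events *)

(** [T2_image] is a relation between laws, witnessed on some unspecified space, so no argument may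
    depend on the space at hand. Hence every comparison passes through [tree_data]: a tree cut at a
    finite depth has a joint law fixed by [nu] and the leaf law, and an event of the canonical tree
    space has the same probability on every realization. For the same reason existence has to be
    shown, of the iterates as well as of T2 at the limit law.

    Freezing om' works because of Fubini: a small event of the product has a small section, and
    summable errors with Borel-Cantelli give almost sure convergence.

    In (b) the limits on rectangles are finitely additive in each argument, but nothing yet makes
    them a measure on the product. Membership in countably many balls turns a pair into bits; the
    limits prescribe consistent laws for finitely many bits, which intervals realize. The marginals
    [mu] then guarantee that the bits are almost surely codes of points, and completeness that a
    measurable decoder exists. *)

Section pi_lambda.
Context {R : realType} {d : measure_display} {O : measurableType d}.
Local Open Scope ereal_scope.

Lemma sigma_gen_sub (G : set (set O)) :
  G `<=` measurable -> <<s G >> `<=` measurable.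
Proof.
move=> Gm; apply: smallest_sub => //.
exact: sigma_algebra_measurable.
Qed.

Lemma pi_lambda_eq (m1 m2 : {finite_measure set O -> \bar R}) (G : set (set O)) :
  setI_closed G -> G `<=` measurable -> m1 setT = m2 setT ->
  (forall A, G A -> m1 A = m2 A) -> forall A, <<s G >> A -> m1 A = m2 A.
Proof.
move=> GI Gm mT mG.
have sm := sigma_gen_sub Gm.
suff : <<s G >> `<=` [set A | measurable A /\ m1 A = m2 A].
  by move=> H A /H [].
apply: lambda_system_subset => //=.
apply/dynkin_lambda_system; split => /=.
- by split.
- move=> A /= [mA eA]; split; first exact: measurableC.
  have lt m : (m : {finite_measure set O -> \bar R}) setT < +oo.
    by rewrite ltey_eq fin_num_measure.
  by rewrite -setTD !measureD ?setTI//; first [exact: lt | by congr (_ - _)].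
- move=> F tF FG; have mF n : measurable (F n) by case: (FG n).
  split; first exact: bigcup_measurable.
  rewrite !measure_bigcup//.
  by apply: eq_eseriesr => n _; case: (FG n).
- by move=> A GA; split; [exact: Gm|exact: mG].
Qed.

Lemma pi_lambda_indep (P : probability O R) (G : set (set O)) (C : set O) :
  setI_closed G -> G `<=` measurable -> measurable C ->
  (forall A, G A -> P (A `&` C) = P A * P C) ->
  forall A, <<s G >> A -> P (A `&` C) = P A * P C.
Proof.
move=> GI Gm mC PG.
have sm := sigma_gen_sub Gm.
have fC : P C \is a fin_num by rewrite fin_num_measure.
suff : <<s G >> `<=` [set A | measurable A /\ P (A `&` C) = P A * P C].
  by move=> H A /H [].
apply: lambda_system_subset => //=.
apply/dynkin_lambda_system; split => /=.
- by split => //; rewrite setTI probability_setT mul1e.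
- move=> A /= [mA eA]; split; first exact: measurableC.
  have -> : ~` A `&` C = C `\` A by rewrite setIC.
  rewrite measureD//; last by rewrite ltey_eq fC.
  rewrite /= (setIC C) eA probability_setC// muleBl ?mul1e//.
- move=> F tF FG; have mF n : measurable (F n) by case: (FG n).
  split; first exact: bigcup_measurable.
  rewrite setI_bigcupl !measure_bigcup//.
  + rewrite muleC -(fineK fC) -nneseriesZl//=.
    by apply: eq_eseriesr => n _; case: (FG n) => _ ->; rewrite fineK// muleC.
  + by move=> n _; exact: measurableI.
  + exact: trivIset_setIr.
- by move=> A GA; split; [exact: Gm|exact: PG].
Qed.

End pi_lambda.

Definition cyl {I : eqType} {T : Type} (J : seq I) (A : I -> set T) : set T :=
  [set w | forall j, j \in J -> A j w].

(** The pi-system generated by the families [F i], [i] in [D], once each is closed under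
    intersection; tree laws are compared on it. *)
Definition cyls {I : eqType} {T : Type} (D : set I) (F : I -> set (set T)) :
    set (set T) :=
  [set C | exists J A, [/\ uniq J, forall j, j \in J -> D j /\ F j (A j)
                         & C = cyl J A]].

Section cylinders.
Context {I : eqType} {T : Type}.
Implicit Types (A : I -> set T) (J : seq I).

Lemma cyl_nil A : cyl [::] A = setT.
Proof. by apply/seteqP; split. Qed.

Lemma cyl_cons j J A : cyl (j :: J) A = A j `&` cyl J A.
Proof.
apply/seteqP; split => w /=.
  by move=> H; split=> [|k kJ]; apply: H; rewrite inE ?eqxx// kJ orbT.
by move=> [Aj H] k; rewrite inE => /predU1P[->//|/H].
Qed.

Lemma cyl_cat J J' A : cyl (J ++ J') A = cyl J A `&` cyl J' A.
Proof.
elim: J => [|j J IH] /=; first by rewrite cyl_nil setTI.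
by rewrite !cyl_cons IH setIA.
Qed.

Lemma eq_cyl J J' A A' : J =i J' -> (forall j, j \in J -> A j = A' j) ->
  cyl J A = cyl J' A'.
Proof.
move=> JJ AA; apply/seteqP; split => w H j jJ.
  by rewrite -AA ?JJ//; apply: H; rewrite JJ.
by rewrite AA//; apply: H; rewrite -JJ.
Qed.

Lemma cyls_setI (D : set I) (F : I -> set (set T)) :
  (forall i, D i -> setI_closed (F i)) -> setI_closed (cyls D F).
Proof.
move=> FI C C' [J [A [uJ JA ->]]] [J' [A' [uJ' JA' ->]]].
(* An index common to both lists must carry the intersection, since a cylinder has one event per
   index. *)
pose B j := if j \in J then (if j \in J' then A j `&` A' j else A j) else A' j.
exists (undup (J ++ J')), B; split; first exact: undup_uniq.
- move=> j; rewrite mem_undup mem_cat /B.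
  have [/JA [Dj Fj]|_] := boolP (j \in J); last by move=> /JA'.
  have [/JA' [_ F'j]|//] := boolP (j \in J').
  by move=> _; split => //; exact: FI.
- apply/seteqP; split => w /=.
    move=> [H H'] j; rewrite mem_undup mem_cat /B.
    case: ifPn => [/H Aj|_]; last by move=> /H'.
    by case: ifPn => // /H' A'j _; split.
  move=> H; split => j jJ; have := H j; rewrite mem_undup mem_cat /B jJ ?orbT.
    by move=> /(_ isT); case: (j \in J') => // -[].
  by move=> /(_ isT); case: (j \in J) => // -[].
Qed.

Lemma preimage_cyl {T' : Type} (f : T' -> T) J A :
  f @^-1` cyl J A = cyl J (fun j => f @^-1` A j).
Proof. by []. Qed.

End cylinders.

Section independence.
Context {R : realType} {d : measure_display} {O : measurableType d}.
Variable P : probability O R.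
Local Open Scope ereal_scope.

(** Relative to an index set, because a tree cut at depth [d] says nothing of the vertices below
    that level. *)
Definition indep_on {I : eqType} (D : set I) (F : I -> set (set O)) : Prop :=
  forall J A, uniq J -> (forall j, j \in J -> D j /\ F j (A j)) ->
    P (cyl J A) = \prod_(j <- J) P (A j).

Lemma measurable_cyl {I : eqType} (J : seq I) (A : I -> set O) :
  (forall j, j \in J -> measurable (A j)) -> measurable (cyl J A).
Proof.
elim: J => [|j J IH] H; first by rewrite cyl_nil.
rewrite cyl_cons; apply: measurableI; first by apply: H; rewrite inE eqxx.
by apply: IH => k kJ; apply: H; rewrite inE kJ orbT.
Qed.

Lemma indep_onP {I : eqType} (F : I -> set (set O)) :
  mutual_indep P F <-> indep_on setT F.
Proof.
split => H J A uJ HJ; apply: H => //; last by move=> j /HJ.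
by move=> j /HJ [].
Qed.

Lemma indep_onS {I : eqType} (D D' : set I) (F F' : I -> set (set O)) :
  (forall i, D i -> D' i /\ F i `<=` F' i) -> indep_on D' F' -> indep_on D F.
Proof.
move=> DD H J A uJ HJ; apply: H => // j /HJ [Dj Fj].
by have [? FF] := DD _ Dj; split => //; exact: FF.
Qed.

(** Generators are replaced by sigma-algebras one index at a time. Midway, [J1] carries events of
    the sigma-algebras and [J2] still carries generators; a pi-lambda argument in one variable moves
    an index from [J2] to [J1]. *)
Lemma indep_pi_ext {I : eqType} (D : set I) (F : I -> set (set O)) :
  (forall i, D i -> setI_closed (F i)) ->
  (forall i, D i -> F i `<=` measurable) ->
  indep_on D F -> indep_on D (fun i => <<s F i >>).
Proof.
move=> FI Fm FP.
suff H J1 : forall J2 A, uniq (J1 ++ J2) ->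
    (forall j, j \in J1 -> D j /\ <<s F j >> (A j)) ->
    (forall j, j \in J2 -> D j /\ F j (A j)) ->
    P (cyl (J1 ++ J2) A) = \prod_(j <- J1 ++ J2) P (A j).
  by move=> J A uJ HJ; have := H J [::] A; rewrite cats0; apply.
elim: J1 => [|j J1 IH] J2 A /= uJ H1 H2; first exact: FP.
move: uJ => /andP[jJ uJ].
have [Dj sj] : D j /\ <<s F j >> (A j) by apply: H1; rewrite inE eqxx.
have H1' k : k \in J1 -> D k /\ <<s F k >> (A k).
  by move=> kJ; apply: H1; rewrite inE kJ orbT.
have mA k : k \in J1 ++ J2 -> measurable (A k).
  rewrite mem_cat => /orP[/H1'|/H2] [Dk Fk]; last exact: Fm Fk.
  exact: sigma_gen_sub (Fm _ Dk) _ Fk.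
rewrite cyl_cons big_cons -IH//.
apply: (pi_lambda_indep (FI _ Dj) (Fm _ Dj) _ _ sj).
  exact: measurable_cyl.
(* With a generator [B] at [j], this index may join [J2], where the induction hypothesis applies. *)
move=> B FB; pose A' k := if k == j then B else A k.
have AA' k : k \in J1 ++ J2 -> A k = A' k.
  by rewrite /A'; case: eqP => // ->; rewrite (negbTE jJ).
have -> : cyl (J1 ++ J2) A = cyl (J1 ++ J2) A' by exact: eq_cyl.
have -> : B `&` cyl (J1 ++ J2) A' = cyl (J1 ++ j :: J2) A'.
  rewrite (_ : B = A' j); last by rewrite /A' eqxx.
  rewrite -cyl_cons; apply: eq_cyl => // k.
  by rewrite !(inE, mem_cat) orbCA.
have H1A k : k \in J1 -> D k /\ <<s F k >> (A' k).
  by move=> kJ; rewrite -AA' ?mem_cat ?kJ//; exact: H1'.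
have H2A k : k \in J2 -> D k /\ F k (A' k).
  by move=> kJ; rewrite -AA' ?mem_cat ?kJ ?orbT//; exact: H2.
have pJ : perm_eq (J1 ++ j :: J2) (j :: (J1 ++ J2)).
  by rewrite -(cat1s j J2) perm_catCA.
rewrite (IH J2 A')// IH//; last 2 first.
- by rewrite (perm_uniq pJ) /= jJ.
- by move=> k; rewrite inE => /predU1P[->|/H2A//]; rewrite /A' eqxx.
by rewrite (perm_big _ pJ) big_cons {1}/A' eqxx.
Qed.

Lemma cyls_measurable {I : eqType} (D : set I) (F : I -> set (set O)) :
  (forall i, D i -> F i `<=` measurable) -> cyls D F `<=` measurable.
Proof.
move=> Fm C [J [A [uJ JA ->]]]; apply: measurable_cyl => j /JA [Dj].
exact: Fm.
Qed.

(** The cylinders inside one fibre of [kap] form a pi-system, and a cylinder made of such cylinders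
    is a cylinder of the original family, to which the product formula applies. *)
Lemma indep_group {I K : eqType} (D : set I) (F : I -> set (set O))
    (kap : I -> K) :
  (forall i, D i -> setI_closed (F i)) ->
  (forall i, D i -> F i `<=` measurable) ->
  indep_on D F ->
  indep_on setT
    (fun k => <<s \bigcup_(i in [set i | D i /\ kap i = k]) F i >>).
Proof.
move=> FI Fm FP.
pose G k := cyls [set i | D i /\ kap i = k] F.
have GI k : setI_closed (G k) by apply: cyls_setI => i [Di _]; exact: FI.
have Gm k : G k `<=` measurable.
  by apply: cyls_measurable => i [Di _]; exact: Fm.
apply: (@indep_onS _ _ setT _ (fun k => <<s G k >>)).
  move=> k _; split => //; apply: smallest_sub; first exact: smallest_sigma_algebra.
  move=> A [i [Di ik] FA]; apply: sub_sigma_algebra.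
  exists [:: i], (fun _ => A); split => //.
    by move=> j; rewrite inE => /eqP ->.
  by rewrite cyl_cons cyl_nil setIT.
apply: indep_pi_ext => // L B uL HL.
have : forall k, exists JA : seq I * (I -> set O), k \in L ->
    [/\ uniq JA.1, forall j, j \in JA.1 -> (D j /\ kap j = k) /\ F j (JA.2 j)
      & B k = cyl JA.1 JA.2].
  move=> k; have [kL|_] := boolP (k \in L); last by exists ([::], (fun=> setT)).
  by have [_ [J [A JA]]] := HL _ kL; exists (J, A).
move=> /choice[f Hf].
(* Fibres are disjoint, so the events chosen block by block fit together into one family. *)
pose A i := (f (kap i)).2 i.
have HA k j : k \in L -> j \in (f k).1 -> [/\ D j, kap j = k & F j (A j)].
  by move=> kL jk; have [_ /(_ _ jk)[[? kj] ?] _] := Hf _ kL; rewrite /A kj.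
have BE k : k \in L -> B k = cyl (f k).1 A.
  move=> kL; have [_ _ ->] := Hf _ kL; apply: eq_cyl => // j jk.
  by have [_ kj _] := HA _ _ kL jk; rewrite /A kj.
rewrite (_ : cyl L B = cyl (flatten [seq (f k).1 | k <- L]) A); last first.
  elim: L uL BE {HL Hf HA} => [|k L IH] uL BE; first by rewrite /= !cyl_nil.
  rewrite /= cyl_cons cyl_cat BE ?inE ?eqxx// IH//.
    by case/andP: uL.
  by move=> l lL; apply: BE; rewrite inE lL orbT.
rewrite FP.
- rewrite big_flatten big_map; apply: eq_big_seq => k kL.
  rewrite BE// FP//; first by have [] := Hf _ kL.
  by move=> j jk; have [] := HA _ _ kL jk.
- elim: L uL Hf HA {HL BE} => //= k L IH /andP[kL uL] Hf HA.
  rewrite cat_uniq; apply/and3P; split.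
  + by have [] := Hf k (mem_head _ _).
  + apply/hasPn => j /flattenP[s /mapP[l lL ->{s}] jl].
    apply/negP => jk; move: kL.
    have [_ <- _] := HA k j (mem_head _ _) jk.
    have [|_ -> _] := HA l j _ jl; first by rewrite inE lL orbT.
    by rewrite lL.
  + by apply: IH => // [l lL|l j lL]; [apply: Hf|apply: HA]; rewrite inE lL orbT.
- move=> j /flattenP[s /mapP[l lL ->{s}] jl].
  by have [] := HA _ _ lL jl.
Qed.

End independence.

Lemma indep_on_inj {R : realType} {d : measure_display} {O : measurableType d}
    (P : probability O R) {I K : eqType} (f : I -> K) (D : set I) (D' : set K)
    (F : I -> set (set O)) (F' : K -> set (set O)) :
  (forall i j, D i -> D j -> f i = f j -> i = j) ->
  (forall i, D i -> D' (f i) /\ F i `<=` F' (f i)) ->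
  indep_on P D' F' -> indep_on P D F.
Proof.
move=> fI DF H J A uJ HJ.
(* Transports the family along [f] without an inverse: [A i] at [f i], the whole space off the
   image. *)
pose A' k := [set w | forall i, D i -> f i = k -> A i w].
have AE i : D i -> A' (f i) = A i.
  move=> Di; apply/seteqP; split => w /=; first exact.
  by move=> Aw j Dj /fI -> //.
have := H (map f J) A'; rewrite big_map.
have -> : cyl (map f J) A' = cyl J A.
  apply/seteqP; split => w Hw j jJ.
    by rewrite -AE; [apply: Hw; exact: map_f|case: (HJ _ jJ)].
  by case/mapP: jJ => i iJ ->; rewrite AE; [exact: Hw|case: (HJ _ iJ)].
move=> ->.
- by apply: eq_big_seq => i iJ; rewrite AE//; case: (HJ _ iJ).
- rewrite map_inj_in_uniq// => i j iJ jJ; apply: fI; first by case: (HJ _ iJ).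
  by case: (HJ _ jJ).
- move=> _ /mapP[i iJ ->]; have [Di Fi] := HJ _ iJ.
  by have [? FF] := DF _ Di; split => //; rewrite AE//; exact: FF.
Qed.

Definition sigma_gen {T : Type} {d} {U : measurableType d} (X : T -> U) :
  set (set T) := [set X @^-1` A | A in measurable].

Lemma sigma_gen_setI {T : Type} {d} {U : measurableType d} (X : T -> U) :
  setI_closed (sigma_gen X).
Proof.
by move=> _ _ [A mA <-] [B mB <-]; exists (A `&` B) => //; exact: measurableI.
Qed.

Lemma sigma_gen_measurable {d'} {T : measurableType d'} {d}
    {U : measurableType d} (X : T -> U) :
  measurable_fun setT X -> sigma_gen X `<=` measurable.
Proof. by move=> mX _ [A mA <-]; rewrite -[_ @^-1` _]setTI; exact: mX. Qed.

(** Measurability for a sub-sigma-algebra is handled as measurability of a map out of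
    [g_sigma_algebraType G], so that the closure properties of measurable functions apply to it. *)
Lemma measurable_fun_gen {T : pointedType} {d} {U : measurableType d}
    (G : set (set T)) (X : T -> U) : sigma_gen X `<=` <<s G >> ->
  measurable_fun setT (X : g_sigma_algebraType G -> U).
Proof. by move=> XG _ A mA; rewrite setTI; apply: XG; exists A. Qed.

Lemma gen_measurable_fun {T : pointedType} {d} {U : measurableType d}
    (G : set (set T)) (X : T -> U) :
  measurable_fun setT (X : g_sigma_algebraType G -> U) ->
  sigma_gen X `<=` <<s G >>.
Proof.
by move=> mX _ [A mA <-]; have := mX measurableT A mA; rewrite setTI.
Qed.

Section tree_data.
Context {R : realType} {dE : measure_display} {E : measurableType dE}
  {dV : measure_display} {V : measurableType dV}.
Local Open Scope ereal_scope.

Definition lev {T : Type} (xi : word -> T -> E) (y : word -> T -> V) (d : nat)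
    (w : word) : set (set T) :=
  if (size w < d)%N then sigma_gen (xi w) else sigma_gen (y w).

Definition tree_data {dO} {O : measurableType dO} (P : probability O R)
    (xi : word -> O -> E) (y : word -> O -> V) (d : nat)
    (nu : set E -> \bar R) (m : set V -> \bar R) : Prop :=
  [/\ forall w, (size w < d)%N -> has_law P (xi w) nu,
      forall w, size w = d -> has_law P (y w) m
    & indep_on P [set w | (size w <= d)%N] (lev xi y d)].

(** Formed on the canonical space of innovations and values, so that one event can be evaluated on
    any realization of the tree. *)
Definition tree_cyls d : set (set ((word -> E) * (word -> V))) :=
  cyls [set w | (size w <= d)%N]
    (lev (fun w t => t.1 w) (fun w t => t.2 w) d).

Lemma lev_setI {T : Type} (xi : word -> T -> E) (y : word -> T -> V) d w :
  setI_closed (lev xi y d w).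
Proof. by rewrite /lev; case: ifP => _; exact: sigma_gen_setI. Qed.

Lemma lev_pull {T : Type} (xi : word -> T -> E) (y : word -> T -> V) d w A :
  lev (fun w (t : (word -> E) * (word -> V)) => t.1 w) (fun w t => t.2 w) d w A ->
  lev xi y d w ((fun om => (xi^~ om, y^~ om)) @^-1` A).
Proof. by rewrite /lev; case: ifP => _ [B mB <-]; exists B. Qed.

Section one_space.
Context {dO : measure_display} {O : measurableType dO}.
Variables (P : probability O R).
Variables (xi : word -> O -> E) (y : word -> O -> V).

Lemma lev_measurable d nu m w : tree_data P xi y d nu m -> (size w <= d)%N ->
  lev xi y d w `<=` measurable.
Proof.
move=> [Hxi Hy _]; rewrite leq_eqVlt /lev => /predU1P[wd|wd].
  by rewrite wd ltnn; apply: sigma_gen_measurable; have [] := Hy w wd.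
by rewrite wd; apply: sigma_gen_measurable; have [] := Hxi w wd.
Qed.

Lemma tree_data_shift d nu m j : tree_data P xi y d.+1 nu m ->
  tree_data P (fun w => xi (j :: w)) (fun w => y (j :: w)) d nu m.
Proof.
move=> [Hxi Hy HI]; split => [w wd|w wd|].
- exact: (Hxi (j :: w)).
- by apply: (Hy (j :: w)); rewrite /= wd.
- apply: (indep_on_inj (f := cons j) _ _ HI); first by move=> i k _ _ [].
  by move=> w wd; split; [exact: wd|exact: subset_refl].
Qed.

End one_space.

(** On cylinders independence gives the same product for both realizations, and the pi-lambda
    theorem does the rest. This is how probabilities are carried from the RTP to other spaces. *)
Lemma tree_data_law {d1 d2} {O1 : measurableType d1} {O2 : measurableType d2}
  (P1 : probability O1 R) (P2 : probability O2 R) xi1 y1 xi2 y2 d nu m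
  (C : set ((word -> E) * (word -> V))) :
  tree_data P1 xi1 y1 d nu m -> tree_data P2 xi2 y2 d nu m ->
  <<s tree_cyls d >> C ->
  P1 ((fun om => (xi1^~ om, y1^~ om)) @^-1` C) =
  P2 ((fun om => (xi2^~ om, y2^~ om)) @^-1` C).
Proof.
move=> H1 H2.
pose T := g_sigma_algebraType (tree_cyls d).
pose f1 om : T := (xi1^~ om, y1^~ om).
pose f2 om : T := (xi2^~ om, y2^~ om).
have mf d0 (O : measurableType d0) (P : probability O R) xi y :
    tree_data P xi y d nu m ->
    measurable_fun setT ((fun om => (xi^~ om, y^~ om)) : O -> T).
  move=> H; apply: measurability => //.
  move=> _ [_ [J [A [uJ JA ->]]] <-]; rewrite setTI preimage_cyl.
  apply: measurable_cyl => j /JA [jd Aj]; apply: (lev_measurable H jd).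
  exact: lev_pull.
have mf1 : f1 \in mfun by rewrite inE; exact: mf H1.
have mf2 : f2 \in mfun by rewrite inE; exact: mf H2.
move=> sC.
apply: (pi_lambda_eq (m1 := distribution P1 (mfun_Sub mf1))
  (m2 := distribution P2 (mfun_Sub mf2)) (G := tree_cyls d)) => //.
- by apply: cyls_setI => i _; exact: lev_setI.
- exact: sub_sigma_algebra.
- by rewrite /= /distribution /pushforward !preimage_setT !probability_setT.
- move=> _ [J [A [uJ JA ->]]]; rewrite /= /distribution /pushforward !preimage_cyl.
  have [Hxi1 Hy1 I1] := H1; have [Hxi2 Hy2 I2] := H2.
  rewrite I1 ?I2//.
  + apply: eq_big_seq => j /JA [jd]; rewrite /lev.
    case: ifPn => [jd' [B mB <-]|jd' [B mB <-]].
      by have [_ /(_ _ mB)] := Hxi1 _ jd'; have [_ /(_ _ mB)] := Hxi2 _ jd' => <-.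
    have {}jd : size j = d by apply/eqP; rewrite eqn_leq jd leqNgt.
    by have [_ /(_ _ mB)] := Hy1 _ jd; have [_ /(_ _ mB)] := Hy2 _ jd => <-.
  + by move=> j /JA [jd Aj]; split => //; exact: lev_pull.
  + by move=> j /JA [jd Aj]; split => //; exact: lev_pull.
Qed.

End tree_data.

(** * Evaluation of trees *)

Section tree_eval.
Context {R : realType} {dT : measure_display} {Theta : measurableType dT}
  {S : ptopologicalType}.
Variable g : Theta -> natinf -> (nat -> borel S) -> borel S.
Hypothesis mg : g_measurable g.
Local Notation E := (Theta * natinf)%type.
Local Notation SS := (borel S * borel S)%type.

(** As [g_measurable] speaks of a fixed number of children, the preimage is cut into the countably
    many events on which that number is constant. *)
Lemma measurable_node {d} {M : measurableType d} (e : M -> E)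
    (y : nat -> M -> borel S) :
  measurable_fun setT e -> (forall j, measurable_fun setT (y j)) ->
  measurable_fun setT (fun x => g (e x).1 (e x).2 (y^~ x)).
Proof.
move=> me my _ A mA; rewrite setTI.
have m1 : measurable_fun setT (fun x => (e x).1).
  by apply: measurableT_comp me; exact: measurable_fst.
have m2 : measurable_fun setT (fun x => (e x).2).
  by apply: measurableT_comp me; exact: measurable_snd.
have ms : measurable_fun setT (fun x => (y^~ x) : seqS S).
  apply: measurability => //.
  move=> _ [_ [j _ [B mB <-]] <-]; rewrite setTI setTI.
  by rewrite -[_ @^-1` _]setTI; exact: my.
have mn n : measurable [set x | (e x).2 = n /\ A (g (e x).1 n (y^~ x))].
  apply: measurableI.
    by rewrite -[X in measurable X]setTI; exact: (m2 measurableT [set n]).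
  have mp : measurable_fun setT (fun x => ((e x).1, (y^~ x) : seqS S)).
    exact: measurable_fun_pair.
  by have := measurableT_comp (@mg n) mp; move=> /(_ measurableT A mA);
    rewrite setTI.
have -> : (fun x => g (e x).1 (e x).2 (y^~ x)) @^-1` A =
    [set x | (e x).2 = None /\ A (g (e x).1 None (y^~ x))] `|`
    \bigcup_k [set x | (e x).2 = Some k /\ A (g (e x).1 (Some k) (y^~ x))].
  apply/seteqP; split => x /=.
    case E2 : (e x).2 => [k|] H; last by left.
    by right; exists k.
  by case=> [[-> //]|[k _ [-> //]]].
by apply: measurableU => //; exact: bigcup_measurable.
Qed.

(** Peeling off the first letter makes the recursion structural in the depth, whereas
    [invariant_RTP] adds letters at the end; [rtp_eval] reconciles the two. *)
Fixpoint ev (d : nat) (e : word -> E) (y : word -> borel S) : borel S :=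
  match d with
  | 0 => y [::]
  | d'.+1 => g (e [::]).1 (e [::]).2
      (fun j => ev d' (fun w => e (j :: w)) (fun w => y (j :: w)))
  end.

Definition ev2 d (e : word -> E) (y : word -> SS) : SS :=
  (ev d e (fun w => (y w).1), ev d e (fun w => (y w).2)).

Lemma measurable_ev {d} {M : measurableType d} n (e : word -> M -> E)
    (y : word -> M -> borel S) :
  (forall w, (size w < n)%N -> measurable_fun setT (e w)) ->
  (forall w, size w = n -> measurable_fun setT (y w)) ->
  measurable_fun setT (fun x => ev n (e^~ x) (y^~ x)).
Proof.
elim: n e y => [|n IH] e y me my /=; first exact: my.
apply: (@measurable_node _ _ (fun x => e [::] x)
  (fun j x => ev n (fun w => e (j :: w) x) (fun w => y (j :: w) x))).
  exact: me.
move=> j; apply: (IH (fun w => e (j :: w)) (fun w => y (j :: w))) => w wn.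
  exact: me.
by apply: my; rewrite /= wn.
Qed.

Lemma measurable_ev2 {d} {M : measurableType d} n (e : word -> M -> E)
    (y : word -> M -> SS) :
  (forall w, (size w < n)%N -> measurable_fun setT (e w)) ->
  (forall w, size w = n -> measurable_fun setT (y w)) ->
  measurable_fun setT (fun x => ev2 n (e^~ x) (y^~ x)).
Proof.
move=> me my; apply: measurable_fun_pair.
  apply: (measurable_ev (y := fun w x => (y w x).1)) => // w /my.
  by apply: measurableT_comp; exact: measurable_fst.
apply: (measurable_ev (y := fun w x => (y w x).2)) => // w /my.
by apply: measurableT_comp; exact: measurable_snd.
Qed.

Section coordinates.
Context {dV : measure_display} {V : measurableType dV}.
Variable n : nat.

Let M := g_sigma_algebraType (@tree_cyls _ E _ V n).

Lemma measurable_coord1 w : (size w < n)%N ->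
  measurable_fun setT ((fun t => t.1 w) : M -> E).
Proof.
move=> wn; apply: measurable_fun_gen => A sA; apply: sub_sigma_algebra.
exists [:: w], (fun _ => A); split => //; last by rewrite cyl_cons cyl_nil setIT.
by move=> j; rewrite inE => /eqP ->; rewrite /lev wn /= ltnW.
Qed.

Lemma measurable_coord2 w : size w = n ->
  measurable_fun setT ((fun t => t.2 w) : M -> V).
Proof.
move=> wn; apply: measurable_fun_gen => A sA; apply: sub_sigma_algebra.
exists [:: w], (fun _ => A); split => //; last by rewrite cyl_cons cyl_nil setIT.
by move=> j; rewrite inE => /eqP ->; rewrite /lev /= wn ltnn.
Qed.

End coordinates.

Section chain.
Variable nu : probability E R.
Local Open Scope ereal_scope.

(* The children of the root span disjoint, hence independent, blocks of the
   tree; the letter [ohead w] names the block of [w]. *)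
Lemma tree_data_children {dO} {O : measurableType dO} (P : probability O R)
    xi (y : word -> O -> SS) d m :
  tree_data P xi y d.+1 nu m ->
  mutual_indep P (fun o : option nat =>
    match o with
    | None => sigma_of (xi [::])
    | Some j => sigma_of (fun om =>
        ev2 d (fun w => xi (j :: w) om) (fun w => y (j :: w) om))
    end).
Proof.
move=> H; have [_ _ HI] := H; apply/indep_onP.
have := indep_group (kap := @ohead nat) _ _ HI.
move=> /(_ (fun i _ => @lev_setI _ _ _ _ _ _ _ _ _)).
move=> /(_ (fun i di => lev_measurable H di)).
apply: indep_onS => -[j|] _; split => //; last first.
  move=> A sA; apply: sub_sigma_algebra.
  by exists [::] => //; rewrite /lev ltnS leq0n.
apply: gen_measurable_fun.
apply: (@measurable_ev2 _ (g_sigma_algebraType _) d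
  (fun w => xi (j :: w)) (fun w => y (j :: w))).
  move=> w wd; apply: measurable_fun_gen => A sA; apply: sub_sigma_algebra.
  exists (j :: w); first by rewrite /= ltnS (ltnW wd).
  by rewrite /lev /= ltnS wd.
move=> w wd; apply: measurable_fun_gen => A sA; apply: sub_sigma_algebra.
exists (j :: w); first by rewrite /= wd.
by rewrite /lev /= wd ltnn.
Qed.

(** The data of [T2_image] are a tree of depth one whose leaf [[:: j]] carries [Y j]. *)
Lemma tree_data_one {dO} {O : measurableType dO} (P : probability O R)
    (z : O -> E) (Y : nat -> O -> SS) m :
  has_law P z nu -> (forall j, has_law P (Y j) m) ->
  mutual_indep P (fun o : option nat =>
    match o with None => sigma_of z | Some j => sigma_of (Y j) end) ->
  tree_data P (fun=> z) (fun w => Y (head 0%N w)) 1 nu m.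
Proof.
move=> Hz HY /indep_onP HI; split => //.
apply: (indep_on_inj (f := @ohead nat) _ _ HI).
  by move=> [|i [|]] // [|j [|]] //= _ _ [->].
move=> [|i [|]] // _; split => //.
Qed.

(** This makes the relation [T2_image] single-valued: the image law can be computed on any space
    with data of the right laws, not just on the witness. *)
Lemma T2_image_law {dO} {O : measurableType dO} (P : probability O R)
    (z : O -> E) (Y : nat -> O -> SS) m m' :
  T2_image nu g m m' ->
  has_law P z nu -> (forall j, has_law P (Y j) m) ->
  mutual_indep P (fun o : option nat =>
    match o with None => sigma_of z | Some j => sigma_of (Y j) end) ->
  has_law P (fun om => ev2 1 (fun=> z om) (fun w => Y (head 0%N w) om)) m'.
Proof.
move=> [d0 [Om [Q [xi [N [Y' [H1 H2 H3 H4]]]]]]] Hz HY HI.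
have D1 := tree_data_one Hz HY HI.
have D2 := tree_data_one H1 H2 H3.
split.
  apply: (measurable_ev2 (e := fun=> z) (y := fun w => Y (head 0%N w))) => w _.
    by have [] := Hz.
  by have [] := HY (head 0%N w).
move=> A mA.
have sC : <<s @tree_cyls _ E _ SS 1 >> ((fun t => ev2 1 t.1 t.2) @^-1` A).
  have := @measurable_ev2 _ (g_sigma_algebraType (@tree_cyls _ E _ SS 1)) 1
    (fun w t => t.1 w) (fun w t => t.2 w).
  move=> /(_ (@measurable_coord1 _ _ 1) (@measurable_coord2 _ _ 1)).
  by move=> /(_ measurableT A mA); rewrite setTI.
have := tree_data_law D1 D2 sC.
by have [_ /(_ A mA) <-] := H4.
Qed.

Lemma chain_law {dO} {O : measurableType dO} (P : probability O R)
    xi (y : word -> O -> SS) d (ms : nat -> set SS -> \bar R) :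
  (forall n, T2_image nu g (ms n) (ms n.+1)) ->
  tree_data P xi y d nu (ms 0%N) ->
  has_law P (fun om => ev2 d (xi^~ om) (y^~ om)) (ms d).
Proof.
move=> Hms; elim: d xi y => [|d IH] xi y D.
  have [_ /(_ [::] erefl) [my Py] _] := D.
  rewrite /ev2 /=; split => [|A mA].
    by apply: eq_measurable_fun my => x _ /=; rewrite -surjective_pairing.
  by rewrite -Py//; congr (P _); apply/seteqP; split => x /=;
    rewrite -surjective_pairing.
have HY j := IH _ _ (tree_data_shift j D).
have [/(_ [::] isT) Hxi _ _] := D.
exact: (T2_image_law (Hms d) Hxi HY (tree_data_children D)).
Qed.

(** The decomposition of [chain_law] used in the opposite direction: the root innovation and the
    subtrees of the children witness the relation. *)
Lemma T2_image_step {dO} {O : measurableType dO} (P : probability O R)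
    xi (y : word -> O -> SS) d m m1 m2 :
  tree_data P xi y d.+1 nu m ->
  (forall j, has_law P (fun om =>
     ev2 d (fun w => xi (j :: w) om) (fun w => y (j :: w) om)) m1) ->
  has_law P (fun om => ev2 d.+1 (xi^~ om) (y^~ om)) m2 ->
  T2_image nu g m1 m2.
Proof.
move=> D H1 H2; have [/(_ [::] isT) Hxi _ _] := D.
exists dO, O, P, (fun om => (xi [::] om).1), (fun om => (xi [::] om).2).
exists (fun j om => ev2 d (fun w => xi (j :: w) om) (fun w => y (j :: w) om)).
split => //.
  rewrite (_ : (fun om => ((xi [::] om).1, (xi [::] om).2)) = xi [::])//.
  by apply/funext => om; rewrite -surjective_pairing.
rewrite (_ : (fun om => ((xi [::] om).1, (xi [::] om).2)) = xi [::]).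
  exact: tree_data_children D.
by apply/funext => om; rewrite -surjective_pairing.
Qed.

End chain.
End tree_eval.

(** * Trees on product spaces *)

Section product_data.
Context {R : realType} {d1 d2 : measure_display} {O1 : measurableType d1}
  {O2 : measurableType d2}.
Variables (P1 : probability O1 R) (P2 : probability O2 R).
Local Open Scope ereal_scope.

Lemma product_probE A B : measurable A -> measurable B ->
  (P1 \x P2 : probability (O1 * O2)%type R) (A `*` B) = P1 A * P2 B.
Proof. exact: product_measure1E. Qed.

Lemma indep_prod {I : eqType} (D : set I) F1 F2 :
  (forall i, D i -> F1 i `<=` measurable) ->
  (forall i, D i -> F2 i `<=` measurable) ->
  indep_on P1 D F1 -> indep_on P2 D F2 ->
  indep_on (P1 \x P2) D (fun i => [set A `*` B | A in F1 i & B in F2 i]).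
Proof.
move=> m1 m2 H1 H2 J C uJ HJ.
have : forall j, exists AB : set O1 * set O2, j \in J ->
    [/\ F1 j AB.1, F2 j AB.2 & C j = AB.1 `*` AB.2].
  move=> j; have [/HJ [_ [A FA [B FB <-]]]|_] := boolP (j \in J).
    by exists (A, B).
  by exists (setT, setT).
move=> /choice[f Hf].
have -> : cyl J C = cyl J (fun j => (f j).1) `*` cyl J (fun j => (f j).2).
  apply/seteqP; split => -[x y] /=.
    by move=> H; split => j jJ; have := H j jJ; have [_ _ ->] := Hf _ jJ => -[].
  by move=> [Hx Hy] j jJ; have [_ _ ->] := Hf _ jJ; split; [exact: Hx|exact: Hy].
have mA j : j \in J -> measurable (f j).1.
  by move=> jJ; have [FA _ _] := Hf _ jJ; have [Dj _] := HJ _ jJ; exact: m1 FA.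
have mB j : j \in J -> measurable (f j).2.
  by move=> jJ; have [_ FB _] := Hf _ jJ; have [Dj _] := HJ _ jJ; exact: m2 FB.
rewrite product_probE; [|exact: measurable_cyl..].
rewrite H1//; last first.
  by move=> j jJ; have [FA _ _] := Hf _ jJ; have [Dj _] := HJ _ jJ.
rewrite H2//; last first.
  by move=> j jJ; have [_ FB _] := Hf _ jJ; have [Dj _] := HJ _ jJ.
rewrite -big_split; apply: eq_big_seq => j jJ /=.
have [_ _ ->] := Hf _ jJ.
by rewrite product_probE; [|exact: mA|exact: mB].
Qed.

Lemma has_law_fst {dV} {V : measurableType dV} (X : O1 -> V) m :
  has_law P1 X m -> has_law (P1 \x P2) (fun p => X p.1) m.
Proof.
move=> [mX HX]; split => [|A mA].
  by apply: measurableT_comp mX _; exact: measurable_fst.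
have -> : (fun p : O1 * O2 => X p.1) @^-1` A = X @^-1` A `*` setT.
  by apply/seteqP; split => -[x y] //= [].
rewrite product_probE//; first by rewrite probability_setT mule1 HX.
by rewrite -[_ @^-1` _]setTI; exact: mX.
Qed.

Lemma has_law_snd {dV} {V : measurableType dV} (X : O2 -> V) m :
  has_law P2 X m -> has_law (P1 \x P2) (fun p => X p.2) m.
Proof.
move=> [mX HX]; split => [|A mA].
  by apply: measurableT_comp mX _; exact: measurable_snd.
have -> : (fun p : O1 * O2 => X p.2) @^-1` A = setT `*` X @^-1` A.
  by apply/seteqP; split => -[x y] //= [].
rewrite product_probE//; first by rewrite probability_setT mul1e HX.
by rewrite -[_ @^-1` _]setTI; exact: mX.
Qed.

Lemma has_law_pair {dV dW} {V : measurableType dV} {W : measurableType dW}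
    (X : O1 -> V) (Y : O2 -> W) (m1 : probability V R) (m2 : probability W R) :
  has_law P1 X m1 -> has_law P2 Y m2 ->
  has_law (P1 \x P2) (fun p => (X p.1, Y p.2)) (m1 \x m2).
Proof.
move=> HX HY; have [mX lX] := HX; have [mY lY] := HY.
have mXY : measurable_fun setT (fun p : O1 * O2 => (X p.1, Y p.2)).
  apply: measurable_fun_pair; first by have [] := has_law_fst HX.
  by have [] := has_law_snd HY.
split => // A mA.
have mf : (fun p : O1 * O2 => (X p.1, Y p.2)) \in mfun by rewrite inE.
pose G := [set A `*` B | A in @measurable _ V & B in @measurable _ W].
suff H : forall C, <<s G >> C -> distribution (P1 \x P2) (mfun_Sub mf) C =
    (m1 \x m2 : probability (V * W)%type R) C.
  by apply: H; rewrite -measurable_prod_measurableType.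
apply: pi_lambda_eq.
- move=> _ _ [A1 mA1 [B1 mB1 <-]] [A2 mA2 [B2 mB2 <-]]; rewrite -setXI.
  by exists (A1 `&` A2); [exact: measurableI|exists (B1 `&` B2) => //;
    exact: measurableI].
- by move=> _ [A1 mA1 [B1 mB1 <-]]; exact: measurableX.
- by rewrite /= /distribution /pushforward !preimage_setT !probability_setT.
- move=> _ [A1 mA1 [B1 mB1 <-]]; rewrite /= /distribution /pushforward.
  have -> : mfun_Sub mf @^-1` (A1 `*` B1) = (X @^-1` A1) `*` (Y @^-1` B1) by [].
  transitivity (P1 (X @^-1` A1) * P2 (Y @^-1` B1)).
    apply: product_measure1E; first by rewrite -[_ @^-1` _]setTI; exact: mX.
    by rewrite -[_ @^-1` _]setTI; exact: mY.
  by rewrite lX// lY//; apply/esym; exact: product_measure1E.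
Qed.

End product_data.

Section product_trees.
Context {R : realType} {dE : measure_display} {E : measurableType dE}
  {dV : measure_display} {V : measurableType dV}
  {d1 d2 : measure_display} {O1 : measurableType d1} {O2 : measurableType d2}.
Variables (P1 : probability O1 R) (P2 : probability O2 R).
Variables (nu : probability E R).
Local Open Scope ereal_scope.

Lemma setT_sigma_gen {T : Type} {dU} {U : measurableType dU} (X : T -> U) :
  sigma_gen X setT.
Proof. by exists setT. Qed.

(** The innovations are read on the first space alone while the leaves pair both spaces; this is the
    tree of two coordinates driven by common innovations. *)
Lemma tree_data_prod {dW} {W : measurableType dW}
    (mu1 : probability V R) (mu2 : probability W R) z y1 z2 y2 d :
  tree_data P1 z y1 d nu mu1 -> tree_data P2 z2 y2 d nu mu2 ->
  tree_data (P1 \x P2) (fun w p => z w p.1) (fun w p => (y1 w p.1, y2 w p.2)) d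
    nu (mu1 \x mu2).
Proof.
move=> D1 D2; have [Hz Hy1 I1] := D1; have [_ Hy2 I2] := D2.
split => [w wd|w wd|]; first exact: has_law_fst (Hz w wd).
  exact: has_law_pair (Hy1 w wd) (Hy2 w wd).
(* At inner vertices the second space contributes only the full event, so that rectangles describe
   the innovations of the first. *)
pose F2 w := if (size w < d)%N then [set setT] else sigma_gen (y2 w).
have F2lev w : F2 w `<=` lev z2 y2 d w.
  by rewrite /F2 /lev; case: ifP => _ A // ->; exact: setT_sigma_gen.
have m1 i : (size i <= d)%N -> lev z y1 d i `<=` measurable.
  by move=> id; exact: (lev_measurable D1).
have m2 i : (size i <= d)%N -> F2 i `<=` measurable.
  move=> id; apply: subset_trans (F2lev i) _; exact: (lev_measurable D2).
have I2' : indep_on P2 [set w | (size w <= d)%N] F2 by apply: indep_onS I2.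
have := indep_prod m1 m2 I1 I2'.
move=> /(indep_pi_ext _ _) Hpi.
apply: (indep_onS _ (Hpi _ _)); last 2 first.
- move=> i _ _ _ [A1 fA1 [B1 fB1 <-]] [A2 fA2 [B2 fB2 <-]]; rewrite -setXI.
  exists (A1 `&` A2); first exact: lev_setI.
  exists (B1 `&` B2) => //; move: fB1 fB2; rewrite /F2; case: ifP => _.
    by move=> -> ->; rewrite setTI.
  exact: sigma_gen_setI.
- move=> i id _ [A1 fA1 [B1 fB1 <-]].
  by apply: measurableX; [exact: m1 fA1|exact: m2 fB1].
move=> w wd; split => //; rewrite {1}/lev; case: ifPn => wd'.
  move=> _ [A mA <-]; apply: sub_sigma_algebra.
  exists (z w @^-1` A); first by rewrite /lev wd'; exists A.
  exists setT; first by rewrite /F2 wd'.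
  by apply/seteqP; split => -[x x'] //= [].
apply: gen_measurable_fun; apply: measurable_fun_pair.
  apply: measurable_fun_gen => _ [A mA <-]; apply: sub_sigma_algebra.
  exists (y1 w @^-1` A); first by rewrite /lev (negbTE wd'); exists A.
  exists setT; first by rewrite /F2 (negbTE wd'); exact: setT_sigma_gen.
  by apply/seteqP; split => -[x x'] //= [].
apply: measurable_fun_gen => _ [A mA <-]; apply: sub_sigma_algebra.
exists setT; first by rewrite /lev (negbTE wd'); exact: setT_sigma_gen.
exists (y2 w @^-1` A); first by rewrite /F2 (negbTE wd'); exists A.
by apply/seteqP; split => -[x x'] //= [].
Qed.

(** Fresh leaves from an i.i.d. sequence on another space replace those of a given tree; [pickle] is
    injective, so distinct words receive distinct terms of the sequence. *)
Lemma tree_data_attach {dW} {W : measurableType dW} (m : probability V R) z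
    (y1 : word -> O1 -> W) m1 (Z : nat -> O2 -> V) d :
  tree_data P1 z y1 d nu m1 ->
  (forall j, has_law P2 (Z j) m) -> mutual_indep P2 (fun j => sigma_of (Z j)) ->
  tree_data (P1 \x P2) (fun w p => z w p.1)
    (fun (w : seq nat) p => Z (pickle w) p.2) d nu m.
Proof.
move=> D1 HZ IZ; have [Hz _ I1] := D1.
split => [w wd|w wd|]; [exact: has_law_fst (Hz w wd)|exact: has_law_snd|].
pose F1 w := if (size w < d)%N then sigma_gen (z w) else [set setT].
pose F2 (w : seq nat) := sigma_gen (Z (pickle w)).
have F1lev w : F1 w `<=` lev z y1 d w.
  by rewrite /F1 /lev; case: ifP => _ A // ->; exact: setT_sigma_gen.
have m1' i : (size i <= d)%N -> F1 i `<=` measurable.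
  by move=> id; apply: subset_trans (F1lev i) _; exact: (lev_measurable D1).
have m2' i : (size i <= d)%N -> F2 i `<=` measurable.
  by move=> _; apply: sigma_gen_measurable; have [] := HZ (pickle i).
have I1' : indep_on P1 [set w | (size w <= d)%N] F1 by apply: indep_onS I1.
have I2' : indep_on P2 [set w | (size w <= d)%N] F2.
  move/indep_onP: IZ; apply: (indep_on_inj (f := @pickle (seq nat))) => //.
    by move=> i j _ _; apply: (pcan_inj pickleK).
  by move=> i _; split => //; exact: subset_refl.
apply: indep_onS (indep_prod m1' m2' I1' I2') => w wd; split => //.
rewrite /lev /F1 /F2; case: ifP => _ _ [A mA <-].
  exists (z w @^-1` A); first by exists A.
  exists setT; first exact: setT_sigma_gen.
  by apply/seteqP; split => -[x x'] //= [].
exists setT => //; exists (Z (pickle w) @^-1` A); first by exists A.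
by apply/seteqP; split => -[x x'] //= [].
Qed.

Lemma tree_data_fst {dW} {W : measurableType dW}
    (m : set (V * W) -> \bar R) (mu : set V -> \bar R) z y d :
  (forall A, measurable A -> m (A `*` setT) = mu A) ->
  tree_data P1 z y d nu m -> tree_data P1 z (fun w om => (y w om).1) d nu mu.
Proof.
move=> mmu [Hz Hy HI]; split => // [w wd|].
  have [my lmy] := Hy w wd; split => [|A mA].
    by apply: measurableT_comp my; exact: measurable_fst.
  rewrite -mmu// -lmy; last exact: measurableX.
  by congr (P1 _); apply/seteqP; split => x //= [].
apply: indep_onS HI => w wd; split => //; rewrite /lev; case: ifP => _.
  exact: subset_refl.
move=> _ [A mA <-]; exists (A `*` setT); first exact: measurableX.
by apply/seteqP; split => x //= [].
Qed.

Lemma tree_data_snd {dW} {W : measurableType dW}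
    (m : set (V * W) -> \bar R) (mu : set W -> \bar R) z y d :
  (forall A, measurable A -> m (setT `*` A) = mu A) ->
  tree_data P1 z y d nu m -> tree_data P1 z (fun w om => (y w om).2) d nu mu.
Proof.
move=> mmu [Hz Hy HI]; split => // [w wd|].
  have [my lmy] := Hy w wd; split => [|A mA].
    by apply: measurableT_comp my; exact: measurable_snd.
  rewrite -mmu// -lmy; last exact: measurableX.
  by congr (P1 _); apply/seteqP; split => x //= [].
apply: indep_onS HI => w wd; split => //; rewrite /lev; case: ifP => _.
  exact: subset_refl.
move=> _ [A mA <-]; exists (setT `*` A); first exact: measurableX.
by apply/seteqP; split => x //= [].
Qed.

End product_trees.

(** * The RTP as a family of finite trees *)

Section rtp.
Context {R : realType} {dT : measure_display} {Theta : measurableType dT}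
  {S : ptopologicalType} {dO : measure_display} {Omega : measurableType dO}.
Variables (nu : probability (Theta * natinf)%type R)
  (g : Theta -> natinf -> (nat -> borel S) -> borel S)
  (P : probability Omega R) (mu : probability (borel S) R)
  (xi : word -> Omega -> Theta) (N : word -> Omega -> natinf)
  (X : word -> Omega -> borel S).
Hypothesis rtp : invariant_RTP P nu g mu xi N X.
Local Open Scope ereal_scope.

(** [invariant_RTP] makes the innovations independent of each other, and the values of level [d]
    independent together with the past [G_lt]. Gathering the inner events of a cylinder into one
    event of the past, at index [None], joins the two factorizations. *)
Lemma rtp_tree_data d : tree_data P (xiN xi N) X d nu mu.
Proof.
have [Hz Iz HX _ HI] := rtp; split => // J A uJ HJ.
pose J1 := [seq w <- J | (size w < d)%N].
pose J2 := [seq w <- J | ~~ (size w < d)%N].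
have pJ : perm_eq J (J1 ++ J2) by rewrite perm_sym perm_filterC.
have J1A j : j \in J1 -> sigma_of (xiN xi N j) (A j).
  by rewrite mem_filter => /andP[jd /HJ [_]]; rewrite /lev jd.
have J2A j : j \in J2 -> size j = d /\ sigma_of (X j) (A j).
  rewrite mem_filter => /andP[jd /HJ [jd']]; rewrite /lev (negbTE jd); split => //.
  by apply/eqP; rewrite eqn_leq jd' leqNgt.
pose A' (o : option word) := if o is Some w then A w else cyl J1 A.
have -> : cyl J A = cyl (None :: map Some J2) A'.
  rewrite cyl_cons (@eq_cyl _ _ J (J1 ++ J2) A A)//; last exact: perm_mem.
  rewrite cyl_cat; congr (_ `&` _).
  apply/seteqP; split => w Hw j.
    by move=> /mapP[i iJ ->]; exact: Hw.
  by move=> jJ; apply: (Hw (Some j)); exact: map_f.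
rewrite (perm_big _ pJ) big_cat /=.
have <- : P (cyl J1 A) = \prod_(i <- J1) P (A i).
  by apply: Iz => //; exact: filter_uniq.
have := HI d (None :: map Some J2) A'.
rewrite big_cons big_map; apply.
  rewrite /=; apply/andP; split; first by apply/mapP => -[].
  by rewrite map_inj_uniq ?filter_uniq// => i j [].
move=> j; rewrite inE => /predU1P[->|/mapP[i /J2A[id iA] ->]]; last first.
  by rewrite id eqxx.
rewrite /A' /G_lt.
apply: (@measurable_cyl _ (g_sigma_algebraType _)) => j' j'J.
apply: sub_sigma_algebra; exists j'; last exact: J1A.
by move: j'J; rewrite mem_filter => /andP[].
Qed.

Lemma rtp_eval d : {ae P, forall om,
  X [::] om = ev g d (fun w => xiN xi N w om) (fun w => X w om)}.
Proof.
have [_ _ _ HX _] := rtp.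
(* Words are countable, so the recursion holds at all vertices simultaneously off one null set. *)
have : {ae P, forall om, forall n (w := CodeSeq.decode n),
    X w om = g (xi w om) (N w om) (fun j => X (rcons w j) om)}.
  by apply: ae_foralln => n; exact: HX.
apply: filterS => om H.
have {}H w : X w om = g (xi w om) (N w om) (fun j => X (rcons w j) om).
  by have := H (CodeSeq.code w); rewrite CodeSeq.codeK.
(* The induction moves to the children, hence the statement for the subtree at an arbitrary [w]. *)
suff E w : X w om =
    ev g d (fun v => xiN xi N (w ++ v) om) (fun v => X (w ++ v) om).
  exact: E [::].
elim: d w => [|d IH] w /=; first by rewrite cats0.
rewrite H /xiN /= cats0; congr (g _ _ _); apply/funext => j.
by rewrite IH; congr (ev g d _ _); apply/funext => v; rewrite cat_rcons.
Qed.

Definition rtp_pair (w : word) (p : Omega * Omega) : borel S * borel S :=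
  (X w p.1, X w p.2).

Lemma rtp_pair_tree_data d :
  tree_data (P \x P) (fun w p => xiN xi N w p.1) rtp_pair d nu (mu \x mu).
Proof. exact: tree_data_prod (rtp_tree_data d) (rtp_tree_data d). Qed.

End rtp.

(** * Events of finitely many generations *)

Section past.
Context {R : realType} {dE : measure_display} {E : measurableType dE}.
Local Open Scope ereal_scope.

(** On the canonical space of innovations, so that an event found on the RTP can be read off any
    other tree. *)
Definition past (d : nat) : set (set (word -> E)) :=
  \bigcup_(w in [set w : word | (size w < d)%N])
    sigma_gen (fun e : word -> E => e w).

Lemma pastS d d' : (d <= d')%N -> <<s past d >> `<=` <<s past d' >>.
Proof.
move=> dd; apply: sub_smallest2r; first exact: smallest_sigma_algebra.
move=> A [w wd Aw]; exists w => //.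
exact: leq_trans dd.
Qed.

Lemma measurable_past_fun {dM} {M : measurableType dM} (z : word -> M -> E) d :
  (forall w, (size w < d)%N -> measurable_fun setT (z w)) ->
  forall C, <<s past d >> C -> measurable [set x | C (z^~ x)].
Proof.
move=> mz C sC.
have mf : measurable_fun setT ((fun x => z^~ x) : M -> g_sigma_algebraType (past d)).
  apply: measurability => //.
  move=> _ [_ [w wd [A mA <-]] <-]; rewrite setTI.
  by rewrite -[_ @^-1` _]setTI; exact: mz.
by have := mf measurableT C sC; rewrite setTI.
Qed.

Definition symd {T : Type} (A B : set T) := (A `\` B) `|` (B `\` A).

Lemma measurable_symd {d} {M : measurableType d} (A B : set M) :
  measurable A -> measurable B -> measurable (symd A B).
Proof. by move=> mA mB; apply: measurableU; exact: measurableD. Qed.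

Variables (dO : measure_display) (O : measurableType dO) (P : probability O R).
Variable z : word -> O -> E.
Hypothesis mz : forall w, measurable_fun setT (z w).
Let zp C := [set om | C (z^~ om)].

Let mzp d C : <<s past d >> C -> measurable (zp C).
Proof. by apply: measurable_past_fun => w _. Qed.

Let AP : set (set O) := [set B | measurable B /\ forall e : R, (0 < e)%R ->
  exists d C, <<s past d >> C /\ P (symd B (zp C)) <= e%:E].

Let AP0 : AP set0.
Proof.
split => // e e0; exists 0%N, set0; split; first exact: sigma_algebra0.
rewrite (_ : symd _ _ = set0) ?measure0 ?lee_fin ?ltW//.
by apply/seteqP; split => x; rewrite /symd /zp /=; tauto.
Qed.

Let APU A B : AP A -> AP B -> AP (A `|` B).
Proof.
move=> [mA HA] [mB HB]; split; first exact: measurableU.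
move=> e e0; have e2 : (0 < e / 2)%R by rewrite divr_gt0.
have [d1 [C1 [sC1 P1]]] := HA _ e2; have [d2 [C2 [sC2 P2]]] := HB _ e2.
have sC1' := pastS (leq_maxl d1 d2) sC1; have sC2' := pastS (leq_maxr d1 d2) sC2.
exists (maxn d1 d2), (C1 `|` C2); split.
  exact: (@measurableU _ (g_sigma_algebraType (past (maxn d1 d2)))).
have mz1 := mzp sC1; have mz2 := mzp sC2.
rewrite (splitr e) EFinD; apply: le_trans (leeD P1 P2).
apply: le_trans (measureU2 _ _ _); try exact: measurable_symd.
apply: le_measure; rewrite ?inE.
- by apply: measurable_symd; apply: measurableU.
- by apply: measurableU; apply: measurable_symd.
- move=> x; rewrite /symd /zp /=; tauto.
Qed.

(** For a countable union, half of [e] pays for truncating it to finitely many events, by continuity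
    from below, and half for approximating the truncation, which [APU] allows. *)
Let AP_sigma : sigma_algebra setT AP.
Proof.
split => //.
- move=> A [mA HA]; split; first exact: measurableD.
  move=> e /HA[d [C [sC PC]]]; exists d, (~` C); split; first exact: sigma_algebraC.
  rewrite (_ : symd _ _ = symd A (zp C))//; apply/seteqP; split => x.
    rewrite /symd /zp /= => -[[[_ ?] /contrapT ?]|[? /not_andP[//|/contrapT ?]]].
      by right.
    by left.
  by rewrite /symd /zp /= => -[[? ?]|[? ?]]; [right|left]; tauto.
- move=> F HF; have mF n : measurable (F n) by have [] := HF n.
  have mU : measurable (\bigcup_k F k) by exact: bigcup_measurable.
  split => // e e0; have e2 : (0 < e / 2)%R by rewrite divr_gt0.
  pose U n := \big[setU/set0]_(k < n) F k.
  have APUn n : AP (U n).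
    rewrite /U; elim: n => [|n IH]; first by rewrite big_ord0.
    by rewrite big_ord_recr; exact: APU.
  have mUn n : measurable (U n) by have [] := APUn n.
  have [n Hn] : exists n, P ((\bigcup_k F k) `\` U n) <= (e / 2)%:E.
    have cv : P (U n) @[n --> \oo] --> P (\bigcup_k F k).
      have -> : \bigcup_k F k = \bigcup_n U n.
        rewrite /U eqEsubset; split => x [k _].
          by move=> Fx; exists k.+1 => //; rewrite big_ord_recr; right.
        by rewrite -bigcup_mkord => -[i _ Fx]; exists i.
      apply: nondecreasing_cvg_mu => //; first exact: bigcup_measurable.
      by move=> i j ij; apply/subsetPset/subset_bigsetU.
    have fU : P (\bigcup_k F k) \is a fin_num by rewrite fin_num_measure.
    have fUn n : P (U n) \is a fin_num by rewrite fin_num_measure.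
    move: cv; rewrite -(fineK fU) => /fine_cvgP[_] /cvgrPdist_lt /(_ _ e2).
    move=> [n _ /(_ n (leqnn n))] /= Hn; exists n.
    have sub : U n `<=` \bigcup_k F k.
      by rewrite /U -bigcup_mkord => x [i _ Fi]; exists i.
    rewrite measureD//; last by rewrite ltey_eq fU.
    rewrite /= setIC (setIidl sub) -(fineK fU) -(fineK (fUn n)) -EFinB lee_fin.
    by apply: le_trans (ltW Hn); exact: ler_norm.
  have [_ /(_ _ e2)[d [C [sC PC]]]] := APUn n.
  exists d, C; split => //; have mzC := mzp sC.
  rewrite (splitr e) EFinD; apply: le_trans (leeD Hn PC).
  apply: le_trans (measureU2 _ _ _); last 2 first.
  + exact: measurableD.
  + exact: measurable_symd.
  apply: le_measure; rewrite ?inE.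
  + exact: measurable_symd.
  + by apply: measurableU; [exact: measurableD|exact: measurable_symd].
  + move=> x; rewrite /symd /= => -[[Fx Cx]|[Cx Fx]].
      by have [Ux|Ux] := pselect (U n x); [right; left|left].
    right; right; split => // Ux; apply: Fx; move: Ux.
    by rewrite /U -bigcup_mkord => -[i _ Fi]; exists i.
Qed.

Lemma past_approx B : <<s \bigcup_(w in [set: word]) sigma_gen (z w) >> B ->
  forall e : R, (0 < e)%R ->
  exists d C, <<s past d >> C /\ P (symd B [set om | C (z^~ om)]) <= e%:E.
Proof.
move=> sB; suff /(_ _ sB)[] : <<s \bigcup_(w in [set: word]) sigma_gen (z w) >> `<=` AP.
  by [].
apply: smallest_sub => // _ [w _ [A mA <-]].
split; first by rewrite -[_ @^-1` _]setTI; exact: mz.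
(* The vertex [w] enters the past only at depth [(size w).+1]; the approximation is then exact. *)
move=> e e0; exists (size w).+1, [set f | A (f w)]; split.
  by apply: sub_sigma_algebra; exists w => //=; exists A.
by rewrite /symd setDv setU0 measure0 lee_fin ltW.
Qed.

End past.

(** * Transfer of endogeny from the RTP to other trees *)

Section transfer.
Context {R : realType} {dT : measure_display} {Theta : measurableType dT}
  {S : ptopologicalType} {dO : measure_display} {Omega : measurableType dO}.
Variables (nu : probability (Theta * natinf)%type R)
  (g : Theta -> natinf -> (nat -> borel S) -> borel S)
  (P : probability Omega R) (mu : probability (borel S) R)
  (xi : word -> Omega -> Theta) (N : word -> Omega -> natinf)
  (X : word -> Omega -> borel S).
Hypothesis mg : g_measurable g.
Hypothesis rtp : invariant_RTP P nu g mu xi N X.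
Local Notation E := (Theta * natinf)%type.
Local Notation SS := (borel S * borel S)%type.
Local Notation z := (xiN xi N).
Local Open Scope ereal_scope.

Lemma tree_cyls_ev n A : measurable A ->
  <<s @tree_cyls _ E _ (borel S) n >> [set t | A (ev g n t.1 t.2)].
Proof.
move=> mA.
have := @measurable_ev _ _ _ _ mg _ (g_sigma_algebraType (@tree_cyls _ E _ (borel S) n)) n
    (fun w t => t.1 w) (fun w t => t.2 w).
move=> /(_ (@measurable_coord1 _ _ _ _ n) (@measurable_coord2 _ _ _ _ n)).
by move=> /(_ measurableT A mA); rewrite setTI.
Qed.

Lemma tree_cyls_past n d C : (d <= n)%N -> <<s past d >> C ->
  <<s @tree_cyls _ E _ (borel S) n >> [set t | C t.1].
Proof.
move=> dn sC.
apply: (@measurable_past_fun _ _ _ (g_sigma_algebraType (@tree_cyls _ E _ (borel S) n))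
  (fun w t => t.1 w) d) => // w wd.
by apply: measurable_coord1; exact: leq_trans dn.
Qed.

Lemma measurable_z w : measurable_fun setT (z w).
Proof. by have [Hz _ _ _ _] := rtp; have [] := Hz w. Qed.

Lemma measurable_X w : measurable_fun setT (X w).
Proof. by have [_ _ HX _ _] := rtp; have [] := HX w. Qed.

Lemma measurable_evX n : measurable_fun setT (fun om => ev g n (z^~ om) (X^~ om)).
Proof.
by apply: measurable_ev => // w _; [exact: measurable_z|exact: measurable_X].
Qed.

Lemma ae_eq_prob (A B : set Omega) : measurable A -> measurable B ->
  {ae P, forall om, A om <-> B om} -> P A = P B.
Proof.
move=> mA mB [D [mD PD HD]]; apply/eqP; rewrite eq_le.
have H U V : measurable U -> measurable V -> U `<=` V `|` D -> P U <= P V.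
  move=> mU mV sub; rewrite -[leRHS]adde0 -PD.
  apply: le_trans (measureU2 _ _ _) => //.
  by apply: le_measure; rewrite ?inE//; exact: measurableU.
apply/andP; split; apply: H => // x Ax; rewrite /setU /=.
  have [Dx|Dx] := pselect (D x); [by right|left].
  by have /contrapT [H _] : ~ ~ (A x <-> B x) := contra_not (@HD x) Dx; exact: H.
have [Dx|Dx] := pselect (D x); [by right|left].
by have /contrapT [_ H] : ~ ~ (A x <-> B x) := contra_not (@HD x) Dx; exact: H.
Qed.

(** On the RTP, evaluation at depth [n] returns the root almost surely, and the root has law [mu];
    other trees have the same joint law. *)
Lemma rtp_law {d2} {O2 : measurableType d2} (P2 : probability O2 R) xi2 y2 n :
  tree_data P2 xi2 y2 n nu mu ->
  has_law P2 (fun om => ev g n (xi2^~ om) (y2^~ om)) mu.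
Proof.
move=> D2; have [Hx Hy _] := D2; split.
  apply: measurable_ev => // w wn; first by have [] := Hx w wn.
  by have [] := Hy w wn.
move=> A mA.
have := tree_data_law D2 (rtp_tree_data rtp n) (tree_cyls_ev mA).
rewrite /preimage /= => ->.
have [_ _ HX _ _] := rtp; have [mX <-//] := HX [::].
apply: ae_eq_prob.
- by rewrite -[X in measurable X]setTI; exact: measurable_evX.
- by rewrite -[X in measurable X]setTI; exact: mX.
- by apply: filterS (rtp_eval rtp n) => om /= ->.
Qed.

Lemma marginals_ev2 {d2} {O2 : measurableType d2} (P2 : probability O2 R) xi2
    (y2 : word -> O2 -> SS) n (m m' : set SS -> \bar R) :
  marginals_eq mu m -> tree_data P2 xi2 y2 n nu m ->
  has_law P2 (fun om => ev2 g n (xi2^~ om) (y2^~ om)) m' -> marginals_eq mu m'.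
Proof.
move=> mm D2 [my ly] A mA.
have D21 := tree_data_fst (fun A mA => (mm A mA).1) D2.
have D22 := tree_data_snd (fun A mA => (mm A mA).2) D2.
have [_ /(_ A mA) l1] := rtp_law D21; have [_ /(_ A mA) l2] := rtp_law D22.
split; [rewrite -l1 -ly|rewrite -l2 -ly].
- by congr (P2 _); apply/seteqP; split => x //= [].
- exact: measurableX.
- by congr (P2 _); apply/seteqP; split => x //= [].
- exact: measurableX.
Qed.

(** Both coordinates share the innovations, hence the past event [C] that approximates the root on
    the RTP. If one lies in [A] and the other does not, one of them disagrees with [C]. Each
    coordinate alone is a tree with leaf law [mu], so each disagreement is as probable as on the
    RTP, at most e/2. The depth [d] is chosen before the tree. *)
Lemma endogenous_transfer A : endogenous P xi N X -> measurable A ->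
  forall e : R, (0 < e)%R -> exists d, forall n, (d <= n)%N ->
  forall d2 (O2 : measurableType d2) (P2 : probability O2 R) xi2
    (y2 : word -> O2 -> SS) (m : set SS -> \bar R),
  marginals_eq mu m -> tree_data P2 xi2 y2 n nu m ->
  P2 ((fun om => ev2 g n (xi2^~ om) (y2^~ om)) @^-1` (A `*` ~` A)) <= e%:E.
Proof.
move=> [Y [GY XY]] mA e e0.
have e2 : (0 < e / 2)%R by rewrite divr_gt0.
have [d [C [sC PC]]] := past_approx P measurable_z (GY A mA) e2.
exists d => n dn d2 O2 P2 xi2 y2 m mm D2.
pose D : set ((word -> E) * (word -> borel S)) :=
  symd [set t | A (ev g n t.1 t.2)] [set t | C t.1].
have sD : <<s @tree_cyls _ E _ (borel S) n >> D.
  apply: (@measurable_symd _ (g_sigma_algebraType (@tree_cyls _ E _ (borel S) n))).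
    exact: tree_cyls_ev.
  exact: tree_cyls_past dn sC.
have mY : measurable (Y @^-1` A).
  apply: sigma_gen_sub (GY A mA) => _ [w _ [B mB <-]].
  by rewrite -[_ @^-1` _]setTI; exact: measurable_z.
have mC : measurable [set om | C (z^~ om)].
  by apply: (measurable_past_fun _ sC) => w _; exact: measurable_z.
have mev : measurable [set om | A (ev g n (z^~ om) (X^~ om))].
  by rewrite -[X in measurable X]setTI; exact: measurable_evX.
have PD y : tree_data P2 xi2 y n nu mu ->
    P2 ((fun om => (xi2^~ om, y^~ om)) @^-1` D) <= (e / 2)%:E /\
    measurable ((fun om => (xi2^~ om, y^~ om)) @^-1` D).
  move=> Dy; split.
    rewrite (tree_data_law Dy (rtp_tree_data rtp n) sD).
    apply: le_trans PC; rewrite le_eqVlt; apply/orP; left; apply/eqP.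
    apply: ae_eq_prob; [exact: measurable_symd|exact: measurable_symd|].
    apply: filterS2 (rtp_eval rtp n) XY => om e1 e3.
    by rewrite /D /symd /preimage /setU /setD /mkset /= -e1 e3.
  have [Hx Hy _] := Dy; apply: measurable_symd.
    rewrite -[X in measurable X]setTI; apply: measurable_ev => // w wn.
      by have [] := Hx w wn.
    by have [] := Hy w wn.
  apply: (measurable_past_fun _ sC) => w wd.
  by have [] := Hx w (leq_trans wd dn).
have [P1 m1] := PD _ (tree_data_fst (fun A mA => (mm A mA).1) D2).
have [P2' m2] := PD _ (tree_data_snd (fun A mA => (mm A mA).2) D2).
rewrite (splitr e) EFinD; apply: le_trans (leeD P1 P2').
apply: le_trans (measureU2 _ _ _) => //.
apply: le_measure; rewrite ?inE; last 2 first.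
- exact: measurableU.
- move=> x [Ax Bx].
  by have [Cx|Cx] := pselect (C (xi2^~ x)); [right; right|left; left].
rewrite -[X in measurable X]setTI; apply: measurable_ev2 => //.
- by move=> w wn; have [Hx _ _] := D2; have [] := Hx w wn.
- by move=> w wn; have [_ Hy _] := D2; have [] := Hy w wn.
- by apply: measurableX => //; exact: measurableC.
Qed.

(** T2 relates laws one generation at a time, while the transfer needs an actual tree of depth [n]
    with these leaves. *)
Definition realizable (m : set SS -> \bar R) (n : nat) : Prop :=
  exists d2 (O2 : measurableType d2) (P2 : probability O2 R) xi2
    (y2 : word -> O2 -> SS), tree_data P2 xi2 y2 n nu m.

(** A pair in A x B whose first point is outside B falls in the piece ~B x B; a pair whose first
    point is in A and B and whose second is outside B falls in B x ~B. There is no other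
    discrepancy. *)
Lemma marginals_rect (m : probability SS R) A B (e : R) :
  marginals_eq mu m -> measurable A -> measurable B ->
  m (B `*` ~` B) <= e%:E -> m (~` B `*` B) <= e%:E ->
  (`|fine (mu (A `&` B)) - fine (m (A `*` B))| <= e)%R.
Proof.
move=> mm mA mB h1 h2.
have mAB : measurable (A `*` B) by exact: measurableX.
have mI : measurable (A `&` B) by exact: measurableI.
have mIT : measurable ((A `&` B) `*` [set: borel S]) by exact: measurableX.
have mB1 : measurable (B `*` ~` B) by apply: measurableX => //; exact: measurableC.
have mB2 : measurable (~` B `*` B) by apply: measurableX => //; exact: measurableC.
rewrite -(mm _ mI).1 ler_distl; apply/andP; split.
  rewrite lerBlDr -lee_fin EFinD !fineK ?fin_num_measure//.
  apply: le_trans (leeD (lexx _) h2).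
  apply: le_trans (measureU2 _ _ _) => //.
  apply: le_measure; rewrite ?inE//; first exact: measurableU.
  move=> [x y] /= [Ax By]; rewrite /setU /setX /mkset /=.
  by have [Bx|Bx] := pselect (B x); [left|right].
rewrite -lee_fin EFinD !fineK ?fin_num_measure//.
apply: le_trans (leeD (lexx _) h1).
apply: le_trans (measureU2 _ _ _) => //.
apply: le_measure; rewrite ?inE//; first exact: measurableU.
move=> [x y] /= [[Ax Bx] _]; rewrite /setU /setX /mkset /=.
by have [By|By] := pselect (B y); [left|right].
Qed.

Lemma endogenous_rect_cvg (ms : nat -> probability SS R) A B :
  endogenous P xi N X -> marginals_eq mu (ms 0%N) ->
  (forall n, T2_image nu g (ms n) (ms n.+1)) ->
  (forall n, realizable (ms 0%N) n) ->
  measurable A -> measurable B ->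
  (fun n => fine (ms n (A `*` B))) @ \oo --> fine (mu (A `&` B)).
Proof.
move=> endo mm Hms Hr mA mB.
apply/cvgrPdist_le => e e0.
have [d1 H1] := endogenous_transfer endo mB e0.
(* The complement of [B] handles the other off-diagonal piece. *)
have [d2 H2] := endogenous_transfer endo (measurableC mB) e0.
near=> n.
have [d3 [Om2 [P2 [xi2 [y2 D2]]]]] := Hr n.
have [my ly] := chain_law mg (ms := ms) Hms D2.
have mmn : marginals_eq mu (ms n) := marginals_ev2 mm D2 (conj my ly).
apply: marginals_rect => //.
- rewrite -ly; last by apply: measurableX => //; exact: measurableC.
  by apply: H1 mm D2; near: n; exists d1.
- rewrite -ly; last by apply: measurableX => //; exact: measurableC.
  have : (d2 <= n)%N by near: n; exists d2.
  by move=> /H2 /(_ _ _ _ _ _ _ mm D2); rewrite setCK.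
Unshelve. all: end_near.
Qed.

End transfer.

(** * Expectations of bounded functions *)

Section expectation.
Context {R : realType} {d : measure_display} {T : measurableType d}.
Implicit Types (m : probability T R) (f h : T -> R).

Definition bmeas f := measurable_fun setT f /\ exists M : R, forall x, `|f x| <= M.

Definition Ex m f : R := \int[m]_x f x.

Lemma bmeas_integrable m f : bmeas f -> m.-integrable setT (EFin \o f).
Proof.
move=> [mf [M HM]]; apply: measurable_bounded_integrable => //.
  by rewrite ltey_eq fin_num_measure.
exists M; split; first exact: num_real.
by move=> y My x _; apply: le_trans (HM x) (ltW My).
Qed.

Lemma EFin_Ex m f : bmeas f -> (Ex m f)%:E = (\int[m]_x (f x)%:E)%E.
Proof.
move=> bf; rewrite /Ex /Rintegral fineK//.
exact: integrable_fin_num (bmeas_integrable m bf).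
Qed.

Lemma bmeasD f h : bmeas f -> bmeas h -> bmeas (fun x => f x + h x).
Proof.
move=> [mf [M HM]] [mh [M' HM']]; split; first exact: measurable_funD.
by exists (M + M') => x; rewrite (le_trans (ler_normD _ _))// lerD.
Qed.

Lemma bmeasM f h : bmeas f -> bmeas h -> bmeas (fun x => f x * h x).
Proof.
move=> [mf [M HM]] [mh [M' HM']]; split; first exact: measurable_funM.
by exists (M * M') => x; rewrite normrM ler_pM.
Qed.

Lemma bmeas_cst c : bmeas (fun=> c).
Proof. by split; [exact: measurable_cst|exists `|c|]. Qed.

Lemma bmeasZ c f : bmeas f -> bmeas (fun x => c * f x).
Proof. exact: bmeasM (bmeas_cst c). Qed.

Lemma bmeasB f h : bmeas f -> bmeas h -> bmeas (fun x => f x - h x).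
Proof.
move=> bf bh; rewrite (_ : (fun x => _) = (fun x => f x + -1 * h x)).
  exact: bmeasD bf (bmeasZ _ bh).
by apply/funext => x; rewrite mulN1r.
Qed.

Lemma bmeas_indic (A : set T) : measurable A -> bmeas (\1_A : T -> R).
Proof.
move=> mA; split; first exact: measurable_indic.
by exists 1 => x; rewrite indicE; case: (_ \in _); rewrite ?normr1 ?normr0.
Qed.

Lemma ExD m f h : bmeas f -> bmeas h -> Ex m (fun x => f x + h x) = Ex m f + Ex m h.
Proof. by move=> bf bh; rewrite /Ex RintegralD//; exact: bmeas_integrable. Qed.

Lemma ExB m f h : bmeas f -> bmeas h -> Ex m (fun x => f x - h x) = Ex m f - Ex m h.
Proof. by move=> bf bh; rewrite /Ex RintegralB//; exact: bmeas_integrable. Qed.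

Lemma ExZ m c f : bmeas f -> Ex m (fun x => c * f x) = c * Ex m f.
Proof. by move=> bf; rewrite /Ex RintegralZl//; exact: bmeas_integrable. Qed.

Lemma Ex_cst m c : Ex m (fun=> c) = c.
Proof. by rewrite /Ex Rintegral_cst//= probability_setT mulr1. Qed.

Lemma Ex_le m f h : bmeas f -> bmeas h -> (forall x, f x <= h x) -> Ex m f <= Ex m h.
Proof.
by move=> bf bh fh; rewrite /Ex le_Rintegral//; exact: bmeas_integrable.
Qed.

Lemma Ex_indic m (A : set T) : measurable A -> Ex m (\1_A) = fine (m A).
Proof. by move=> mA; rewrite /Ex /Rintegral integral_indic// setIT. Qed.

(** Layer-cake approximation: each of the levels r, 2r, ..., Kr lying below [f x] contributes r, so
    that the expectation is a sum of measures of superlevel sets. *)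
Definition stepf (K : nat) (r : R) f (x : T) : R :=
  \sum_(i < K) r * \1_[set y | i.+1%:R * r < f y] x.

Lemma stepfS K r f x :
  stepf K.+1 r f x = stepf K r f x + r * \1_[set y | K.+1%:R * r < f y] x.
Proof. by rewrite /stepf big_ord_recr. Qed.

(** The middle clause serves the induction: it gives the exact value of the sum when [f x] lies
    above the last level treated. *)
Lemma stepfP K r f x : 0 < r -> 0 <= f x ->
  [/\ stepf K r f x <= f x, K%:R * r < f x -> stepf K r f x = K%:R * r
    & f x <= K%:R * r -> f x <= stepf K r f x + r].
Proof.
move=> r0 f0; elim: K => [|K [IH1 IH2 IH3]].
  by rewrite /stepf big_ord0; split; lra.
rewrite stepfS indicE.
have -> : K.+1%:R = K%:R + 1 :> R by rewrite -natr1.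
have E : (x \in [set y | (K%:R + 1) * r < f y]) = ((K%:R + 1) * r < f x).
  by apply/idP/idP; rewrite inE.
rewrite E; case: (ltP ((K%:R + 1) * r) (f x)) => /= Kx.
  have Kx' : K%:R * r < f x by lra.
  by have := IH2 Kx'; split; lra.
split; [lra|lra|] => _.
by case: (leP (f x) (K%:R * r)) => Kx'; [have := IH3 Kx'|have := IH2 Kx']; lra.
Qed.

Lemma bmeas_stepf K r f : measurable_fun setT f -> bmeas (stepf K r f).
Proof.
move=> mf; elim: K => [|K IH].
  rewrite (_ : stepf 0 r f = fun=> 0); first exact: bmeas_cst.
  by apply/funext => x; rewrite /stepf big_ord0.
rewrite (_ : stepf K.+1 r f =
    fun x => stepf K r f x + r * \1_[set y | K.+1%:R * r < f y] x).
  apply: bmeasD => //; apply: bmeasZ; apply: bmeas_indic.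
  rewrite -[X in measurable X]setTI.
  have -> : [set y | K.+1%:R * r < f y] = f @^-1` `]K.+1%:R * r, +oo[.
    by apply/seteqP; split => x /=; rewrite in_itv /= andbT.
  exact: mf.
by apply/funext => x; rewrite stepfS.
Qed.

Lemma measurable_superlevel f (c : R) : measurable_fun setT f ->
  measurable [set y | c < f y].
Proof.
move=> mf; rewrite -[X in measurable X]setTI.
have -> : [set y | c < f y] = f @^-1` `]c, +oo[.
  by apply/seteqP; split => x /=; rewrite in_itv /= andbT.
exact: mf.
Qed.

Lemma Ex_stepf m K r f : measurable_fun setT f ->
  Ex m (stepf K r f) = \sum_(i < K) r * fine (m [set y | i.+1%:R * r < f y]).
Proof.
move=> mf; elim: K => [|K IH].
  rewrite big_ord0 (_ : stepf 0 r f = fun=> 0) ?Ex_cst//.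
  by apply/funext => x; rewrite /stepf big_ord0.
rewrite big_ord_recr /= -IH.
have mK := measurable_superlevel (K.+1%:R * r) mf.
rewrite -Ex_indic// -ExZ; last exact: bmeas_indic.
rewrite -ExD; [|exact: bmeas_stepf|by apply: bmeasZ; exact: bmeas_indic].
by congr (Ex m _); apply/funext => x; rewrite stepfS.
Qed.

Lemma near_forall_lt (Q : nat -> nat -> Prop) K :
  (forall i, \forall n \near \oo, Q i n) ->
  \forall n \near \oo, forall i, (i < K)%N -> Q i n.
Proof.
move=> H; elim: K => [|K IH]; first by near=> n.
near=> n => i; rewrite ltnS leq_eqVlt => /predU1P[->|].
  by near: n; exact: H.
by move: i; near: n; exact: IH.
Unshelve. all: end_near.
Qed.

Lemma lower_semicont_Ex (ms : nat -> probability T R) m f (B e : R) :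
  (forall c eps : R, 0 < eps -> \forall n \near \oo,
     fine (m [set y | c < f y]) - eps <= fine (ms n [set y | c < f y])) ->
  measurable_fun setT f -> (forall x, 0 <= f x <= B) -> 0 < e ->
  \forall n \near \oo, Ex m f - e <= Ex (ms n) f.
Proof.
move=> H mf fB e0.
have bf : bmeas f.
  by split => //; exists B => x; have /andP[f0 fb] := fB x; rewrite ger0_norm.
(* Half of [e] is lost in the discretization by steps of height [r], the other half in the
   superlevel sets. *)
pose r := e / 2; have r0 : 0 < r by rewrite divr_gt0.
have [K HK] : exists K : nat, B <= K%:R * r.
  exists (Num.bound `|B / r|); rewrite -ler_pdivrMr//.
  by apply: le_trans (ler_norm _) (ltW (archi_boundP _)).
(* An error 1/(K+1) on each of the K superlevel sets, weighted by [r], adds up to at most [r]. *)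
have K0 : 0 < K.+1%:R^-1 :> R by rewrite invr_gt0.
near=> n.
have Hn : forall i, (i < K)%N -> fine (m [set y | i.+1%:R * r < f y]) - K.+1%:R^-1 <=
    fine (ms n [set y | i.+1%:R * r < f y]).
  near: n; apply: (@near_forall_lt (fun i n => fine (m [set y | i.+1%:R * r < f y])
    - K.+1%:R^-1 <= fine (ms n [set y | i.+1%:R * r < f y]))) => i; exact: H.
have bs := bmeas_stepf K r mf.
have h1 : Ex m f <= Ex m (stepf K r f) + r.
  rewrite -[X in _ + X](Ex_cst m) -ExD//; last exact: bmeas_cst.
  apply: Ex_le => //; first by apply: bmeasD => //; exact: bmeas_cst.
  move=> x; have /andP[f0 fb] := fB x; have [_ _] := stepfP K r0 f0; apply.
  exact: le_trans HK.
have h2 : Ex (ms n) (stepf K r f) <= Ex (ms n) f.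
  by apply: Ex_le => // x; have /andP[f0 fb] := fB x; have [] := stepfP K r0 f0.
have h3 : Ex m (stepf K r f) <= Ex (ms n) (stepf K r f) + r.
  rewrite !Ex_stepf//.
  apply: (@le_trans _ _ (\sum_(i < K) (r * fine (ms n [set y | i.+1%:R * r < f y]) +
      r * K.+1%:R^-1))).
    apply: ler_sum => i _; rewrite -mulrDr ler_pM2l// -lerBlDr; exact: Hn.
  rewrite big_split /= lerD2l sumr_const card_ord.
  rewrite -[(r * _) *+ _]mulr_natr -mulrA ger_pMr//.
  by rewrite mulrC ler_pdivrMr// mul1r ler_nat.
rewrite /r in h1 h3; lra.
Unshelve. all: end_near.
Qed.

End expectation.

(** * Weak convergence on a separable metric space *)

Definition sepmetric {R : realType} {S : ptopologicalType}
    (dist : borel S -> borel S -> R) (s : nat -> borel S) : Prop :=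
  [/\ forall x y, dist x y = 0 <-> x = y,
      forall x y, dist x y = dist y x,
      forall x y z, dist x z <= dist x y + dist y z,
      forall x : borel S,
        nbhs x = filter_from [set e : R | 0 < e] (fun e => [set y | dist x y < e])
    & forall x (e : R), 0 < e -> exists i, dist (s i) x < e].

Lemma polish_sepmetric {R : realType} {S : ptopologicalType} : polish R S ->
  exists (dist : borel S -> borel S -> R) (s : nat -> borel S),
    sepmetric dist s /\
    forall u : nat -> borel S,
      (forall e : R, 0 < e -> exists M : nat, forall m n, (M <= m)%N ->
         (M <= n)%N -> dist (u m) (u n) < e) ->
      exists l : borel S, u @ \oo --> l.
Proof.
move=> [[D [cD dD]] [dist [H0 Hs Ht Hn Hc]]].
have [s Ds] : exists s : nat -> S, D `<=` range s.
  have /countable_injP[f fI] := cD.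
  exists (fun n => xget point [set x | D x /\ f x = n]) => x Dx.
  exists (f x) => //; case: xgetP => [y _ [Dy fy]|/(_ x)]; last by case.
  by apply: fI => //; rewrite inE.
exists dist, s; split => //; split => // x e e0.
have : closure D x by rewrite dD.
move=> /(_ [set y | dist x y < e]).
have : nbhs x [set y | dist x y < e] by rewrite Hn; exists e.
move=> /[swap]/[apply] -[y [/Ds[i _ <-]] /= xy].
by exists i; rewrite Hs.
Qed.

Section metric_topology.
Context {R : realType} {S : ptopologicalType}.
Variables (dist : borel S -> borel S -> R) (s : nat -> borel S).
Hypothesis met : sepmetric dist s.
Local Notation SS := (borel S * borel S)%type.

Lemma dist_eq0 x : dist x x = 0.
Proof. by have [H _ _ _ _] := met; apply/H. Qed.

Lemma distC x y : dist x y = dist y x.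
Proof. by have [_ H _ _ _] := met. Qed.

Lemma dist_tri y x z : dist x z <= dist x y + dist y z.
Proof. by have [_ _ H _ _] := met. Qed.

Lemma dist_ge0 x y : 0 <= dist x y.
Proof. by have := dist_tri y x x; rewrite dist_eq0 (distC y x); lra. Qed.

Lemma nbhs_distP x (A : set (borel S)) :
  nbhs x A <-> exists2 e : R, 0 < e & forall y, dist x y < e -> A y.
Proof.
have [_ _ _ -> _] := met; split; first by move=> [e e0 H]; exists e.
by move=> [e e0 H]; exists e.
Qed.

Definition bl (i m : nat) : set (borel S) := [set y | dist (s i) y < m.+1%:R^-1].

Lemma open_dist_ball x e : open ([set y | dist x y < e] : set (borel S)).
Proof.
rewrite openE => y /= xy; apply/nbhs_distP; exists (e - dist x y); first lra.
by move=> t yt; rewrite /=; have := dist_tri y x t; lra.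
Qed.

Lemma measurable_open (U : set (borel S)) : open U -> measurable U.
Proof. by move=> oU; exact: sub_sigma_algebra. Qed.

Lemma measurable_bl i m : measurable (bl i m).
Proof. by apply: measurable_open; exact: open_dist_ball. Qed.

Lemma bl_basis x (U : set (borel S)) : nbhs x U ->
  exists i m, bl i m x /\ bl i m `<=` U.
Proof.
move=> /nbhs_distP[e e0 He].
have [m Hm] : exists m : nat, m.+1%:R^-1 < e / 2.
  have e2 : 0 < e / 2 by lra.
  have [m _ /(_ m (leqnn m)) Hm] := near_infty_natSinv_lt (PosNum e2).
  by exists m.
have [_ _ _ _ /(_ x m.+1%:R^-1)[|i Hi]] := met; first by rewrite invr_gt0.
exists i, m; split => // y; rewrite /bl /= => iy; apply: He.
apply: le_lt_trans (dist_tri (s i) x y) _; rewrite (splitr e) (distC x (s i)).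
by apply: ltrD; [exact: lt_trans Hi Hm|exact: lt_trans iy Hm].
Qed.

(** A countable base of rectangles. The sigma-algebra of the product is generated by rectangles, and
    countability of this base is what puts the open sets in it. *)
Definition bl2 (k : nat) : set SS :=
  if @unpickle (nat * nat * (nat * nat))%type k is Some p then
    bl p.1.1 p.1.2 `*` bl p.2.1 p.2.2 else set0.

Lemma open_bl2 (G : set SS) : open G ->
  G = \bigcup_(k in [set k | bl2 k `<=` G]) bl2 k.
Proof.
rewrite openE => oG; apply/seteqP; split => [[x y] Gxy|p [k kG]]; last exact: kG.
have [[A B] [/= /bl_basis[i [m [xi iA]]] /bl_basis[j [n [yj jB]]]] AB] := oG _ Gxy.
have E : bl2 (pickle ((i, m), (j, n))) = bl i m `*` bl j n by rewrite /bl2 pickleK.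
exists (pickle ((i, m), (j, n))); rewrite /= E//.
by move=> [x' y'] [/= xi' yj']; apply: AB; split; [exact: iA|exact: jB].
Qed.

Lemma bl2_rect k : exists A B, [/\ measurable A, measurable B & bl2 k = A `*` B].
Proof.
rewrite /bl2; case: unpickle => [p|].
  by exists (bl p.1.1 p.1.2), (bl p.2.1 p.2.2); split => //; exact: measurable_bl.
by exists set0, set0; split => //; rewrite setX0.
Qed.

Lemma measurable_open2 (G : set SS) : open G -> measurable G.
Proof.
move=> /open_bl2 ->; apply: bigcup_measurable => k _.
by have [A [B [mA mB ->]]] := bl2_rect k; exact: measurableX.
Qed.

Lemma measurable_continuous2 (f : SS -> R) : continuous f -> measurable_fun setT f.
Proof.
move=> /continuousP cf; apply: (measurability _ (RGenOpens.measurableE R)).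
move=> _ [_ [a [b ->] <-]]; rewrite setTI.
by apply: measurable_open2; apply: cf; exact: interval_open.
Qed.

(** Inclusion-exclusion for one more rectangle: rectangles are closed under intersection, so the
    overlap with the first K is again a union of K rectangles and the induction hypothesis covers
    it. *)
Lemma rect_cvg_bigU (ms : nat -> probability SS R) (m : probability SS R) :
  (forall A B, measurable A -> measurable B ->
    (fun n => fine (ms n (A `*` B))) @ \oo --> fine (m (A `*` B))) ->
  forall K (F : nat -> set SS),
    (forall k, exists A B, [/\ measurable A, measurable B & F k = A `*` B]) ->
    (fun n => fine (ms n (\big[setU/set0]_(k < K) F k))) @ \oo -->
      fine (m (\big[setU/set0]_(k < K) F k)).
Proof.
move=> H; elim=> [|K IH] F HF.
  rewrite big_ord0 measure0 /=.
  rewrite (_ : (fun n => _) = fun=> 0); first exact: cvg_cst.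
  by apply/funext => n; rewrite measure0.
have mF k : measurable (F k).
  by have [A [B [mA mB ->]]] := HF k; exact: measurableX.
have mU (G : nat -> set SS) : (forall k, measurable (G k)) ->
    measurable (\big[setU/set0]_(k < K) G k).
  by move=> mG; exact: bigsetU_measurable.
have E (p : probability SS R) : fine (p (\big[setU/set0]_(k < K.+1) F k)) =
    fine (p (\big[setU/set0]_(k < K) F k)) + fine (p (F K)) -
    fine (p (\big[setU/set0]_(k < K) (F k `&` F K))).
  rewrite big_ord_recr /= -big_distrl /=.
  have mUK := mU F mF; have mI := measurableI _ _ mUK (mF K).
  rewrite measureUfinr//=; last by rewrite ltey_eq fin_num_measure.
  by rewrite fineB ?fineD// ?fin_numD ?fin_num_measure//.
rewrite E; under eq_fun do rewrite E.
apply: cvgB; first apply: cvgD.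
- exact: IH.
- by have [A [B [mA mB ->]]] := HF K; exact: H.
- apply: (IH (fun k => F k `&` F K)) => k; have [A [B [mA mB ->]]] := HF k.
  have [A' [B' [mA' mB' ->]]] := HF K; rewrite -setXI.
  by exists (A `&` A'), (B `&` B'); split => //; exact: measurableI.
Qed.

(** A finite union of base rectangles fills [G] up to e/2 in measure; its measures converge, and
    monotonicity gives the lower bound for [G]. *)
Lemma rect_cvg_open (ms : nat -> probability SS R) (m : probability SS R) :
  (forall A B, measurable A -> measurable B ->
    (fun n => fine (ms n (A `*` B))) @ \oo --> fine (m (A `*` B))) ->
  forall G, open G -> forall e : R, 0 < e ->
    \forall n \near \oo, fine (m G) - e <= fine (ms n G).
Proof.
move=> H G oG e e0; have mG := measurable_open2 oG.
pose F k := if `[< bl2 k `<=` G >] then bl2 k else set0.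
have HF k : exists A B, [/\ measurable A, measurable B & F k = A `*` B].
  rewrite /F; case: asboolP => _; first exact: bl2_rect.
  by exists set0, set0; split => //; rewrite setX0.
have mF k : measurable (F k).
  by have [A [B [mA mB ->]]] := HF k; exact: measurableX.
have mU K : measurable (\big[setU/set0]_(k < K) F k) by exact: bigsetU_measurable.
have GF : G = \bigcup_K \big[setU/set0]_(k < K) F k.
  rewrite {1}(open_bl2 oG) eqEsubset; split => p.
    move=> [k /= kG kp]; exists k.+1 => //; rewrite big_ord_recr; right.
    by rewrite /F asboolT.
  move=> [K _]; rewrite -bigcup_mkord => -[k _]; rewrite /F.
  by case: asboolP => // kG kp; exists k.
have cv : m (\big[setU/set0]_(k < K) F k) @[K --> \oo] --> m G.
  rewrite [in m G]GF; apply: nondecreasing_cvg_mu => //.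
    exact: bigcup_measurable.
  by move=> i j ij; apply/subsetPset/subset_bigsetU.
have fG : (m G \is a fin_num)%E by rewrite fin_num_measure.
have e2 : 0 < e / 2 by lra.
move: cv; rewrite -(fineK fG) => /fine_cvgP[_] /cvgrPdist_lt /(_ _ e2).
move=> [K _ /(_ K (leqnn K))] /= HK.
have := @rect_cvg_bigU ms m H K F HF => /cvgrPdist_lt /(_ _ e2).
apply: filterS => n Hn.
have : fine (ms n (\big[setU/set0]_(k < K) F k)) <= fine (ms n G).
  apply: fine_le; rewrite ?fin_num_measure//.
  apply: le_measure; rewrite ?inE//.
  by rewrite [X in _ `<=` X]GF => p Hp; exists K.
move: Hn HK => /ltr_normlW + /ltr_normlW; lra.
Qed.

(** Superlevel sets of continuous functions are open, which gives lower bounds for expectations;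
    applied to [f] and to its opposite they give convergence. *)
Lemma weak_cvg_rect (ms : nat -> probability SS R) (m : probability SS R) :
  (forall A B, measurable A -> measurable B ->
    (fun n => fine (ms n (A `*` B))) @ \oo --> fine (m (A `*` B))) ->
  weak_cvg ms m.
Proof.
move=> H f cf [M HM].
have L (h : SS -> R) : continuous h -> (forall x, `|h x| <= M) ->
    forall e, 0 < e -> \forall n \near \oo, Ex m h - e <= Ex (ms n) h.
  (* Shifted into [0, 2M], where the layer-cake bound applies. *)
  move=> ch hM e e0; pose h' x := h x + M.
  have bh : bmeas h by split; [exact: measurable_continuous2|exists M].
  have bh' : bmeas h' by apply: bmeasD => //; exact: bmeas_cst.
  have Eh (p : probability SS R) : Ex p h' = Ex p h + M.
    by rewrite /h' ExD//; [rewrite Ex_cst|exact: bmeas_cst].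
  have : \forall n \near \oo, Ex m h' - e <= Ex (ms n) h'.
    apply: (@lower_semicont_Ex _ _ _ ms m h' (M + M)) => //.
    - move=> c eps eps0; apply: rect_cvg_open => //.
      have -> : [set y | c < h' y] = h @^-1` [set t | c - M < t].
        by apply/seteqP; split => x; rewrite /h' /=; lra.
      by move/continuousP : ch; apply; exact: open_gt.
    - by case: bh'.
    - by move=> x; have := hM x; rewrite ler_norml /h'; lra.
  by apply: filterS => n; rewrite !Eh; lra.
have bf : bmeas f by split; [exact: measurable_continuous2|exists M].
rewrite -EFin_Ex//; under eq_fun do rewrite -EFin_Ex//.
apply: cvg_EFin; first by near=> n.
apply/cvgrPdist_le => e e0; near=> n => /=.
rewrite distrC ler_distl; apply/andP; split.
  by near: n; exact: L.
have bN : bmeas (fun x => -1 * f x) by exact: bmeasZ.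
have : Ex m (fun x => -1 * f x) - e <= Ex (ms n) (fun x => -1 * f x).
  near: n; apply: L => //; last by move=> x; rewrite mulN1r normrN.
  move=> x; apply: cvgM; [exact: cvg_cst|exact: cf].
by rewrite !ExZ//; lra.
Unshelve. all: end_near.
Qed.

End metric_topology.

Section quantified_events.
Context {d : measure_display} {T : measurableType d}.

Lemma measurable_foralln (Q : nat -> T -> Prop) :
  (forall i, measurable [set x | Q i x]) -> measurable [set x | forall i, Q i x].
Proof.
move=> H; rewrite (_ : [set x | _] = \bigcap_i [set x | Q i x]).
  exact: bigcapT_measurable.
by apply/seteqP; split => x Hx i; [move=> _; exact: Hx|exact: Hx].
Qed.

Lemma measurable_existsn (Q : nat -> T -> Prop) :
  (forall i, measurable [set x | Q i x]) -> measurable [set x | exists i, Q i x].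
Proof.
move=> H; rewrite (_ : [set x | _] = \bigcup_i [set x | Q i x]).
  exact: bigcup_measurable.
by apply/seteqP; split => x [i]; [exists i|move=> _; exists i].
Qed.

Lemma measurable_imply (b : bool) (Q : T -> Prop) :
  measurable [set x | Q x] -> measurable [set x | b -> Q x].
Proof.
case: b => H.
  by rewrite (_ : [set x | _] = [set x | Q x])//; apply/seteqP; split => x /=; auto.
by rewrite (_ : [set x | _] = setT)//; apply/seteqP; split.
Qed.

End quantified_events.

Section metric_limits.
Context {R : realType} {S : ptopologicalType}.
Variables (dist : borel S -> borel S -> R) (s : nat -> borel S).
Hypothesis met : sepmetric dist s.
Local Notation SS := (borel S * borel S)%type.

Lemma dist_lip (p q : SS) :
  `|dist p.1 p.2 - dist q.1 q.2| <= dist p.1 q.1 + dist p.2 q.2.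
Proof.
have t1 := dist_tri met q.1 p.1 p.2; have t2 := dist_tri met q.2 q.1 p.2.
have t3 := dist_tri met p.1 q.1 q.2; have t4 := dist_tri met p.2 p.1 q.2.
rewrite (distC met q.2 p.2) in t2; rewrite (distC met q.1 p.1) in t3.
by rewrite ler_norml; lra.
Qed.

Lemma near_dist (p : SS) (e : R) : 0 < e ->
  \forall q \near p, `|dist p.1 p.2 - dist q.1 q.2| < e.
Proof.
move=> e0; have e2 : 0 < e / 2 by lra.
exists ([set y | dist p.1 y < e / 2], [set y | dist p.2 y < e / 2]).
  by split; apply/(nbhs_distP met); exists (e / 2).
move=> q [/= h1 h2]; apply: le_lt_trans (dist_lip p q) _.
by rewrite (splitr e); exact: ltrD.
Qed.

Lemma continuous_dist : continuous (fun p : SS => dist p.1 p.2).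
Proof. by move=> p; apply/cvgrPdist_lt => e e0; exact: near_dist. Qed.

(** The bounded test function, zero on the diagonal, that turns weak convergence to the diagonal law
    into closeness of the two coordinates. *)
Lemma continuous_mindist : continuous (fun p : SS => Num.min (dist p.1 p.2) 1).
Proof.
move=> p; apply/cvgrPdist_lt => e e0; apply: filterS (near_dist p e0) => q.
apply: le_lt_trans; rewrite ler_norml.
have := ler_norm (dist p.1 p.2 - dist q.1 q.2).
have := ler_norm (- (dist p.1 p.2 - dist q.1 q.2)); rewrite normrN.
set a := `|_|; set x := dist p.1 p.2; set y := dist q.1 q.2 => h1 h2.
by rewrite !minEle; case: (leP x 1) => ?; case: (leP y 1) => ?; lra.
Qed.

Lemma measurable_dist {d} {M : measurableType d} (f h : M -> borel S) :
  measurable_fun setT f -> measurable_fun setT h ->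
  measurable_fun setT (fun x => dist (f x) (h x)).
Proof.
move=> mf mh.
have := measurableT_comp (measurable_continuous2 met continuous_dist)
  (measurable_fun_pair mf mh).
exact.
Qed.

Lemma measurable_dist_lt {d} {M : measurableType d} (f h : M -> borel S) (e : R) :
  measurable_fun setT f -> measurable_fun setT h ->
  measurable [set x | dist (f x) (h x) < e].
Proof.
move=> mf mh; have := measurable_superlevel (- e)
  (measurable_funB (measurable_cst (0 : R)) (measurable_dist mf mh)).
congr measurable; apply/seteqP; split => x /=; lra.
Qed.

Hypothesis complete : forall u : nat -> borel S,
  (forall e : R, 0 < e -> exists M : nat, forall m n, (M <= m)%N ->
     (M <= n)%N -> dist (u m) (u n) < e) ->
  exists l : borel S, u @ \oo --> l.

Lemma inv_lt (e : R) : 0 < e -> exists m : nat, m.+1%:R^-1 < e.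
Proof.
move=> e0; have [m _ /(_ m (leqnn m)) Hm] := near_infty_natSinv_lt (PosNum e0).
by exists m.
Qed.

Definition dcvg (u : nat -> borel S) (l : borel S) : Prop :=
  forall e : R, 0 < e -> exists N, forall n, (N <= n)%N -> dist (u n) l < e.

Lemma dcvg_unique u l l' : dcvg u l -> dcvg u l' -> l = l'.
Proof.
move=> H H'; have [D0 _ _ _ _] := met; apply/D0.
apply/eqP; rewrite eq_le (dist_ge0 met) andbT leNgt; apply/negP => d0.
have d2 : 0 < dist l l' / 2 by lra.
have [N HN] := H _ d2; have [N' HN'] := H' _ d2.
have h1 := HN _ (leq_maxl N N'); have h2 := HN' _ (leq_maxr N N').
have h3 := dist_tri met (u (maxn N N')) l l'.
have h4 := distC met l (u (maxn N N')).
rewrite h4 in h3; have := le_lt_trans h3 (ltrD h1 h2); rewrite -splitr ltxx.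
by [].
Qed.

(** Points that keep a margin above 1/(m+1) inside [A]. The strict inequality makes the set open,
    and the margin passes membership in [A] on to limits. *)
Definition inner (A : set (borel S)) (m : nat) : set (borel S) :=
  [set y | exists2 r : R, m.+1%:R^-1 < r & forall t, dist y t < r -> A t].

Lemma open_inner A m : open (inner A m).
Proof.
rewrite openE => y [r mr Hr]; apply/(nbhs_distP met).
move: mr; set k := _^-1 => mr; exists (r - k); first lra.
move=> t yt; exists (r - dist y t); first by rewrite -/k; lra.
by move=> t' tt'; apply: Hr; have := dist_tri met t y t'; lra.
Qed.

(** By completeness the convergence set is the set where the sequence is Cauchy, a countable
    combination of events [dist < 1/(k+1)]; off it the limit takes the default value [point]. *)
Lemma measurable_limit {d} {M : measurableType d} (f : nat -> M -> borel S) :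
  (forall n, measurable_fun setT (f n)) ->
  exists2 F : M -> borel S, measurable_fun setT F &
    forall x l, dcvg (f ^~ x) l -> F x = l.
Proof.
move=> mf.
pose C := [set x | forall k, exists N, forall i, forall j, (N <= i)%N && (N <= j)%N ->
  dist (f i x) (f j x) < k.+1%:R^-1].
have mC : measurable C.
  apply: measurable_foralln => k; apply: measurable_existsn => N.
  apply: measurable_foralln => i; apply: measurable_foralln => j.
  apply: measurable_imply; exact: measurable_dist_lt.
have CP x : C x -> exists l, dcvg (f ^~ x) l.
  move=> Cx; have [|l Hl] := complete (u := f ^~ x).
    move=> e /inv_lt[k ke]; have [N HN] := Cx k; exists N => i j Ni Nj.
    by apply: lt_trans ke; apply: HN; rewrite Ni Nj.
  exists l => e e0.
  have [N _ HN] : \forall n \near \oo, dist l (f n x) < e.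
    by apply: (Hl [set y | dist l y < e]); apply/(nbhs_distP met); exists e.
  by exists N => n /HN /=; rewrite (distC met).
have PC x l : dcvg (f ^~ x) l -> C x.
  move=> H k; have k2 : 0 < k.+1%:R^-1 / 2 :> R by rewrite divr_gt0// invr_gt0.
  have [N HN] := H _ k2; exists N => i j /andP[/HN Ni /HN Nj].
  apply: le_lt_trans (dist_tri met l (f i x) (f j x)) _.
  by rewrite (distC met l (f j x)) [ltRHS]splitr; exact: ltrD.
pose F x := xget point [set l | dcvg (f ^~ x) l].
have FP x l : dcvg (f ^~ x) l -> F x = l.
  move=> H; rewrite /F; case: xgetP => [y _ Hy|/(_ l)//].
  exact: dcvg_unique Hy H.
have FC x : ~ C x -> F x = point.
  by move=> nC; rewrite /F; case: xgetP => // y _ /PC.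
exists F => //.
apply: (measurability (open : set (set (borel S)))) => // _ [A oA <-]; rewrite setTI.
(* On [C], the limit lies in the open set [A] exactly when the sequence eventually stays in some
   [inner A m]. *)
pose L := [set x | exists m, exists N, forall i, (N <= i)%N -> inner A m (f i x)].
have mL : measurable L.
  apply: measurable_existsn => m; apply: measurable_existsn => N.
  apply: measurable_foralln => i; apply: measurable_imply.
  rewrite -[X in measurable X]setTI; apply: mf => //.
  by apply: measurable_open; exact: open_inner.
have -> : F @^-1` A = (C `&` L) `|` (~` C `&` [set x | A point]).
  apply/seteqP; split => x /=.
    have [Cx|nC] := pselect (C x); last by rewrite FC//; right.
    have [l Hl] := CP _ Cx; rewrite (FP _ _ Hl) => Al; left; split => //.
    have /(nbhs_distP met)[e e0 He] : nbhs l A by apply: open_nbhs_nbhs.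
    have e4 : 0 < e / 4 by lra.
    have [m Hm] := inv_lt e4; have [N HN] := Hl _ e4.
    exists m, N => i /HN Ni; exists (e / 2); first by apply: lt_trans Hm _; lra.
    move=> t it; apply: He; have := dist_tri met (f i x) l t.
    by rewrite (distC met l (f i x)); move: Ni it; lra.
  case=> [[Cx [m [N HN]]]|[nC Ap]]; last by rewrite FC.
  have [l Hl] := CP _ Cx; rewrite (FP _ _ Hl).
  have m0 : 0 < m.+1%:R^-1 :> R by rewrite invr_gt0.
  have [N' HN'] := Hl _ m0.
  have [r mr Hr] := HN _ (leq_maxl N N'); apply: Hr.
  exact: lt_trans (HN' _ (leq_maxr N N')) mr.
apply: measurableU; first exact: measurableI.
apply: measurableI; first exact: measurableC.
have [Ap|nAp] := pselect (A point).
  by rewrite (_ : [set x | _] = setT)//; apply/seteqP; split.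
by rewrite (_ : [set x | _] = set0)//; apply/seteqP; split.
Qed.

End metric_limits.

Section pair_laws.
Context {R : realType} {S : ptopologicalType}.
Local Notation SS := (borel S * borel S)%type.
Variable mu : probability (borel S) R.
Local Open Scope ereal_scope.

Lemma measurable_diag : measurable_fun setT (fun x : borel S => (x, x)).
Proof. by apply: measurable_fun_pair; exact: measurable_id. Qed.

Lemma diag_mfun : (fun x : borel S => (x, x)) \in @mfun _ _ (borel S) SS.
Proof. by rewrite inE; exact: measurable_diag. Qed.

(** [diag_law] is a bare set function; this is a probability convertible to it, on which the later
    [change] steps rely. *)
Definition diag_prob : probability SS R := distribution mu (mfun_Sub diag_mfun).

Lemma diag_probE A : diag_prob A = diag_law mu A.
Proof. by []. Qed.

Lemma diag_rect A B : diag_prob (A `*` B) = mu (A `&` B).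
Proof. by rewrite diag_probE /diag_law /pushforward. Qed.

Lemma rect_meas_eq (m1 m2 : probability SS R) :
  (forall A B, measurable A -> measurable B -> m1 (A `*` B) = m2 (A `*` B)) ->
  meas_eq m1 m2.
Proof.
move=> H A mA.
pose G := [set A `*` B | A in @measurable _ (borel S) & B in @measurable _ (borel S)].
have sA : <<s G >> A by rewrite -measurable_prod_measurableType.
apply: pi_lambda_eq sA.
- move=> _ _ [A1 mA1 [B1 mB1 <-]] [A2 mA2 [B2 mB2 <-]]; rewrite -setXI.
  by exists (A1 `&` A2); [exact: measurableI|exists (B1 `&` B2) => //;
    exact: measurableI].
- by move=> _ [A1 mA1 [B1 mB1 <-]]; exact: measurableX.
- by rewrite /= !probability_setT.
- by move=> _ [A1 mA1 [B1 mB1 <-]]; exact: H.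
Qed.

Lemma has_law_meas_eq {d} {T : measurableType d} (Q : probability T R) (Y : T -> SS) m m' :
  meas_eq m m' -> has_law Q Y m -> has_law Q Y m'.
Proof. by move=> mm [mY H]; split => // A mA; rewrite -mm// H. Qed.

Lemma tree_data_meas_eq {dE} {E : measurableType dE} {d} {T : measurableType d}
    (Q : probability T R) (z : word -> T -> E) (y : word -> T -> SS) n nu m m' :
  meas_eq m m' -> tree_data Q z y n nu m -> tree_data Q z y n nu m'.
Proof.
by move=> mm [Hz Hy HI]; split => // w /Hy; exact: has_law_meas_eq.
Qed.

Lemma marginals_meas_eq m m' : meas_eq m m' -> marginals_eq mu m -> marginals_eq mu m'.
Proof.
move=> mm H A mA; have [H1 H2] := H A mA.
by split; rewrite -mm//; exact: measurableX.
Qed.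

Lemma weak_cvg_eq (ms ms' : nat -> probability SS R) (m m' : probability SS R) :
  (forall n, meas_eq (ms n) (ms' n)) -> meas_eq m m' ->
  weak_cvg ms m -> weak_cvg ms' m'.
Proof.
move=> H H' W f cf bf.
rewrite (_ : (fun n => _) = (fun n => \int[ms n]_x (f x)%:E)).
  rewrite (@eq_measure_integral _ _ _ setT m m'); first exact: W.
  by move=> A mA _; exact/esym/H'.
apply/funext => n; apply: eq_measure_integral => A mA _; exact/esym/H.
Qed.

Lemma T2_image_meas_eq {dT} {Theta : measurableType dT}
    (nu : probability (Theta * natinf)%type R) g (m1 m2 m1' m2' : set SS -> \bar R) :
  meas_eq m1 m1' -> meas_eq m2 m2' ->
  T2_image nu g m1 m2 -> T2_image nu g m1' m2'.
Proof.
move=> H1 H2 [d [T [Q [xi [N [Y [h1 h2 h3 h4]]]]]]].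
exists d, T, Q, xi, N, Y; split => //.
  by move=> j; exact: has_law_meas_eq (h2 j).
exact: has_law_meas_eq h4.
Qed.

(** Markov's inequality for the distance truncated at 1, whose integral under the diagonal law is 0;
    as [eta] is at most 1, truncation does not alter the event. *)
Lemma weak_cvg_mindist (dist : borel S -> borel S -> R) s
    (ms : nat -> probability SS R) : sepmetric dist s ->
  weak_cvg ms (diag_law mu) ->
  forall eta e : R, (0 < eta <= 1)%R -> (0 < e)%R ->
  \forall n \near \oo, ms n [set p | (eta <= dist p.1 p.2)%R] < e%:E.
Proof.
move=> met W eta e /andP[eta0 eta1] e0.
pose f (p : SS) : R := Num.min (dist p.1 p.2) 1%R.
have f0 p : (0 <= f p)%R by rewrite /f le_min (dist_ge0 met) ler01.
have f1 p : (f p <= 1)%R by rewrite /f ge_min lexx orbT.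
have cf : continuous f := continuous_mindist met.
have bf : bmeas f.
  split; first exact: (measurable_continuous2 met).
  by exists 1%R => p; rewrite ger0_norm.
have Wf : (fun n => \int[ms n]_x (f x)%:E) @ \oo --> \int[diag_law mu]_x (f x)%:E.
  by apply: W => //; exists 1%R => p; rewrite ger0_norm.
have E0 : \int[diag_law mu]_x (f x)%:E = 0.
  rewrite /diag_law ge0_integral_pushforward//; first last.
  - by move=> p _; rewrite lee_fin.
  - by apply/measurable_EFinP; case: bf.
  - exact: measurable_diag.
  rewrite preimage_setT; under eq_integral => x _ do
    rewrite /= /f /= (dist_eq0 met) (min_idPl ler01).
  by rewrite integral0.
have me : measurable [set p : SS | (eta <= dist p.1 p.2)%R].
  have -> : [set p : SS | (eta <= dist p.1 p.2)%R] =
      ~` [set p | (dist p.1 p.2 < eta)%R].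
    by apply/seteqP; split => p /=; rewrite leNgt => /negP.
  apply: measurableC.
  exact: (measurable_dist_lt met (f := fst) (h := snd) eta measurable_fst measurable_snd).
move: Wf; rewrite E0; under eq_fun do rewrite -EFin_Ex//.
move=> /fine_cvgP[_] /cvgrPdist_lt /(_ (eta * e)%R)[|n0 _ Hn].
  by rewrite mulr_gt0.
exists n0 => // n /Hn /=; rewrite sub0r normrN ger0_norm; last first.
  by rewrite -(Ex_cst (ms n) 0%R); apply: Ex_le => //; exact: bmeas_cst.
move=> Hlt; have fm : ms n [set p : SS | (eta <= dist p.1 p.2)%R] \is a fin_num.
  by rewrite fin_num_measure.
rewrite -(fineK fm) lte_fin -(ltr_pM2l eta0); apply: le_lt_trans Hlt.
rewrite -Ex_indic// -ExZ; last exact: bmeas_indic.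
apply: Ex_le => //; first by apply: bmeasZ; exact: bmeas_indic.
move=> p; rewrite indicE; case: (boolP (p \in _)); last by rewrite mulr0.
by rewrite inE /= mulr1 /f le_min eta1 => ->.
Qed.

End pair_laws.

Section sections_of_products.
Context {R : realType} {d1 d2 : measure_display} {T1 : measurableType d1}
  {T2 : measurableType d2}.
Variables (P1 : probability T1 R) (P2 : probability T2 R).
Variable D : set (T1 * T2).
Hypothesis mD : measurable D.
Local Open Scope ereal_scope.

Lemma product_xsection : (P1 \x P2) D = \int[P1]_x P2 [set y | D (x, y)].
Proof.
apply: eq_integral => x _ /=; congr (P2 _).
by apply/seteqP; split => y; rewrite /xsection /= in_setE.
Qed.

Lemma product_ysection : (P1 \x P2) D = \int[P2]_y P1 [set x | D (x, y)].
Proof.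
have -> : (P1 \x P2) D = \int[P1 \x P2]_p (\1_D p)%:E.
  by rewrite integral_indic// setIT.
rewrite (fubini_tonelli2 (EFin \o \1_D)) => [||p]; last 2 first.
- by apply/measurable_EFinP; exact: measurable_indic.
- by rewrite /= lee_fin.
rewrite indic_fubini_tonelli_GE//; apply: eq_integral => y _ /=; congr (P1 _).
by apply/seteqP; split => x; rewrite /ysection /= in_setE.
Qed.

End sections_of_products.

(** Otherwise every section would weigh more than [e], and their average at least [e]. *)
Lemma small_section {R : realType} {d1 d2} {T1 : measurableType d1}
    {T2 : measurableType d2} (P1 : probability T1 R) (P2 : probability T2 R)
    (D : set (T1 * T2)) (e : R) : measurable D ->
  ((P1 \x P2) D < e%:E)%E -> exists y, (P1 [set x | D (x, y)] <= e%:E)%E.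
Proof.
move=> mD; apply: contraPP => /forallNP H; apply/negP; rewrite -leNgt.
rewrite product_ysection//.
have <- : (\int[P2]_y e%:E = e%:E)%E.
  by rewrite integral_cst//= probability_setT mule1.
have [e0|e0] := leP 0 e; last first.
  apply: (@le_trans _ _ 0%E); last by apply: integral_ge0 => y _; exact: measure_ge0.
  by rewrite integral_cst//= probability_setT mule1 lee_fin ltW.
apply: ge0_le_integral => //.
- apply: eq_measurable_fun (measurable_fun_ysection P1 mD) => y _ /=; congr (P1 _).
  by apply/seteqP; split => x; rewrite /ysection /= in_setE.
- by move=> y _; have := H y => /negP; rewrite -ltNge => /ltW.
Qed.

(** * Endogeny and the iterates of T2 *)

Section main_parts.
Context {R : realType} {dT : measure_display} {Theta : measurableType dT}
  {S : ptopologicalType} {dO : measure_display} {Omega : measurableType dO}.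
Variables (nu : probability (Theta * natinf)%type R)
  (g : Theta -> natinf -> (nat -> borel S) -> borel S)
  (P : probability Omega R) (mu : probability (borel S) R)
  (xi : word -> Omega -> Theta) (N : word -> Omega -> natinf)
  (X : word -> Omega -> borel S).
Hypothesis mg : g_measurable g.
Hypothesis rtp : invariant_RTP P nu g mu xi N X.
Local Notation SS := (borel S * borel S)%type.
Local Notation z := (xiN xi N).
Local Open Scope ereal_scope.

Let PP : probability (Omega * Omega)%type R := P \x P.
Let zz (w : word) (p : Omega * Omega) := z w p.1.
Let Y2 n (p : Omega * Omega) : SS := ev2 g n (zz^~ p) ((rtp_pair X)^~ p).

Lemma marginals_prod : marginals_eq mu (mu \x mu).
Proof.
move=> A mA; rewrite !product_measure1E//.
by rewrite /= !probability_setT mule1 mul1e.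
Qed.

Lemma measurable_Y2 n : measurable_fun setT (Y2 n).
Proof.
have [Hz Hy _] := rtp_pair_tree_data rtp n.
apply: measurable_ev2 => // w wn; first by have [] := Hz w wn.
by have [] := Hy w wn.
Qed.

Let Y2_mfun n : Y2 n \in mfun. Proof. by rewrite inE; exact: measurable_Y2. Qed.

(** T2 being a relation, its iterates from the product law are exhibited as laws of trees on Omega x
    Omega; a hypothesis on all sequences of iterates can then be applied to one. *)
Definition pair_chain n : probability SS R := distribution PP (mfun_Sub (Y2_mfun n)).

Lemma pair_chain_law n : has_law PP (Y2 n) (pair_chain n).
Proof. by split; [exact: measurable_Y2|]. Qed.

Lemma pair_chain0 : meas_eq (pair_chain 0) (mu \x mu).
Proof.
have [_ /(_ [::] erefl) [_ H] _] := rtp_pair_tree_data rtp 0.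
by move=> A mA; rewrite -H.
Qed.

Lemma pair_chainS n : T2_image nu g (pair_chain n) (pair_chain n.+1).
Proof.
have D := rtp_pair_tree_data rtp n.+1.
apply: (T2_image_step mg D); last exact: pair_chain_law.
(* The subtree of a child in the tree of depth n+1 has the law of the whole tree of depth n. *)
move=> j; have Dj := tree_data_shift j D; have D0 := rtp_pair_tree_data rtp n.
split.
  have [Hz Hy _] := Dj.
  apply: measurable_ev2 => // w wn; first by have [] := Hz w wn.
  by have [] := Hy w wn.
move=> A mA.
have sC : <<s @tree_cyls _ (Theta * natinf)%type _ SS n >>
    ((fun t => ev2 g n t.1 t.2) @^-1` A).
  have := @measurable_ev2 _ _ _ g mg _
    (g_sigma_algebraType (@tree_cyls _ (Theta * natinf)%type _ SS n)) n
    (fun w t => t.1 w) (fun w t => t.2 w).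
  move=> /(_ (@measurable_coord1 _ _ _ _ n) (@measurable_coord2 _ _ _ _ n)).
  by move=> /(_ measurableT A mA); rewrite setTI.
exact: (tree_data_law Dj D0 sC).
Qed.

Lemma pair_realizable m n : meas_eq m (mu \x mu) -> realizable nu (R := R) (S := S) m n.
Proof.
move=> mm; exists _, (Omega * Omega)%type, PP, zz, (rtp_pair X).
apply: tree_data_meas_eq (rtp_pair_tree_data rtp n).
by move=> A mA; rewrite mm.
Qed.

Section metrized.
Variables (dist : borel S -> borel S -> R) (s : nat -> borel S).
Hypothesis met : sepmetric dist s.

Lemma endogenous_T2_iterates_cvg : endogenous P xi N X -> T2_iterates_cvg nu g mu.
Proof.
move=> endo ms ms0 msS.
change (weak_cvg (fun n => ms n) (diag_prob mu)).
apply: (weak_cvg_rect met) => A B mA mB; rewrite diag_rect.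
apply: (endogenous_rect_cvg mg rtp endo _ msS) => //.
  apply: marginals_meas_eq marginals_prod => A' mA'; exact/esym/ms0.
by move=> n; exact: pair_realizable.
Qed.

Lemma T2_image_diag : T2_image nu g (diag_law mu) (diag_law mu).
Proof.
have D0 := rtp_tree_data rtp 1.
have D : tree_data P z (fun w om => (X w om, X w om)) 1 nu (diag_law mu).
  have [Hz Hy HI] := D0; split => // [w wn|].
    have [mX lX] := Hy w wn; split => [|A mA].
      exact: measurableT_comp measurable_diag mX.
    rewrite /diag_law /pushforward -lX//.
    rewrite -[X in measurable X]setTI; exact: measurable_diag.
  apply: indep_onS HI => w wd; split => //; rewrite /lev; case: ifP => _.
    exact: subset_refl.
  move=> _ [A mA <-]; exists ((fun x : borel S => (x, x)) @^-1` A) => //.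
  by rewrite -[X in measurable X]setTI; exact: measurable_diag.
apply: (T2_image_step mg D) => [j|].
  by have [_ /(_ [:: j] erefl) H _] := D.
have [mev lev] := rtp_law mg rtp D0; split => [|A mA].
  exact: measurableT_comp measurable_diag mev.
rewrite /diag_law /pushforward -lev//.
by rewrite -[X in measurable X]setTI; exact: measurable_diag.
Qed.

(** The relation supplies an i.i.d. sequence of law [m]; it is attached as leaves, at any depth, to
    the innovations of the RTP. *)
Lemma T2_image_realizable (m m' : probability SS R) n :
  T2_image nu g m m' -> realizable nu (R := R) (S := S) m n.
Proof.
move=> [d [T [Q [xi' [N' [Y [_ HY /indep_onP HI _]]]]]]].
exists _, (Omega * T)%type, (P \x Q), (fun w p => z w p.1),
  (fun (w : seq nat) p => Y (pickle w) p.2).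
apply: (tree_data_attach (rtp_tree_data rtp n) HY).
apply/indep_onP; apply: (indep_on_inj (f := Some) _ _ HI); first by move=> i j _ _ [].
by move=> i _; split.
Qed.

Lemma endogenous_bivariate_uniqueness :
  endogenous P xi N X -> bivariate_uniqueness nu g mu.
Proof.
move=> endo; split; first exact: T2_image_diag.
move=> m2 mm Hm.
change (meas_eq m2 (diag_prob mu)).
apply: rect_meas_eq => A B mA mB; rewrite diag_rect.
(* A fixed point is a constant sequence of iterates, so its limit on rectangles is its own value. *)
have := @endogenous_rect_cvg _ _ _ _ _ _ nu g P mu xi N X mg rtp (fun=> m2) A B endo mm
  (fun=> Hm) (fun n => T2_image_realizable n Hm) mA mB.
move=> H; have := cvg_unique _ H (cvg_cst _) => /(_ (@Rhausdorff R)) E.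
have mAB : measurable (A `*` B) by exact: measurableX.
have mI : measurable (A `&` B) by exact: measurableI.
by rewrite -(fineK (fin_num_measure m2 _ mAB)) -(fineK (fin_num_measure mu _ mI)) E.
Qed.

Hypothesis complete : forall u : nat -> borel S,
  (forall e : R, (0 < e)%R -> exists M : nat, forall m n, (M <= m)%N ->
     (M <= n)%N -> (dist (u m) (u n) < e)%R) ->
  exists l : borel S, u @ \oo --> l.

(** Step k picks a depth and a frozen second point for which the tree value is within 1/(k+1) of the
    root, off an event of probability at most 1/2^(k+1). These bounds are summable, so by
    Borel-Cantelli the values [Z k] converge to the root almost surely, and their limit is
    measurable for the innovations. *)
Lemma chain_cvg_endogenous (ms : nat -> probability SS R) :
  meas_eq (ms 0%N) (mu \x mu) -> (forall n, T2_image nu g (ms n) (ms n.+1)) ->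
  weak_cvg ms (diag_law mu) -> endogenous P xi N X.
Proof.
move=> ms0 msS W.
have law n : has_law PP (Y2 n) (ms n).
  apply: (chain_law mg (ms := ms) msS).
  apply: tree_data_meas_eq (rtp_pair_tree_data rtp n).
  by move=> A mA; rewrite ms0.
pose D k n := [set p | (k.+1%:R^-1 <= dist (Y2 n p).1 (Y2 n p).2)%R].
have mS k : measurable [set p : SS | (k.+1%:R^-1 <= dist p.1 p.2)%R].
  have -> : [set p : SS | (k.+1%:R^-1 <= dist p.1 p.2)%R] =
      ~` [set p | (dist p.1 p.2 < k.+1%:R^-1)%R].
    by apply/seteqP; split => p /=; rewrite leNgt => /negP.
  apply: measurableC.
  exact: (measurable_dist_lt met (f := fst) (h := snd) _ measurable_fst measurable_snd).
have mD k n : measurable (D k n).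
  by rewrite -[X in measurable X]setTI; exact: (measurable_Y2 n measurableT (mS k)).
have HD k : exists no : nat * Omega,
    P [set om | D k no.1 (om, no.2)] <= (1 / (2 ^ k.+1)%:R)%:E.
  have e0 : (0 < 1 / (2 ^ k.+1)%:R :> R)%R by rewrite divr_gt0// ltr0n expn_gt0.
  have k0 : (0 < (k.+1%:R^-1 : R) <= 1)%R.
    by rewrite invr_gt0 ltr0n /= invf_le1// ler1n.
  have [n _ /(_ n (leqnn n)) /= Hn] := weak_cvg_mindist met W k0 e0.
  have Hn' : PP (D k n) < (1 / (2 ^ k.+1)%:R)%:E.
    by have [_ /(_ _ (mS k)) ln] := law n; move: Hn; rewrite -ln.
  have [om Hom] := small_section (mD k n) Hn'.
  by exists (n, om).
have [no Hno] := choice HD.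
pose GG := \bigcup_(w in [set: word]) sigma_of (xiN xi N w).
pose Z k om := ev g (no k).1 (z^~ om) (X^~ (no k).2).
have mZ k : measurable_fun setT (Z k : g_sigma_algebraType GG -> borel S).
  apply: (@measurable_ev _ _ _ _ mg _ (g_sigma_algebraType GG) (no k).1 z
    (fun w _ => X w (no k).2)) => w _; last exact: measurable_cst.
  by apply: measurable_fun_gen => A sA; apply: sub_sigma_algebra; exists w.
have [F mF HF] := measurable_limit met complete mZ.
exists F; split.
  by move=> A mA; have := mF measurableT A mA; rewrite setTI.
pose B k := [set om | D k (no k).1 (om, (no k).2)].
have mB k : measurable (B k).
  have := measurable_ysection (no k).2 (mD k (no k).1).
  by congr measurable; apply/seteqP; split => x; rewrite /ysection /= in_setE.
have L0 : P (lim_sup_set B) = 0.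
  apply: lim_sup_set_cvg0 => //.
  apply: (@le_lt_trans _ _ (\sum_(k <oo) (1 / (2 ^ k.+1)%:R)%:E)).
    by apply: lee_nneseries => *; [exact: measure_ge0|exact: Hno].
  by rewrite (le_lt_trans (epsilon_trick0 _ _))// ltry.
have ae1 : {ae P, forall om, ~ lim_sup_set B om}.
  exists (lim_sup_set B); split => //; last by move=> om /= /contrapT.
  apply: bigcap_measurable => // n _; apply: bigcup_measurable => k _; exact: mB.
have ae2 : {ae P, forall om, forall n,
    X [::] om = ev g n (fun w => z w om) (fun w => X w om)}.
  by apply: ae_foralln => n; exact: (rtp_eval rtp n).
apply: filterS2 ae1 ae2 => om nL E; apply/esym; apply: HF.
move: nL => /existsNP[n0] /not_implyP[_ nB].
move=> e /inv_lt[k ke]; exists (maxn n0 k) => n; rewrite geq_max => /andP[n0n kn].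
have : ~ B n om by move=> Bn; apply: nB; exists n.
(* The first coordinate keeps the leaves of the RTP, so by [E] it is the root. *)
rewrite /B /D /= => /negP; rewrite -ltNge /rtp_pair /zz /= -E => Hn.
rewrite (distC met) /Z; apply: lt_trans ke; apply: lt_le_trans Hn _.
by rewrite lef_pV2 ?posrE// ler_nat.
Qed.

End metrized.
End main_parts.

(** * Correlations of conditional probabilities *)

Section correlations.
Context {R : realType} {dT : measure_display} {Theta : measurableType dT}
  {S : ptopologicalType} {dO : measure_display} {Omega : measurableType dO}.
Variables (nu : probability (Theta * natinf)%type R)
  (g : Theta -> natinf -> (nat -> borel S) -> borel S)
  (P : probability Omega R) (mu : probability (borel S) R)
  (xi : word -> Omega -> Theta) (N : word -> Omega -> natinf)
  (X : word -> Omega -> borel S).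
Hypothesis mg : g_measurable g.
Hypothesis rtp : invariant_RTP P nu g mu xi N X.
Local Notation SS := (borel S * borel S)%type.
Local Notation E := (Theta * natinf)%type.
Local Notation z := (xiN xi N).
Local Open Scope ereal_scope.

Let PP : probability (Omega * Omega)%type R := P \x P.
Let ms := pair_chain mg rtp.

Definition crossev n (A : set (borel S)) : set (Omega * Omega) :=
  [set p | A (ev g n (fun w => z w p.1) (fun w => X w p.2))].

(** Averaging over resampled leaves gives a version of the conditional probability that the root
    lies in [A], given the innovations of the first [n] generations. *)
Definition condp n A om : \bar R := P [set om' | crossev n A (om, om')].

Lemma measurable_crossev n A : measurable A -> measurable (crossev n A).
Proof.
move=> mA; have := measurable_Y2 mg rtp n measurableT (measurableX measurableT mA).
by congr measurable; apply/seteqP; split => p; rewrite /crossev /=; [move=> [_ []]|].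
Qed.

Lemma condpE n A om : condp n A om = P (xsection (crossev n A) om).
Proof.
by congr (P _); apply/seteqP; split => y; rewrite /xsection /= in_setE.
Qed.

Lemma measurable_condp n A : measurable A -> measurable_fun setT (condp n A).
Proof.
move=> mA; rewrite (_ : condp n A = fun om => P (xsection (crossev n A) om)).
  apply: measurable_fun_xsection; exact: measurable_crossev.
by apply/funext => om; rewrite condpE.
Qed.

Lemma condp_le1 n A om : measurable A -> 0 <= condp n A om <= 1.
Proof.
move=> mA; rewrite condpE measure_ge0 probability_le1//.
by apply: measurable_xsection; exact: measurable_crossev.
Qed.

Lemma past_ev k B (y : word -> borel S) : measurable B ->
  <<s @past _ E k >> [set e | B (ev g k e y)].
Proof.
move=> mB.
have := @measurable_ev _ _ _ _ mg _ (g_sigma_algebraType (@past _ E k)) k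
  (fun w e => e w) (fun w _ => y w).
move=> /(_ _ _ measurableT B mB); rewrite setTI; apply => w wk.
  apply: measurable_fun_gen => A sA; apply: sub_sigma_algebra.
  by exists w.
exact: measurable_cst.
Qed.

(* For fixed [om2] the second event depends only on the innovations of the first k
   generations, so the resampled root may be replaced by the root of the RTP. *)
Lemma cross_law n k A B om2 : measurable A -> measurable B -> (k <= n)%N ->
  PP [set p | crossev n A p /\ crossev k B (p.1, om2)] =
  P [set om | A (ev g k (z^~ om) (X^~ om)) /\ crossev k B (om, om2)].
Proof.
move=> mA mB kn.
have D1 := tree_data_snd (fun A mA => (marginals_prod mu mA).2) (rtp_pair_tree_data rtp n).
have D2 := rtp_tree_data rtp n.
pose C := [set e | B (ev g k e (X^~ om2))].
have sC : <<s @past _ E k >> C by exact: past_ev.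
have sD : <<s @tree_cyls _ E _ (borel S) n >>
    ([set t | A (ev g n t.1 t.2)] `&` [set t | C t.1]).
  apply: (@measurableI _ (g_sigma_algebraType (@tree_cyls _ E _ (borel S) n))).
    exact: tree_cyls_ev.
  exact: tree_cyls_past kn sC.
have := tree_data_law D1 D2 sD.
rewrite /preimage /= => H.
transitivity (P [set om | A (ev g n (z^~ om) (X^~ om)) /\ C (z^~ om)]).
  exact: H.
have mC : measurable [set om | C (z^~ om)].
  by apply: (measurable_past_fun _ sC) => w _; exact: (measurable_z rtp).
have mev m : measurable [set om | A (ev g m (z^~ om) (X^~ om))].
  by rewrite -[X in measurable X]setTI; exact: (measurable_evX mg rtp).
apply: ae_eq_prob; [exact: (measurableI _ _ (mev n) mC)|exact: (measurableI _ _ (mev k) mC)|].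
apply: filterS2 (rtp_eval rtp n) (rtp_eval rtp k) => om /= en ek.
by rewrite /setI /mkset -en -ek; split.
Qed.

(** A product of conditional probabilities is the probability of two events built on a common om
    with leaves resampled independently. Since k is at most n, [cross_law] replaces the first
    resampled root by the true one, and the outcome no longer depends on n: this is the martingale
    property of [condp]. *)
Lemma condp_corr n k A B : measurable A -> measurable B -> (k <= n)%N ->
  \int[P]_om (condp n A om * condp k B om) = ms k (A `*` B).
Proof.
move=> mA mB kn.
pose D3 : set ((Omega * Omega) * Omega) :=
  [set t | crossev n A t.1 /\ crossev k B (t.1.1, t.2)].
have mn := measurable_crossev n mA; have mk := measurable_crossev k mB.
have mD3 : measurable D3.
  apply: measurableI.
    by have := @measurable_fst _ _ (Omega * Omega)%type Omega measurableT _ mn;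
      rewrite setTI.
  have mf : measurable_fun setT (fun t : (Omega * Omega) * Omega => (t.1.1, t.2)).
    apply: measurable_fun_pair; last exact: measurable_snd.
    exact: measurableT_comp measurable_fst measurable_fst.
  by have := mf measurableT _ mk; rewrite setTI.
(* Integrating the third point first yields the product of conditional probabilities; freezing it
   instead brings in [cross_law]. *)
transitivity ((PP \x P) D3).
  rewrite product_xsection//.
  under [RHS]eq_integral => p _.
    rewrite (_ : P _ = (\1_(crossev n A) p)%:E * condp k B p.1); last first.
      rewrite indicE; case: (boolP (p \in _)) => [|/negP]; rewrite inE => pn.
        by rewrite mul1e; congr (P _); apply/seteqP; split => y;
          rewrite /D3 /=; tauto.
      rewrite mul0e (_ : [set y | _] = set0) ?measure0//.
      by apply/seteqP; split => y; rewrite /D3 /=; tauto.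
    over.
  have mc := measurable_condp k mB.
  rewrite (fubini_tonelli1 (fun p => (\1_(crossev n A) p)%:E * condp k B p.1)).
  - apply: eq_integral => om _; rewrite /fubini_F /=.
    have c0 : 0 <= condp k B om by case/andP: (condp_le1 k om mB).
    rewrite ge0_integralZr//.
    + congr (_ * _); rewrite condpE.
      by have /(congr1 (fun f => f om)) := @indic_fubini_tonelli_FE _ _ _ _ R P _ mn.
    + apply/measurable_EFinP.
      exact: (measurable_fun_pair2 om (measurable_indic mn)).
  - apply: emeasurable_funM.
      by apply/measurable_EFinP; exact: measurable_indic.
    exact: measurableT_comp mc measurable_fst.
  - by move=> p; rewrite mule_ge0// ?lee_fin//; case/andP: (condp_le1 k p.1 mB).
rewrite product_ysection//.
have mAB : measurable [set p : Omega * Omega |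
    A (ev g k (z^~ p.1) (X^~ p.1)) /\ crossev k B p].
  apply: measurableI => //.
  have := measurableT_comp (measurable_evX mg rtp k) measurable_fst.
  by move=> /(_ dO Omega measurableT A mA); rewrite setTI.
have -> : ms k (A `*` B) = (P \x P) [set p : Omega * Omega |
    A (ev g k (z^~ p.1) (X^~ p.1)) /\ crossev k B p] by [].
rewrite [RHS]product_ysection//; apply: eq_integral => om2 _.
exact: cross_law.
Qed.

Let kap n A om : R := fine (condp n A om).

Let bkap n A : measurable A -> bmeas (kap n A).
Proof.
move=> mA; split.
  apply/measurable_EFinP; apply: eq_measurable_fun (measurable_condp n mA) => om _.
  by rewrite /= fineK// condpE fin_num_measure//; apply: measurable_xsection;
    exact: measurable_crossev.
exists 1%R => om; have /andP[c0 c1] := condp_le1 n om mA.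
rewrite ger0_norm ?fine_ge0// -lee_fin fineK//.
by rewrite ge0_fin_numE// (le_lt_trans c1)// ltry.
Qed.

Let kap_corr n k A B : measurable A -> measurable B -> (k <= n)%N ->
  Ex P (fun om => kap n A om * kap k B om)%R = fine (ms k (A `*` B)).
Proof.
move=> mA mB kn; rewrite -(condp_corr mA mB kn) /Ex /Rintegral; congr fine.
have fin m C om : measurable C -> condp m C om \is a fin_num.
  move=> mC; rewrite condpE fin_num_measure//; apply: measurable_xsection.
  exact: measurable_crossev.
by apply: eq_integral => om _; rewrite /kap EFinM !fineK//; exact: fin.
Qed.

Lemma pair_chain_sym n A B : measurable A -> measurable B ->
  fine (ms n (A `*` B)) = fine (ms n (B `*` A)).
Proof.
move=> mA mB; rewrite -!(@kap_corr n n)//; congr (Ex P _).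
by apply/funext => om; rewrite mulrC.
Qed.

(** Second moment of the sum of the two conditional probabilities. It is monotone in [n], and
    polarization recovers the rectangle A x B from it. *)
Let ssum n A B : R := (fine (ms n (A `*` A)) + 2 * fine (ms n (A `*` B)) +
  fine (ms n (B `*` B)))%R.

Let Ex_ssum n k A B : measurable A -> measurable B -> (k <= n)%N ->
  Ex P (fun om => (kap n A om + kap n B om) * (kap k A om + kap k B om))%R =
  ssum k A B.
Proof.
move=> mA mB kn; rewrite /ssum.
rewrite (_ : (fun om => _) = (fun om => (kap n A om * kap k A om +
    kap n A om * kap k B om) + (kap n B om * kap k A om + kap n B om * kap k B om)))%R;
  last by apply/funext => om; ring.
have b C D : measurable C -> measurable D ->
    bmeas (fun om => kap n C om * kap k D om)%R.
  by move=> mC mD; apply: bmeasM; exact: bkap.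
rewrite !ExD; try (by [exact: b|apply: bmeasD; exact: b]).
rewrite !kap_corr// (pair_chain_sym k mB mA); ring.
Qed.

(** By [Ex_ssum] the increments of [u] are orthogonal to its past: the mean of the squared increment
    is the increment of the second moments, hence nonnegative. *)
Let ssum_nd A B : measurable A -> measurable B -> nondecreasing_seq (fun n => ssum n A B).
Proof.
move=> mA mB; apply/nondecreasing_seqP => k.
pose u n om := (kap n A om + kap n B om)%R.
have bu n : bmeas (u n) by apply: bmeasD; exact: bkap.
have : (0 <= Ex P (fun om => (u k.+1 om * u k.+1 om + u k om * u k om) -
    2 * (u k.+1 om * u k om)))%R.
  rewrite -(Ex_cst P 0%R); apply: Ex_le; first exact: bmeas_cst.
    apply: bmeasB; last by apply: bmeasZ; exact: bmeasM.
    by apply: bmeasD; exact: bmeasM.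
  move=> om; have := sqr_ge0 (u k.+1 om - u k om); rewrite expr2.
  by set a := u _ om; set b := u k om; nra.
rewrite ExB; last 2 first.
- by apply: bmeasD; exact: bmeasM.
- by apply: bmeasZ; exact: bmeasM.
rewrite ExD; try exact: bmeasM.
rewrite ExZ; last exact: bmeasM.
rewrite !Ex_ssum//; lra.
Qed.

Let ssum_cvg A B : measurable A -> measurable B -> cvgn (fun n => ssum n A B).
Proof.
move=> mA mB; apply: (@nondecreasing_is_cvgn R); first exact: ssum_nd.
(* 4 = 1 + 2 + 1, each rectangle having probability at most 1. *)
exists 4%R => _ [n _ <-].
have le1 C D : measurable C -> measurable D -> (fine (ms n (C `*` D)) <= 1)%R.
  move=> mC mD; rewrite -lee_fin fineK ?fin_num_measure//; last exact: measurableX.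
    by apply: probability_le1; exact: measurableX.
have := le1 A A mA mA; have := le1 A B mA mB; have := le1 B B mB mB.
rewrite /ssum; lra.
Qed.

Lemma pair_chain_rect_cvg A B : measurable A -> measurable B ->
  cvgn (fun n => fine (ms n (A `*` B))).
Proof.
move=> mA mB.
have c1 := ssum_cvg mA mB.
(* An empty second event isolates the squares A x A and B x B. *)
have E n (C : set (borel S)) : ssum n C set0 = fine (ms n (C `*` C)).
  by rewrite /ssum !setX0 measure0 /= mulr0 !addr0.
have c2 : cvgn (fun n => fine (ms n (A `*` A))).
  by have := ssum_cvg mA measurable0; under eq_fun do rewrite E.
have c3 : cvgn (fun n => fine (ms n (B `*` B))).
  by have := ssum_cvg mB measurable0; under eq_fun do rewrite E.
rewrite (_ : (fun n => _) = (fun n => 2^-1 * (ssum n A B -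
    (fine (ms n (A `*` A)) + fine (ms n (B `*` B))))))%R; last first.
  by apply/funext => n; rewrite /ssum; field.
exact: cvgP (cvgM (cvg_cst _) (cvgB c1 (cvgD c2 c3))).
Qed.

End correlations.

(** * Random bits and the limiting coupling *)

Fixpoint bitprefix (c : nat -> bool) (n : nat) : seq bool :=
  if n is n'.+1 then c n' :: bitprefix c n' else [::].

Lemma size_bitprefix c n : size (bitprefix c n) = n.
Proof. by elim: n => //= n ->. Qed.

Lemma bitprefix_eqP c c' n :
  bitprefix c n = bitprefix c' n <-> forall i, (i < n)%N -> c i = c' i.
Proof.
elim: n => [|n IH] /=; first by split.
split => [[cn /IH H] i|H].
  by rewrite ltnS leq_eqVlt => /predU1P[->//|]; exact: H.
by rewrite (H n)//; congr cons; apply/IH => i ni; apply: H; exact: ltnW.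
Qed.

(** Half-open like the cells, so that the cells of a given length partition it. *)
Definition unit_measure (R : realType) : set (measurableTypeR R) -> \bar R :=
  mrestr (@lebesgue_measure R) (measurable_itv `[0, 1[).

HB.instance Definition _ (R : realType) := Measure.on (@unit_measure R).

Lemma unit_measureT (R : realType) : unit_measure [set: measurableTypeR R] = 1%E.
Proof.
by rewrite /unit_measure /mrestr setTI lebesgue_measure_itv /= lte_fin ltr01 sube0.
Qed.

HB.instance Definition _ (R : realType) :=
  Measure_isProbability.Build _ _ R (@unit_measure R) (@unit_measureT R).

Section random_bits.
Context {R : realType}.
Variable p : seq bool -> R.
Hypothesis p_ge0 : forall b, 0 <= p b.
Hypothesis p_nil : p [::] = 1.
Hypothesis p_cons : forall b, p (true :: b) + p (false :: b) = p b.

(* Words are stored with the most recent bit first; the interval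
   [left b, left b + p b[ is the cell of the word b, and it is cut into the cells
   of [false :: b] and [true :: b], from left to right. *)
Fixpoint cell_left (b : seq bool) : R :=
  if b is x :: b' then cell_left b' + (if x then p (false :: b') else 0) else 0.

Fixpoint cell_word (n : nat) (u : R) : seq bool :=
  if n is n'.+1 then
    (cell_left (cell_word n' u) + p (false :: cell_word n' u) <= u) :: cell_word n' u
  else [::].

Lemma cell_bounds b : 0 <= cell_left b /\ cell_left b + p b <= 1.
Proof.
elim: b => [|x b [IH1 IH2]] /=; first by rewrite p_nil; lra.
have := p_ge0 (true :: b); have := p_ge0 (false :: b); have := p_cons b.
by case: x; lra.
Qed.

Lemma cell_wordE b u : 0 <= u < 1 ->
  cell_word (size b) u = b <-> cell_left b <= u < cell_left b + p b.
Proof.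
move=> u01; elim: b => [|x b IH] /=; first by rewrite p_nil add0r.
have pt := p_ge0 (true :: b); have pf := p_ge0 (false :: b); have pc := p_cons b.
split.
  move=> [+ E]; rewrite E => xE; have := IH.1 E.
  by case: x xE; move: (leP (cell_left b + p (false :: b)) u) => []; lra.
move=> H; have E : cell_word (size b) u = b.
  by apply/IH; case: x H; lra.
rewrite E; congr cons; case: x H => H.
  by apply/idP; lra.
by apply/negbTE; rewrite -ltNge; lra.
Qed.

Lemma measurable_cell_word n b : measurable [set u : R | cell_word n u = b].
Proof.
elim: n b => [|n IH] b /=.
  have [->|b0] := eqVneq b [::].
    by rewrite (_ : [set _ | _] = setT)//; apply/seteqP; split.
  rewrite (_ : [set _ | _] = set0)//; apply/seteqP; split => // u /= bE.
  by rewrite -bE eqxx in b0.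
case: b => [|x b]; first by rewrite (_ : [set _ | _] = set0)//; apply/seteqP; split.
set t := cell_left b + p (false :: b).
rewrite (_ : [set _ | _] = [set u | cell_word n u = b] `&` [set u | (t <= u) = x]).
  apply: measurableI => //; case: x.
    rewrite (_ : [set u | _] = `[t, +oo[%classic)//.
    by apply/seteqP; split => u /=; rewrite in_itv /= andbT.
  rewrite (_ : [set u | _] = `]-oo, t[%classic)//.
  apply/seteqP; split => u /=; rewrite in_itv /= ltNge; first by move=> ->.
  by move=> /negbTE.
apply/seteqP; split => u /=; first by move=> [xE bE]; rewrite -xE bE.
by move=> [bE xE]; rewrite bE -/t xE.
Qed.

Lemma unit_cell b : unit_measure [set u | cell_word (size b) u = b] = (p b)%:E.
Proof.
have [l0 h1] := cell_bounds b; have pb := p_ge0 b.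
rewrite /unit_measure /mrestr.
rewrite (_ : _ `&` _ = `[cell_left b, (cell_left b + p b)[%classic).
  rewrite lebesgue_measure_itv /= lte_fin; case: ltP => H.
    by rewrite -EFinB addrAC subrr add0r.
  by congr (_%:E); lra.
apply/seteqP; split => u /=; rewrite !in_itv /=.
  by move=> [bE u01]; apply/(cell_wordE b u01).
move=> H; have u01 : 0 <= u < 1 by lra.
by split => //; apply/(cell_wordE b u01).
Qed.

Lemma random_bits :
  exists d (T : measurableType d) (Q : probability T R) (c : nat -> T -> bool),
    (forall i, measurable [set u | c i u]) /\
    forall n (beta : nat -> bool),
      Q [set u | forall i, (i < n)%N -> c i u = beta i] = (p (bitprefix beta n))%:E.
Proof.
exists _, (measurableTypeR R), (@unit_measure R),
  (fun i u => head false (cell_word i.+1 u)).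
have E n u : cell_word n u = bitprefix (fun i => head false (cell_word i.+1 u)) n.
  by elim: n => //= n ->.
split => [i|n beta].
  rewrite (_ : [set u | _] = \bigcup_(b in [set: seq bool])
      [set u | cell_word i.+1 u = true :: b]).
    by apply: countable_bigcupT_measurable => // b; exact: measurable_cell_word.
  apply/seteqP; split => u /=; last by move=> [b _ /= [-> _]].
  by move=> H; exists (cell_word i u) => //=; rewrite H.
rewrite -unit_cell size_bitprefix; congr (unit_measure _).
by apply/seteqP; split => u /= H; [rewrite E; apply/bitprefix_eqP|
  apply/bitprefix_eqP; rewrite -E].
Qed.

End random_bits.

Lemma nth_bitprefix beta n i : (i < n)%N -> nth false (rev (bitprefix beta n)) i = beta i.
Proof.
elim: n => // n IH; rewrite /= rev_cons nth_rcons size_rev size_bitprefix.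
by rewrite ltnS leq_eqVlt => /predU1P[->|ni]; rewrite ?ltnn ?eqxx// ni IH.
Qed.

(** * Laws of bit patterns *)

Section patterns.
Context {R : realType} {dV : measure_display} {V : measurableType dV}.
Variable pp : set V -> set V -> R.
Hypothesis pp_ge0 : forall A B, measurable A -> measurable B -> 0 <= pp A B.
Hypothesis ppT : pp setT setT = 1.
Hypothesis ppUl : forall A A' B, measurable A -> measurable A' -> measurable B ->
  A `&` A' = set0 -> pp (A `|` A') B = pp A B + pp A' B.
Hypothesis ppUr : forall A A' B, measurable A -> measurable A' -> measurable B ->
  A `&` A' = set0 -> pp B (A `|` A') = pp B A + pp B A'.
Variables (J : nat -> nat) (sd : nat -> bool) (W : nat -> set V).
Hypothesis mW : forall i, measurable (W i).
Implicit Types (pi rho : nat -> bool -> bool).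

(** A pattern [pi] allows the value [v] for bit [i] when [pi i v] holds. This is the constraint that
    its first [L] bits put on the coordinate [sg] of the pair [j]. *)
Definition psel (j : nat) (sg : bool) (pi : nat -> bool -> bool) (L : nat) : set V :=
  [set x | forall i, (i < L)%N && (J i == j) && (sd i == sg) -> pi i `[< W i x >]].

(** The probability a pattern must have if the pairs are independent and [pp] gives the law of one
    pair on rectangles. *)
Definition pprod K pi L : R :=
  \prod_(j < K) pp (psel j true pi L) (psel j false pi L).

Definition pbound K L := forall i, (i < L)%N -> (J i < K)%N.

Lemma measurable_psel j sg pi L : measurable (psel j sg pi L).
Proof.
apply: measurable_foralln => i; apply: measurable_imply.
have -> : [set x | pi i `[< W i x >]] =
    (W i `&` [set _ | pi i true]) `|` (~` W i `&` [set _ | pi i false]).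
  apply/seteqP; split => x /=.
    by case: asboolP => Wx H; [left|right].
  by case=> -[Wx H]; [rewrite asboolT|rewrite asboolF].
have mb (b : bool) : measurable ([set _ | b] : set V).
  case: b; first by rewrite (_ : [set _ | _] = setT)//; apply/seteqP; split.
  by rewrite (_ : [set _ | _] = set0)//; apply/seteqP; split.
by apply: measurableU; apply: measurableI => //; exact: measurableC.
Qed.

Lemma pp0l B : measurable B -> pp set0 B = 0.
Proof.
move=> mB; have := ppUl measurable0 measurable0 mB (setI0 _).
by rewrite setU0; lra.
Qed.

Lemma pp0r B : measurable B -> pp B set0 = 0.
Proof.
move=> mB; have := ppUr measurable0 measurable0 mB (setI0 _).
by rewrite setU0; lra.
Qed.

Lemma eq_psel j sg pi pi' L : (forall i, (i < L)%N -> pi i =1 pi' i) ->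
  psel j sg pi L = psel j sg pi' L.
Proof.
by move=> H; apply/seteqP; split => x Hx i /[dup] /andP[/andP[iL _] _] /Hx; rewrite H.
Qed.

Lemma eq_pprod K pi pi' L : (forall i, (i < L)%N -> pi i =1 pi' i) ->
  pprod K pi L = pprod K pi' L.
Proof.
by move=> H; apply: eq_bigr => j _; rewrite !(eq_psel _ _ H).
Qed.

Lemma psel_free j sg pi L :
  (forall i, (i < L)%N -> J i = j -> forall v, pi i v) -> psel j sg pi L = setT.
Proof.
move=> H; apply/seteqP; split => // x _ i /andP[/andP[iL /eqP ij] _]; exact: H.
Qed.

Lemma pprod_bound K K' pi L : pbound K L -> (K <= K')%N -> pprod K' pi L = pprod K pi L.
Proof.
move=> bK /subnKC <-; rewrite /pprod big_split_ord /= [X in _ * X]big1 ?mulr1// => j _.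
by rewrite !psel_free ?ppT// => i /bK + ij; rewrite ij ltnNge leq_addr.
Qed.

Definition prestr (t : nat) (v : bool) (pi : nat -> bool -> bool) : nat -> bool -> bool :=
  fun i w => pi i w && ((i != t) || (w == v)).

Lemma psel_restr j sg t v pi L : (t < L)%N -> psel j sg (prestr t v pi) L =
  if (J t == j) && (sd t == sg) then
    psel j sg pi L `&` (if v then W t else ~` W t) else psel j sg pi L.
Proof.
move=> tL; case: ifPn => Ht.
  apply/seteqP; split => x.
    move=> H; split; first by move=> i /H /andP[].
    have := H t; rewrite tL -andbA Ht /prestr eqxx /= => /(_ isT) /andP[_].
    by case: (v); [move=> /eqP/asboolP|move=> /eqP/asboolPn].
  move=> [H Hv] i iL; rewrite /prestr H//=; case: eqP => //= ->.
  by move: Hv; case: (v) => ?; [rewrite asboolT|rewrite asboolF].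
apply/seteqP; split => x H i iL; first by have /andP[] := H i iL.
rewrite /prestr H//=; case: eqP => //= it; move: iL; rewrite it => /andP[/andP[_ h1] h2].
by rewrite h1 h2 in Ht.
Qed.

(** Pinning bit [t] changes one side of the single factor [J t], and there finite additivity of [pp]
    cuts that side by [W t]. *)
Lemma pprod_split K t pi L : pbound K L -> (t < L)%N ->
  pprod K pi L = pprod K (prestr t true pi) L + pprod K (prestr t false pi) L.
Proof.
move=> bK tL; pose j0 := Ordinal (bK t tL).
rewrite /pprod !(bigD1 j0 isT) /=.
have E v : \prod_(j < K | j != j0) pp (psel j true (prestr t v pi) L)
      (psel j false (prestr t v pi) L) =
    \prod_(j < K | j != j0) pp (psel j true pi L) (psel j false pi L).
  apply: eq_bigr => j jj; rewrite !psel_restr//.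
  have /negbTE -> : J t != j by apply: contra jj => /eqP E; apply/eqP/val_inj.
  by [].
rewrite !E -mulrDl; congr (_ * _).
rewrite !psel_restr// eqxx /=.
have mp sg := measurable_psel (J t) sg pi L.
have mC : measurable (~` W t) by exact: measurableC.
have US (A : set V) : A = (A `&` W t) `|` (A `&` ~` W t).
  by rewrite -setIUr setUv setIT.
have dis (A : set V) : (A `&` W t) `&` (A `&` ~` W t) = set0.
  by rewrite setIACA setICr setI0.
case: (sd t) => /=.
- by rewrite [in LHS](US (psel (J t) true pi L)) ppUl//; exact: measurableI.
- by rewrite [in LHS](US (psel (J t) false pi L)) ppUr//; exact: measurableI.
Qed.

Definition pfull (beta : nat -> bool) : nat -> bool -> bool := fun i v => v == beta i.

Definition Kof L := (\max_(i < L) J i).+1.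

Lemma pbound_Kof L : pbound (Kof L) L.
Proof. by move=> i iL; rewrite ltnS; exact: (leq_bigmax (Ordinal iL)). Qed.

Lemma Kof_le L : (Kof L <= Kof L.+1)%N.
Proof. by rewrite /Kof ltnS big_ord_recr leq_maxl. Qed.

(** Words list the latest bit first, hence [rev]. *)
Definition bitlaw (b : seq bool) : R :=
  pprod (Kof (size b)) (pfull (nth false (rev b))) (size b).

Lemma bitlaw_ge0 b : 0 <= bitlaw b.
Proof. by apply: prodr_ge0 => j _; apply: pp_ge0; exact: measurable_psel. Qed.

Lemma bitlaw_nil : bitlaw [::] = 1.
Proof. by apply: big1 => j _; rewrite !psel_free. Qed.

Lemma bitlaw_cons b : bitlaw (true :: b) + bitlaw (false :: b) = bitlaw b.
Proof.
set n := size b; have bK := @pbound_Kof n.+1.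
(* Leaves the new bit free, so that [bitlaw b] splits along its two values. *)
pose pi' i v := (i < n)%N ==> pfull (nth false (rev b)) i v.
have E v : bitlaw (v :: b) = pprod (Kof n.+1) (prestr n v pi') n.+1.
  apply: eq_pprod => i; rewrite ltnS leq_eqVlt => iL w.
  rewrite /pfull /prestr /pi' rev_cons nth_rcons size_rev -/n.
  by case: ltngtP iL => //= *; rewrite ?andbT ?eqxx.
rewrite !E -pprod_split// /bitlaw -/n -(pprod_bound _ (@pbound_Kof n) (Kof_le n)).
rewrite -(@eq_pprod _ pi' _ n); last by move=> i ni v; rewrite /pi' ni.
apply: eq_bigr => j _; congr pp.
  apply/seteqP; split => x H i iL; last first.
    rewrite /pi'; have [ni|//] := boolP (i < n)%N.
    have := H i; rewrite /pi' ni /=; apply.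
    by move: iL => /andP[/andP[_ ->] ->].
  by apply: H; move: iL => /andP[/andP[/ltnW h1 ->] ->]; rewrite ltnS h1.
apply/seteqP; split => x H i iL; last first.
  rewrite /pi'; have [ni|//] := boolP (i < n)%N.
  have := H i; rewrite /pi' ni /=; apply.
  by move: iL => /andP[/andP[_ ->] ->].
by apply: H; move: iL => /andP[/andP[/ltnW h1 ->] ->]; rewrite ltnS h1.
Qed.

Section pattern_prob.
Context {dQ : measure_display} {T : measurableType dQ}.
Variables (Q : probability T R) (c : nat -> T -> bool).
Hypothesis mc : forall i, measurable [set u | c i u].
Hypothesis Qc : forall n beta,
  Q [set u | forall i, (i < n)%N -> c i u = beta i] = (bitlaw (bitprefix beta n))%:E.

Definition pevent pi L : set T := [set u | forall i, (i < L)%N -> pi i (c i u)].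

Lemma measurable_bit i (q : bool -> bool) : measurable [set u | q (c i u)].
Proof.
have -> : [set u | q (c i u)] = ([set u | c i u] `&` [set _ | q true]) `|`
    (~` [set u | c i u] `&` [set _ | q false]).
  apply/seteqP; split => u /=.
    by case: (c i u) => H; [left|right].
  by case=> -[Hu H]; [rewrite Hu|move/negP/negbTE: Hu => ->].
have mb (b : bool) : measurable ([set _ | b] : set T).
  case: b; first by rewrite (_ : [set _ | _] = setT)//; apply/seteqP; split.
  by rewrite (_ : [set _ | _] = set0)//; apply/seteqP; split.
by apply: measurableU; apply: measurableI => //; exact: measurableC.
Qed.

Lemma measurable_pevent pi L : measurable (pevent pi L).
Proof.
apply: measurable_foralln => i; apply: measurable_imply; exact: measurable_bit.
Qed.

(** Induction on the number [t] of leading bits that may still be undetermined. With every bit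
    pinned the pattern is a single word, covered by [Qc], or contradictory; the inductive step
    splits along bit [t], over which both sides are additive. *)
Lemma pevent_prob K pi L : pbound K L -> Q (pevent pi L) = (pprod K pi L)%:E.
Proof.
move=> bK.
suff S t : forall rho, (forall i, (t <= i < L)%N -> exists b, forall v, rho i v -> v = b) ->
    Q (pevent rho L) = (pprod K rho L)%:E.
  by apply: (S L) => i; case: ltngtP.
elim: t => [|t IH] rho Hrho.
  have /choice[beta Hb] : forall i, exists b, (i < L)%N -> forall v, rho i v -> v = b.
    move=> i; have [iL|_] := boolP (i < L)%N; last by exists true.
    by have [b Hb] := Hrho i iL; exists b.
  have [Hall|/existsNP[i /not_implyP[iL /negP Hi]]] :=
      pselect (forall i, (i < L)%N -> rho i (beta i)).
    have E i : (i < L)%N -> rho i =1 pfull beta i.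
      move=> iL v; apply/idP/idP; rewrite /pfull; first by move/(Hb i iL) => ->.
      by move=> /eqP ->; exact: Hall.
    rewrite (eq_pprod K E).
    have -> : pevent rho L = [set u | forall i, (i < L)%N -> c i u = beta i].
      apply/seteqP; split => u H i iL; last by rewrite H// Hall.
      exact: Hb (H i iL).
    rewrite Qc /bitlaw size_bitprefix; congr (_%:E).
    have -> : pprod (Kof L) (pfull (nth false (rev (bitprefix beta L)))) L =
        pprod (Kof L) (pfull beta) L.
      by apply: eq_pprod => i iL v; rewrite /pfull nth_bitprefix.
    rewrite -(pprod_bound _ (@pbound_Kof L) (leq_maxl _ K)).
    by rewrite -(pprod_bound _ bK (leq_maxr (Kof L) _)).
  (* Bit [i] has no allowed value, so both sides vanish. *)
  have rf v : rho i v = false.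
    apply/negbTE/negP => rv; move: Hi; rewrite -(Hb i iL v rv) rv; by [].
  have -> : pevent rho L = set0.
    by apply/seteqP; split => // u /(_ i iL); rewrite rf.
  rewrite measure0 /pprod (bigD1 (Ordinal (bK i iL)) isT) /=.
  have E0 : psel (J i) (sd i) rho L = set0.
    by apply/seteqP; split => // x /(_ i); rewrite iL !eqxx /= rf => /(_ isT).
  case Es : (sd i) E0 => ->.
    by rewrite pp0l ?mul0r//; exact: measurable_psel.
  by rewrite pp0r ?mul0r//; exact: measurable_psel.
have [tL|Lt] := ltnP t L; last first.
  by apply: IH => i /andP[ti iL]; move: (leq_ltn_trans Lt (leq_ltn_trans ti iL)); rewrite ltnn.
have Hr v : Q (pevent (prestr t v rho) L) = (pprod K (prestr t v rho) L)%:E.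
  apply: IH => i /andP[ti iL]; move: ti; rewrite leq_eqVlt => /predU1P[<-|ti].
    by exists v => w; rewrite /prestr eqxx /= => /andP[_ /eqP].
  have [|b Hb] := Hrho i; first by rewrite ti iL.
  by exists b => w /andP[/Hb].
rewrite (pprod_split _ bK tL) EFinD -!Hr -measureU.
- congr (Q _); apply/seteqP; split => u.
    move=> H; case Ec : (c t u); [left|right] => i iL; rewrite /prestr H//=;
    by case: eqP => //= ->; rewrite Ec.
  by case=> H i iL; have /andP[] := H i iL.
- exact: measurable_pevent.
- exact: measurable_pevent.
- apply/seteqP; split => // u [H1 H2].
  have := H1 t tL; have := H2 t tL; rewrite /prestr eqxx /= => /andP[_ /eqP ->].
  by move=> /andP[].
Qed.

Definition bevents (j : nat) : set (set T) :=
  [set A | exists pi L, A = pevent (fun i v => (J i == j) ==> pi i v) L].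

Lemma bevents_setI j : setI_closed (bevents j).
Proof.
move=> _ _ [pi [L ->]] [pi' [L' ->]].
exists (fun i v => ((i < L)%N ==> pi i v) && ((i < L')%N ==> pi' i v)), (maxn L L').
apply/seteqP; split => u /=.
  move=> [H H'] i _; apply/implyP => ij; apply/andP; split; apply/implyP => iL.
    by have /implyP := H i iL; apply.
  by have /implyP := H' i iL; apply.
move=> H; split => i iL; apply/implyP => ij.
  by have := H i; rewrite leq_max iL ij /= => /(_ isT) /andP[].
by have := H i; rewrite leq_max iL ij orbT /= => /(_ isT) /andP[_].
Qed.

Lemma bevents_prob j pi L :
  Q (pevent (fun i v => (J i == j) ==> pi i v) L) =
  (pp (psel j true pi L) (psel j false pi L))%:E.
Proof.
pose K := maxn j.+1 (Kof L).
have bK : pbound K L by move=> i iL; rewrite leq_max (@pbound_Kof L i iL) orbT.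
have jK : (j < K)%N by rewrite leq_max leqnn.
rewrite (pevent_prob _ bK) /pprod (bigD1 (Ordinal jK) isT) /= big1 ?mulr1; last first.
  move=> k kj.
  have kE sg : psel k sg (fun i v => (J i == j) ==> pi i v) L = setT.
    apply: psel_free => i _ ik v; rewrite ik.
    suff /negbTE -> : (k : nat) != j by [].
    by apply: contra kj => /eqP E; apply/eqP/val_inj.
  by rewrite !kE ppT.
by congr (_%:E); congr pp; apply/seteqP; split => x H i iL;
  have := H i iL; move: iL => /andP[/andP[_ ->] _].
Qed.

Lemma bevents_indep : indep_on Q setT bevents.
Proof.
move=> Js A uJs HA.
have /choice[f Hf] : forall j, exists f : (nat -> bool -> bool) * nat,
    j \in Js -> A j = pevent (fun i v => (J i == j) ==> f.1 i v) f.2.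
  move=> j; have [/HA[_ [pi [L ->]]]|_] := boolP (j \in Js); first by exists (pi, L).
  by exists (fun _ _ => true, 0%N).
pose L := \max_(j <- Js) (f j).2.
(* Each bit obeys the pattern of its own pair, up to the length of that pattern. *)
pose pi i v := (J i \in Js) ==> ((i < (f (J i)).2)%N ==> (f (J i)).1 i v).
have LJ j : j \in Js -> ((f j).2 <= L)%N.
  by move=> jJ; rewrite /L (big_rem j jJ) /= leq_maxl.
have -> : cyl Js A = pevent pi L.
  apply/seteqP; split => u.
    move=> H i _; apply/implyP => iJ; apply/implyP => iL.
    by have := H (J i) iJ; rewrite Hf// => /(_ i iL); rewrite eqxx.
  move=> H j jJ; rewrite Hf// => i iL; apply/implyP => /eqP ij.
  have := H i (leq_trans iL (LJ j jJ)); rewrite /pi ij jJ /= iL; by [].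
pose K := maxn (Kof L) (\max_(j <- Js) j).+1.
have bK : pbound K L by move=> i iL; rewrite leq_max (@pbound_Kof L i iL).
have JK j : j \in Js -> (j < K)%N.
  by move=> jJ; rewrite leq_max ltnS (big_rem j jJ) /= leq_maxl orbT.
rewrite (pevent_prob _ bK).
pose G j := pp (psel j true pi L) (psel j false pi L).
have -> : pprod K pi L = \prod_(j <- Js) G j.
  rewrite /pprod -(big_mkord xpredT G) /index_iota subn0 (bigID (mem Js)) /=.
  rewrite [X in _ * X]big1 ?mulr1; last first.
    move=> j jJ.
    have jE sg : psel j sg pi L = setT.
      by apply: psel_free => i _ ij v; rewrite /pi ij (negbTE jJ).
    by rewrite /G !jE ppT.
  rewrite -big_filter; apply: perm_big; apply: uniq_perm => //.
    by rewrite filter_uniq// iota_uniq.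
  move=> j; rewrite mem_filter mem_iota /= add0n.
  by apply/andP/idP => [[]//|jJ]; split => //; exact: JK.
rewrite -prodEFin; apply: eq_big_seq => j jJ.
rewrite Hf// bevents_prob /G; congr (_%:E); congr pp; apply/seteqP; split => x H i.
- move=> /andP[/andP[iL ij] js]; have := H i.
  by rewrite (leq_trans iL (LJ j jJ)) ij js /pi (eqP ij) jJ iL /=; apply.
- move=> /andP[/andP[iL ij] js]; rewrite /pi (eqP ij) jJ /=; apply/implyP => iL'.
  by apply: H; rewrite iL' ij js.
- move=> /andP[/andP[iL ij] js]; have := H i.
  by rewrite (leq_trans iL (LJ j jJ)) ij js /pi (eqP ij) jJ iL /=; apply.
- move=> /andP[/andP[iL ij] js]; rewrite /pi (eqP ij) jJ /=; apply/implyP => iL'.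
  by apply: H; rewrite iL' ij js.
Qed.

End pattern_prob.
End patterns.

(** * Convergence on rectangles from generating families *)

Section dominated_extension.
Context {R : realType} {d : measure_display} {V : measurableType d}.
Variables (mu : probability V R) (h : nat -> set V -> R) (h' : set V -> R).
(** Finite additivity alone would not control countable unions; a bound by the fixed [mu] makes
    their tails small uniformly over the sequence. *)
Definition dominated (f : set V -> R) : Prop :=
  (forall A B, measurable A -> measurable B -> A `&` B = set0 ->
     f (A `|` B) = f A + f B) /\
  (forall A, measurable A -> 0 <= f A <= fine (mu A)).
Hypothesis hD : forall n, dominated (h n).
Hypothesis h'D : dominated h'.
Variable G : set (set V).
Hypothesis GI : setI_closed G.
Hypothesis Gm : G `<=` measurable.
Hypothesis hT : (fun n => h n setT) @ \oo --> h' setT.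
Hypothesis hG : forall A, G A -> (fun n => h n A) @ \oo --> h' A.

Let domC f A : dominated f -> measurable A -> f (~` A) = f setT - f A.
Proof.
move=> [fU _] mA; rewrite -(setvU A) fU//; first by lra.
  exact: measurableC.
exact: setICl.
Qed.

Let dom_bigU f (F : nat -> set V) K : dominated f -> (forall k, measurable (F k)) ->
  trivIset setT F -> f (\big[setU/set0]_(k < K) F k) = \sum_(k < K) f (F k).
Proof.
move=> [fU f0] mF tF; elim: K => [|K IH].
  rewrite !big_ord0; have /andP[a b] := f0 _ measurable0.
  by rewrite measure0 /= in b; lra.
rewrite !big_ord_recr /= fU ?IH//; first exact: bigsetU_measurable.
by apply: (@trivIset_bigsetUI _ predT) => //; rewrite /predT /= trueE.
Qed.

(** A disjoint union is cut after K terms, the same K for all [h n] and [h']; the two tails and the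
    finite sum cost e/3 each. *)
Lemma dominated_cvg_ext A : <<s G >> A -> (fun n => h n A) @ \oo --> h' A.
Proof.
have sm := sigma_gen_sub Gm.
suff : <<s G >> `<=` [set A | measurable A /\ (fun n => h n A) @ \oo --> h' A].
  by move=> H /H [].
apply: lambda_system_subset => //=.
apply/dynkin_lambda_system; split => /=.
- by split.
- move=> B /= [mB cB]; split; first exact: measurableC.
  rewrite domC//; under eq_fun do rewrite domC//.
  exact: cvgB.
- move=> F tF HF; have mF n : measurable (F n) by case: (HF n).
  have mU : measurable (\bigcup_k F k) by exact: bigcup_measurable.
  split => //.
  apply/cvgrPdist_le => e e0; have e3 : 0 < e / 3 by lra.
  pose U K := \big[setU/set0]_(k < K) F k.
  have mUK K : measurable (U K) by exact: bigsetU_measurable.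
  have [K HK] : exists K, fine (mu ((\bigcup_k F k) `\` U K)) <= e / 3.
    have cv : mu (U n) @[n --> \oo] --> mu (\bigcup_k F k).
      have -> : \bigcup_k F k = \bigcup_n U n.
        rewrite /U eqEsubset; split => x [k _].
          by move=> Fx; exists k.+1 => //; rewrite big_ord_recr; right.
        by rewrite -bigcup_mkord => -[i _ Fx]; exists i.
      apply: nondecreasing_cvg_mu => //; first exact: bigcup_measurable.
      by move=> i j ij; apply/subsetPset/subset_bigsetU.
    have fU : (mu (\bigcup_k F k) \is a fin_num)%E by rewrite fin_num_measure.
    have fUn n : (mu (U n) \is a fin_num)%E by rewrite fin_num_measure.
    move: cv; rewrite -(fineK fU) => /fine_cvgP[_] /cvgrPdist_lt /(_ _ e3).
    move=> [n _ /(_ n (leqnn n))] /= Hn; exists n.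
    have sub : U n `<=` \bigcup_k F k.
      by rewrite /U -bigcup_mkord => x [i _ Fi]; exists i.
    rewrite measureD//; last by rewrite ltey_eq fU.
    rewrite /= setIC (setIidl sub) fineB//.
    by apply: le_trans (ltW Hn); exact: ler_norm.
  have split_U f : dominated f ->
      0 <= f (\bigcup_k F k) - \sum_(k < K) f (F k) <= e / 3.
    move=> fD; have [fU f0] := fD.
    rewrite -(@dom_bigU f F K fD mF tF) -/(U K).
    have -> : f (\bigcup_k F k) = f (U K) + f ((\bigcup_k F k) `\` U K).
      rewrite -fU//; last 2 first.
      - exact: measurableD.
      - by rewrite setDE setIA setIAC setICr set0I.
      by rewrite setDUK// /U -bigcup_mkord => x [i _ Fi]; exists i.
    have /andP[a b] := f0 _ (measurableD mU (mUK K)).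
    by rewrite addrAC subrr add0r a /=; exact: le_trans HK.
  have cS : (fun n => \sum_(k < K) h n (F k)) @ \oo --> \sum_(k < K) h' (F k).
    elim: (K) => [|k IH].
      by rewrite big_ord0; under eq_fun do rewrite big_ord0; exact: cvg_cst.
    rewrite big_ord_recr; under eq_fun do rewrite big_ord_recr.
    by apply: cvgD => //; case: (HF k).
  move/cvgrPdist_le : cS => /(_ _ e3); apply: filterS => n /=.
  have /andP[a1 b1] := split_U _ h'D; have /andP[a2 b2] := split_U _ (hD n).
  by rewrite !ler_norml => /andP[]; lra.
- by move=> B GB; split; [exact: Gm|exact: hG].
Qed.

End dominated_extension.

Section rectangle_extension.
Context {R : realType} {S : ptopologicalType}.
Local Notation SS := (borel S * borel S)%type.
Variables (mu : probability (borel S) R) (ms : nat -> probability SS R)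
  (m : probability SS R).
Hypothesis mms : forall n, marginals_eq mu (ms n).
Hypothesis mm : marginals_eq mu m.

Let dom1 (p : probability SS R) B : marginals_eq mu p -> measurable B ->
  dominated mu (fun A => fine (p (A `*` B))).
Proof.
move=> mp mB; split => [A A' mA mA' AA'|A mA].
  have m1 := measurableX mA mB; have m2 := measurableX mA' mB.
  rewrite (_ : (A `|` A') `*` B = (A `*` B) `|` (A' `*` B)); last first.
    by apply/seteqP; split => -[x y] /=; tauto.
  rewrite measureU// ?fineD ?fin_num_measure//.
  apply/seteqP; split => // -[x y] /= [[Ax _] [Ax' _]].
  by have : (A `&` A') x by []; rewrite AA'.
rewrite fine_ge0//= -(mp _ mA).1 fine_le ?fin_num_measure//; try exact: measurableX.
by apply: le_measure; rewrite ?inE; try exact: measurableX; move=> -[x y] [].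
Qed.

Let dom2 (p : probability SS R) B : marginals_eq mu p -> measurable B ->
  dominated mu (fun A => fine (p (B `*` A))).
Proof.
move=> mp mB; split => [A A' mA mA' AA'|A mA].
  have m1 := measurableX mB mA; have m2 := measurableX mB mA'.
  rewrite (_ : B `*` (A `|` A') = (B `*` A) `|` (B `*` A')); last first.
    by apply/seteqP; split => -[x y] /=; tauto.
  rewrite measureU// ?fineD ?fin_num_measure//.
  apply/seteqP; split => // -[x y] /= [[_ Ax] [_ Ax']].
  by have : (A `&` A') y by []; rewrite AA'.
rewrite fine_ge0//= -(mp _ mA).2 fine_le ?fin_num_measure//; try exact: measurableX.
by apply: le_measure; rewrite ?inE; try exact: measurableX; move=> -[x y] [].
Qed.

(** One side at a time: with the other side fixed, a coupling with marginals [mu] is a set function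
    dominated by [mu]. *)
Lemma rect_cvg_ext (G1 G2 : set (set (borel S))) :
  setI_closed G1 -> setI_closed G2 -> <<s G1 >> = measurable -> <<s G2 >> = measurable ->
  (forall A B, G1 A -> G2 B ->
    (fun n => fine (ms n (A `*` B))) @ \oo --> fine (m (A `*` B))) ->
  forall A B, measurable A -> measurable B ->
    (fun n => fine (ms n (A `*` B))) @ \oo --> fine (m (A `*` B)).
Proof.
move=> I1 I2 s1 s2 H.
have G1m : G1 `<=` measurable by rewrite -s1; exact: sub_sigma_algebra.
have G2m : G2 `<=` measurable by rewrite -s2; exact: sub_sigma_algebra.
have cT1 B : measurable B ->
    (fun n => fine (ms n (setT `*` B))) @ \oo --> fine (m (setT `*` B)).
  move=> mB; rewrite (mm mB).2.
  by under eq_fun do rewrite (mms _ mB).2; exact: cvg_cst.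
have cT2 B : measurable B ->
    (fun n => fine (ms n (B `*` setT))) @ \oo --> fine (m (B `*` setT)).
  move=> mB; rewrite (mm mB).1.
  by under eq_fun do rewrite (mms _ mB).1; exact: cvg_cst.
have H1 A B : measurable A -> G2 B ->
    (fun n => fine (ms n (A `*` B))) @ \oo --> fine (m (A `*` B)).
  move=> mA GB; have mB := G2m _ GB.
  apply: (@dominated_cvg_ext _ _ _ mu (fun n A => fine (ms n (A `*` B)))
    (fun A => fine (m (A `*` B))) _ _ G1) => //; last by rewrite s1.
  - by move=> n; exact: dom1.
  - exact: dom1.
  - exact: cT1.
  - by move=> A' GA'; exact: H.
move=> A B mA mB.
apply: (@dominated_cvg_ext _ _ _ mu (fun n B => fine (ms n (A `*` B)))
  (fun B => fine (m (A `*` B))) _ _ G2) => //; last by rewrite s2.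
- by move=> n; exact: dom2.
- exact: dom2.
- exact: cT2.
- by move=> B' GB'; exact: H1.
Qed.

End rectangle_extension.

(** * Construction of the limit coupling *)

Section limit_coupling.
Context {R : realType} {S : ptopologicalType}.
Local Notation SS := (borel S * borel S)%type.
Variables (dist : borel S -> borel S -> R) (s : nat -> borel S).
Hypothesis met : sepmetric dist s.
Hypothesis complete : forall u : nat -> borel S,
  (forall e : R, 0 < e -> exists M : nat, forall m n, (M <= m)%N ->
     (M <= n)%N -> dist (u m) (u n) < e) ->
  exists l : borel S, u @ \oo --> l.

(* The bit of index (j, sg, (a, k)) tells whether the coordinate sg of the j-th
   pair lies in the ball [bl dist s a k]. *)
Definition bitidx (i : nat) : nat * bool * (nat * nat) :=
  odflt (0%N, false, (0%N, 0%N)) (@unpickle (nat * bool * (nat * nat))%type i).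
Definition bitcode j sg a k : nat := @pickle (nat * bool * (nat * nat))%type (j, sg, (a, k)).
Definition bitcopy i := (bitidx i).1.1.
Definition bitside i := (bitidx i).1.2.
Definition bitset i : set (borel S) := bl dist s (bitidx i).2.1 (bitidx i).2.2.

Lemma bitcodeK j sg a k : bitidx (bitcode j sg a k) = (j, sg, (a, k)).
Proof. by rewrite /bitidx pickleK. Qed.

Lemma measurable_bitset i : measurable (bitset i).
Proof. exact: measurable_bl met _ _. Qed.

Definition psets j sg : set (set (borel S)) :=
  [set A | exists pi L, A = psel bitcopy bitside bitset j sg pi L].

Lemma psets_setI j sg : setI_closed (psets j sg).
Proof.
move=> _ _ [pi [L ->]] [pi' [L' ->]].
exists (fun i v => ((i < L)%N ==> pi i v) && ((i < L')%N ==> pi' i v)), (maxn L L').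
apply/seteqP; split => u /=.
  move=> [H H'] i /andP[/andP[_ ij] is']; apply/andP; split; apply/implyP => iL.
    by apply: H; rewrite iL ij is'.
  by apply: H'; rewrite iL ij is'.
move=> H; split => i /andP[/andP[iL ij] is'].
  by have := H i; rewrite leq_max iL ij is' /= => /(_ isT) /andP[].
by have := H i; rewrite leq_max iL ij is' orbT /= => /(_ isT) /andP[_].
Qed.

Lemma psets_borel j sg : <<s psets j sg >> = @measurable _ (borel S).
Proof.
apply/seteqP; split.
  apply: sigma_gen_sub => _ [pi [L ->]]; apply: measurable_psel.
  exact: measurable_bitset.
apply: smallest_sub; first exact: smallest_sigma_algebra.
move=> U oU.
have bls a k : <<s psets j sg >> (bl dist s a k).
  apply: sub_sigma_algebra.
  exists (fun i v => (i == bitcode j sg a k) ==> v), (bitcode j sg a k).+1.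
  apply/seteqP; split => x /=.
    move=> Hx i _; apply/implyP => /eqP ->; apply/asboolP.
    by rewrite /bitset bitcodeK.
  move=> /(_ (bitcode j sg a k)); rewrite ltnS leqnn /bitcopy /bitside bitcodeK /= !eqxx /=.
  by move=> /(_ isT) /asboolP; rewrite /bitset bitcodeK.
have -> : U = \bigcup_(i in [set: nat]) (if @unpickle (nat * nat)%type i is Some p then
    (if `[< bl dist s p.1 p.2 `<=` U >] then bl dist s p.1 p.2 else set0) else set0).
  apply/seteqP; split => x.
    move=> Ux; have [a [k [xk kU]]] : exists a k, bl dist s a k x /\ bl dist s a k `<=` U.
      by apply: (bl_basis met); exact: open_nbhs_nbhs.
    by exists (pickle (a, k)) => //; rewrite pickleK /= asboolT.
  by move=> [i _]; case: unpickle => // p; case: asboolP => // pU; exact: pU.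
apply: (@bigcup_measurable _ (g_sigma_algebraType (psets j sg))) => i _.
case: unpickle => [p|]; last exact: sigma_algebra0.
by case: asboolP => _; [exact: bls|exact: sigma_algebra0].
Qed.

Definition bitcyls j sg : set (set (nat -> bool)) :=
  [set A | exists (pi : nat -> bool -> bool) L, A = [set x | forall i,
     (i < L)%N && (bitcopy i == j) && (bitside i == sg) -> pi i (x i)]].

Lemma bitcyls_setI j sg : setI_closed (bitcyls j sg).
Proof.
move=> _ _ [pi [L ->]] [pi' [L' ->]].
exists (fun i v => ((i < L)%N ==> pi i v) && ((i < L')%N ==> pi' i v)), (maxn L L').
apply/seteqP; split => u /=.
  move=> [H H'] i /andP[/andP[_ ij] is']; apply/andP; split; apply/implyP => iL.
    by apply: H; rewrite iL ij is'.
  by apply: H'; rewrite iL ij is'.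
move=> H; split => i /andP[/andP[iL ij] is'].
  by have := H i; rewrite leq_max iL ij is' /= => /(_ isT) /andP[].
by have := H i; rewrite leq_max iL ij is' orbT /= => /(_ isT) /andP[_].
Qed.

Lemma bitcyls_bit j sg i : bitcopy i = j -> bitside i = sg ->
  bitcyls j sg [set x | x i].
Proof.
move=> ij si; exists (fun i' v => (i' == i) ==> v), i.+1.
apply/seteqP; split => x /=.
  by move=> xi i' _; apply/implyP => /eqP ->.
by move=> /(_ i); rewrite ltnS leqnn ij si !eqxx; apply.
Qed.

(** All pairs and both sides of the code are filled with the same point, so that any coordinate
    alone determines it. *)
Definition encode (y : borel S) : nat -> bool := fun i => `[< bitset i y >].

(** At precision k, take the first centre whose ball of radius 1/(k+1) is marked by the bits of this
    coordinate. On the code of y these centres converge to y, and [measurable_limit] extends the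
    limit to all bit sequences. *)
Lemma decoder j sg : exists2 Phi : (nat -> bool) -> borel S,
  measurable_fun setT (Phi : g_sigma_algebraType (bitcyls j sg) -> borel S) &
  forall y, Phi (encode y) = y.
Proof.
pose M := g_sigma_algebraType (bitcyls j sg).
pose first k a : set M := [set x | x (bitcode j sg a k) /\
  forall a', (a' < a)%N -> ~ x (bitcode j sg a' k)].
pose f k (x : M) : borel S := s (xget 0%N [set a | first k a x]).
have mbit a k : measurable ([set x | x (bitcode j sg a k)] : set M).
  apply: sub_sigma_algebra; apply: bitcyls_bit.
    by rewrite /bitcopy bitcodeK.
  by rewrite /bitside bitcodeK.
have mfirst k a : measurable (first k a).
  apply: (@measurableI _ M [set x | x (bitcode j sg a k)]) => //.
  apply: (@measurable_foralln _ M
    (fun a' x => (a' < a)%N -> ~ x (bitcode j sg a' k))) => a'.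
  apply: (@measurable_imply _ M _ (fun x => ~ x (bitcode j sg a' k))).
  exact: (@measurableC _ M _ (mbit a' k)).
have first_inj k a a' x : first k a x -> first k a' x -> a = a'.
  move=> [h1 h2] [h3 h4]; have [aa|aa|//] := ltngtP a a'; first by case: (h4 a aa).
  by case: (h2 a' aa).
have xgetE k a x : first k a x -> xget 0%N [set a | first k a x] = a.
  by move=> H; case: xgetP => [b _ Hb|/(_ a)//]; exact: first_inj Hb H.
have mf k : measurable_fun setT (f k).
  move=> _ A mA; rewrite setTI.
  have mc (B : Prop) : measurable ([set _ | B] : set M).
    have [b|nb] := pselect B.
      by rewrite (_ : [set _ | _] = setT)//; apply/seteqP; split.
    by rewrite (_ : [set _ | _] = set0)//; apply/seteqP; split.
  have -> : f k @^-1` A = (\bigcup_a (first k a `&` [set _ | A (s a)])) `|`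
      (~` (\bigcup_a first k a) `&` [set _ | A (s 0%N)]).
    apply/seteqP; split => x /=; rewrite /f.
      have [[a Ha]|nE] := pselect (exists a, first k a x).
        by rewrite (xgetE k a x Ha) => Aa; left; exists a.
      case: xgetP => [a _ Ha|_ A0]; first by case: nE; exists a.
      by right; split => // -[a _ Ha]; apply: nE; exists a.
    case=> [[a _ [Ha Aa]]|[nE A0]]; first by rewrite (xgetE k a x Ha).
    by case: xgetP => [a _ Ha|//]; case: nE; exists a.
  apply: measurableU; first by apply: bigcup_measurable => a _; exact: measurableI.
  by apply: measurableI => //; apply: measurableC; exact: bigcup_measurable.
have [Phi mPhi HPhi] := measurable_limit met complete mf.
exists Phi => // y; apply: HPhi => e e0.
have [n ne] := inv_lt e0; exists n => k nk.
have [_ _ _ _ /(_ y k.+1%:R^-1)[|a0 Ha0]] := met; first by rewrite invr_gt0.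
have Eb a : encode y (bitcode j sg a k) = `[< bl dist s a k y >].
  by rewrite /encode /bitset bitcodeK.
have ex : exists a, encode y (bitcode j sg a k) by exists a0; rewrite Eb; apply/asboolP.
have Hfirst : first k (ex_minn ex) (encode y).
  case: ex_minnP => a Ha amin; split => // a' a'a Ha'.
  by have := amin _ Ha'; rewrite leqNgt a'a.
rewrite /f (xgetE _ _ _ Hfirst).
have : encode y (bitcode j sg (ex_minn ex) k) by case: Hfirst.
rewrite Eb => /asboolP; rewrite /bl /= => Hd.
apply: lt_trans Hd _; apply: le_lt_trans ne.
by rewrite lef_pV2 ?posrE// ler_nat.
Qed.

Variables (mu : probability (borel S) R) (ms : nat -> probability SS R).
Hypothesis mms : forall n, marginals_eq mu (ms n).
Hypothesis cms : forall A B, measurable A -> measurable B ->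
  cvgn (fun n => fine (ms n (A `*` B))).

Let pp (A B : set (borel S)) : R := limn (fun n => fine (ms n (A `*` B))).

Let pp_cvg A B : measurable A -> measurable B ->
  (fun n => fine (ms n (A `*` B))) @ \oo --> pp A B.
Proof. by move=> mA mB; exact: cms. Qed.

Let pp_ge0 A B : measurable A -> measurable B -> 0 <= pp A B.
Proof.
by move=> mA mB; apply: limr_ge; [exact: cms|apply: nearW => n; rewrite fine_ge0].
Qed.

Let pp_unique A B l : measurable A -> measurable B ->
  (fun n => fine (ms n (A `*` B))) @ \oo --> l -> pp A B = l.
Proof. by move=> mA mB H; apply: cvg_lim. Qed.

Let ppl A : measurable A -> pp A setT = fine (mu A).
Proof.
move=> mA; apply: pp_unique => //.
by under eq_fun do rewrite (mms _ mA).1; exact: cvg_cst.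
Qed.

Let ppr A : measurable A -> pp setT A = fine (mu A).
Proof.
move=> mA; apply: pp_unique => //.
by under eq_fun do rewrite (mms _ mA).2; exact: cvg_cst.
Qed.

Let ppT : pp setT setT = 1.
Proof. by rewrite ppl// probability_setT. Qed.

Let ppUl A A' B : measurable A -> measurable A' -> measurable B ->
  A `&` A' = set0 -> pp (A `|` A') B = pp A B + pp A' B.
Proof.
move=> mA mA' mB AA'; apply: pp_unique => //; first exact: measurableU.
rewrite (_ : (fun n => _) = (fun n => fine (ms n (A `*` B)) + fine (ms n (A' `*` B)))).
  exact: cvgD (pp_cvg mA mB) (pp_cvg mA' mB).
apply/funext => n; have m1 := measurableX mA mB; have m2 := measurableX mA' mB.
rewrite (_ : (A `|` A') `*` B = (A `*` B) `|` (A' `*` B)); last first.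
  by apply/seteqP; split => -[x y] /=; tauto.
rewrite measureU// ?fineD ?fin_num_measure//.
apply/seteqP; split => // -[x y] /= [[Ax _] [Ax' _]].
by have : (A `&` A') x by []; rewrite AA'.
Qed.

Let ppUr A A' B : measurable A -> measurable A' -> measurable B ->
  A `&` A' = set0 -> pp B (A `|` A') = pp B A + pp B A'.
Proof.
move=> mA mA' mB AA'; apply: pp_unique => //; first exact: measurableU.
rewrite (_ : (fun n => _) = (fun n => fine (ms n (B `*` A)) + fine (ms n (B `*` A')))).
  exact: cvgD (pp_cvg mB mA) (pp_cvg mB mA').
apply/funext => n; have m1 := measurableX mB mA; have m2 := measurableX mB mA'.
rewrite (_ : B `*` (A `|` A') = (B `*` A) `|` (B `*` A')); last first.
  by apply/seteqP; split => -[x y] /=; tauto.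
rewrite measureU// ?fineD ?fin_num_measure//.
apply/seteqP; split => // -[x y] /= [[_ Ax] [_ Ax']].
by have : (A `&` A') y by []; rewrite AA'.
Qed.

(** The rectangle limits [pp] define the law of the bits, and [Z j] decodes those of pair [j].
    Decoding fails only on a null set: with one full side [pp] is [mu], so the bits of a single
    coordinate are distributed like the code of a [mu]-random point. *)
Lemma limit_coupling : exists d (T : measurableType d) (Q : probability T R)
    (Z : nat -> T -> SS) (m : probability SS R),
  [/\ forall j, has_law Q (Z j) m,
      mutual_indep Q (fun j => sigma_of (Z j)),
      marginals_eq mu m
    & forall A B, measurable A -> measurable B ->
        (fun n => fine (ms n (A `*` B))) @ \oo --> fine (m (A `*` B))].
Proof.
have mW := measurable_bitset.
pose bl' := @bitlaw R _ _ pp bitcopy bitside bitset.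
have [d [T [Q [c [mc Qc]]]]] : exists d (T : measurableType d) (Q : probability T R)
    (c : nat -> T -> bool), (forall i, measurable [set u | c i u]) /\
    forall n (beta : nat -> bool),
      Q [set u | forall i, (i < n)%N -> c i u = beta i] = (bl' (bitprefix beta n))%:E.
  apply: random_bits.
  - exact: (bitlaw_ge0 pp_ge0 _ _ mW).
  - exact: (bitlaw_nil ppT).
  - exact: (bitlaw_cons ppT ppUl ppUr _ _ mW).
have bprob := bevents_prob ppT ppUl ppUr mW mc Qc.
have bind := bevents_indep ppT ppUl ppUr mW mc Qc.
pose C (u : T) : nat -> bool := fun i => c i u.
(* each coordinate reads its bits as if they were the code of a mu-random point *)
have bitcyls_law j sg A : <<s bitcyls j sg >> A ->
    measurable (C @^-1` A) /\ measurable (encode @^-1` A) /\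
    Q (C @^-1` A) = mu (encode @^-1` A).
  pose M := g_sigma_algebraType (bitcyls j sg).
  have mC : measurable_fun setT (C : T -> M).
    apply: measurability => // _ [_ [pi [L ->]] <-]; rewrite setTI.
    apply: measurable_foralln => i; apply: measurable_imply; exact: (measurable_bit mc i (pi i)).
  have mE : measurable_fun setT (encode : borel S -> M).
    apply: measurability => // _ [_ [pi [L ->]] <-]; rewrite setTI.
    exact: (measurable_psel bitcopy bitside mW j sg pi L).
  have fC : C \in @mfun _ _ T M by rewrite inE.
  have fE : encode \in @mfun _ _ (borel S) M by rewrite inE.
  move=> sA; split; first by rewrite -[X in measurable X]setTI; exact: mC.
  split; first by rewrite -[X in measurable X]setTI; exact: mE.
  apply: (@pi_lambda_eq R _ M (distribution Q (mfun_Sub fC))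
    (distribution mu (mfun_Sub fE)) (bitcyls j sg)) sA.
  - exact: bitcyls_setI.
  - exact: sub_sigma_algebra.
  - by rewrite /= /distribution /pushforward !preimage_setT !probability_setT.
  move=> _ [pi [L ->]]; rewrite /= /distribution /pushforward /preimage /=.
  pose pi' i v := (bitside i == sg) ==> pi i v.
  transitivity (Q (pevent c (fun i v => (bitcopy i == j) ==> pi' i v) L)).
    congr (Q _); apply/seteqP; split => u H i.
      by move=> iL; apply/implyP => ij; apply/implyP => si; apply: H; rewrite iL ij si.
    by move=> /andP[/andP[iL ij] si]; have := H i iL; rewrite ij /pi' si.
  rewrite bprob.
  have pE : psel bitcopy bitside bitset j sg pi' L =
      [set t | forall i, (i < L)%N && (bitcopy i == j) && (bitside i == sg) ->
        pi i (encode t i)].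
    apply/seteqP; split => t H i Hi; have := H i Hi; move: Hi => /andP[_ si].
      by rewrite /pi' si.
    by rewrite /pi' si.
  (* The opposite side is free, so [pp] reduces to its marginal [mu]. *)
  have pN : psel bitcopy bitside bitset j (~~ sg) pi' L = setT.
    apply/seteqP; split => // t _ i /andP[_ /eqP si].
    by rewrite /pi' si; case: (sg).
  have mp := measurable_psel bitcopy bitside mW j sg pi' L.
  rewrite -pE; case: (sg) pE pN mp => /= _ -> mp.
    by rewrite ppl// fineK// fin_num_measure.
  by rewrite ppr// fineK// fin_num_measure.
have [Phi HPhi] : exists Phi : nat * bool -> (nat -> bool) -> borel S, forall p,
    measurable_fun setT (Phi p : g_sigma_algebraType (bitcyls p.1 p.2) -> borel S) /\
    forall y, Phi p (encode y) = y.
  have /choice[f Hf] : forall p : nat * bool, exists f : (nat -> bool) -> borel S,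
      measurable_fun setT (f : g_sigma_algebraType (bitcyls p.1 p.2) -> borel S) /\
      forall y, f (encode y) = y.
    by move=> p; have [f mf Hf] := decoder p.1 p.2; exists f.
  by exists f.
pose Y j sg u := Phi (j, sg) (C u).
have sPhi j sg A : measurable A -> <<s bitcyls j sg >> (Phi (j, sg) @^-1` A).
  by move=> mA; have [mP _] := HPhi (j, sg); have := mP measurableT A mA; rewrite setTI.
have mY j sg : measurable_fun setT (Y j sg).
  by move=> _ A mA; rewrite setTI; have [] := bitcyls_law j sg _ (sPhi j sg A mA).
have lY j sg A : measurable A -> Q (Y j sg @^-1` A) = mu A.
  move=> mA; have [_ [_ ->]] := bitcyls_law j sg _ (sPhi j sg A mA).
  by congr (mu _); apply/seteqP; split => y; have [_ HP] := HPhi (j, sg);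
    rewrite /preimage /= HP.
pose Z j u : SS := (Y j true u, Y j false u).
have mZ j : measurable_fun setT (Z j) by exact: measurable_fun_pair.
(* The event [D] that decoding contradicts a bit contains no code, so its preimage under [encode] is
   empty, and [bitcyls_law] makes it null for [Q]. *)
have aeY j : {ae Q, forall u, forall i, bitcopy i = j ->
    (bitset i (Y j (bitside i) u) <-> c i u)}.
  apply: ae_foralln => i; have [ij|ij] := eqVneq (bitcopy i) j; last first.
    by apply: nearW => u E; rewrite E eqxx in ij.
  set sg := bitside i.
  pose D : set (nat -> bool) := symd (Phi (j, sg) @^-1` bitset i) [set x | x i].
  have sD : <<s bitcyls j sg >> D.
    apply: (@measurable_symd _ (g_sigma_algebraType (bitcyls j sg))).
      exact: sPhi.
    by apply: sub_sigma_algebra; exact: bitcyls_bit.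
  have [mD [_ QD]] := bitcyls_law j sg D sD.
  exists (C @^-1` D); split => //.
    apply: (etrans QD); rewrite (_ : encode @^-1` D = set0) ?measure0//.
    apply/seteqP; split => // y; have [_ HP] := HPhi (j, sg).
    rewrite /D /symd /preimage /setD /setU /mkset /= HP /encode.
    by case=> -[h1 h2]; [apply: h2; apply/asboolP|apply: h2; exact/asboolP].
  move=> u /= Hu; have {}Hu : ~ (bitset i (Y j sg u) <-> c i u).
    by move=> H; apply: Hu.
  rewrite /D /symd /preimage /setD /setU /mkset /= /C -/(Y j sg u).
  have [h1|h1] := pselect (bitset i (Y j sg u)).
    by left; split => // h2; apply: Hu.
  by right; split => //; apply: contrapT => h2; apply: Hu.
have ZP j A B : psets j true A -> psets j false B ->
    Q (Z j @^-1` (A `*` B)) = (pp A B)%:E.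
  move=> [piA [LA ->]] [piB [LB ->]].
  pose L := maxn LA LB.
  pose pi i v := if bitside i then (i < LA)%N ==> piA i v else (i < LB)%N ==> piB i v.
  have EA : psel bitcopy bitside bitset j true piA LA = psel bitcopy bitside bitset j true pi L.
    apply/seteqP; split => x H i /andP[/andP[iL ij] /eqP si]; rewrite ?/pi ?si.
      by apply/implyP => iA; apply: H; rewrite iA ij si.
    have := H i; rewrite /L leq_max iL ij si /pi si iL /=; exact.
  have EB : psel bitcopy bitside bitset j false piB LB = psel bitcopy bitside bitset j false pi L.
    apply/seteqP; split => x H i /andP[/andP[iL ij] /eqP si]; rewrite ?/pi ?si.
      by apply/implyP => iA; apply: H; rewrite iA ij si.
    have := H i; rewrite /L leq_max iL ij si orbT /pi si iL /=; exact.
  rewrite EA EB -bprob.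
  have mt := measurable_psel bitcopy bitside mW j true pi L.
  have mf := measurable_psel bitcopy bitside mW j false pi L.
  apply: ae_eq_prob.
  - rewrite -[X in measurable X]setTI; apply: mZ => //; exact: measurableX.
  - exact: measurable_pevent.
  apply: filterS (aeY j) => u Hu; split.
    move=> [/= Ht Hf] i iL; apply/implyP => /eqP ij.
    have E : `[< bitset i (Y j (bitside i) u) >] = c i u.
      by apply/asboolP/idP => /(Hu i ij).
    rewrite -E; case Es : (bitside i).
      by apply: Ht; rewrite iL ij Es !eqxx.
    by apply: Hf; rewrite iL ij Es !eqxx.
  move=> H; split => /= i /andP[/andP[iL ij] /eqP si].
    have E : `[< bitset i (Y j (bitside i) u) >] = c i u.
      by apply/asboolP/idP => /(Hu i (eqP ij)).
    by rewrite si in E; rewrite E; have := H i iL; rewrite ij.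
  have E : `[< bitset i (Y j (bitside i) u) >] = c i u.
    by apply/asboolP/idP => /(Hu i (eqP ij)).
  by rewrite si in E; rewrite E; have := H i iL; rewrite ij.
have fZ j : Z j \in @mfun _ _ T SS by rewrite inE; exact: mZ.
pose m j : probability SS R := distribution Q (mfun_Sub (fZ j)).
have mE j A : m j A = Q (Z j @^-1` A) by [].
have mm j : marginals_eq mu (m j).
  move=> A mA; rewrite !mE -(lY j true A mA); split.
    by congr (Q _); apply/seteqP; split => u //= [].
  by rewrite lY// -(lY j false A mA); congr (Q _); apply/seteqP; split => u //= [].
have cZ j A B : measurable A -> measurable B ->
    (fun n => fine (ms n (A `*` B))) @ \oo --> fine (m j (A `*` B)).
  apply: (@rect_cvg_ext _ _ mu ms (m j) mms (mm j) (psets j true) (psets j false)).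
  - exact: psets_setI.
  - exact: psets_setI.
  - exact: psets_borel.
  - exact: psets_borel.
  move=> A' B' pA pB; rewrite mE ZP//; apply: pp_cvg.
    by rewrite -(psets_borel j true); exact: sub_sigma_algebra.
  by rewrite -(psets_borel j false); exact: sub_sigma_algebra.
(* Every [m j] is the same limit on rectangles, so the pairs are identically distributed. *)
have mj j : meas_eq (m j) (m 0%N).
  apply: rect_meas_eq => A B mA mB.
  have mAB := measurableX mA mB.
  rewrite -(fineK (fin_num_measure (m j) _ mAB)) -(fineK (fin_num_measure (m 0%N) _ mAB)).
  congr (_%:E); exact: (cvg_unique _ (cZ j A B mA mB) (cZ 0%N A B mA mB)).
exists d, T, Q, Z, (m 0%N); split => //.
- by move=> j; apply: has_law_meas_eq (mj j) _; split.
- apply/indep_onP.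
  have bI := @bevents_setI bitcopy _ T c.
  have bm i : bevents bitcopy c i `<=` measurable.
    by move=> _ [pi [L ->]]; exact: measurable_pevent.
  apply: indep_onS (indep_pi_ext (fun i _ => bI i) (fun i _ => bm i) bind) => j _.
  split => //; apply: gen_measurable_fun.
  have mYj sg : measurable_fun setT (Y j sg : g_sigma_algebraType (bevents bitcopy c j) -> borel S).
    have mCj : measurable_fun setT (C : g_sigma_algebraType (bevents bitcopy c j) ->
        g_sigma_algebraType (bitcyls j sg)).
      apply: measurability => // _ [_ [pi [L ->]] <-]; rewrite setTI.
      apply: sub_sigma_algebra; exists (fun i v => (bitside i == sg) ==> pi i v), L.
      apply/seteqP; split => u H i.
        by move=> iL; apply/implyP => ij; apply/implyP => si; apply: H; rewrite iL ij si.
      by move=> /andP[/andP[iL ij] si]; have := H i iL; rewrite ij si.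
    by have [mP _] := HPhi (j, sg); exact: measurableT_comp mP mCj.
  exact: measurable_fun_pair.
- by move=> A B mA mB; exact: (cZ 0%N).
Qed.

End limit_coupling.

(** * Weak limits and the theorem *)

Lemma Ex_cvg {R : realType} {d} {T : measurableType d} (m : probability T R)
    (f : nat -> T -> R) (h : T -> R) :
  (forall n, bmeas (f n)) -> bmeas h -> (forall n x, `|f n x| <= 1) ->
  (forall x, (fun n => f n x) @ \oo --> h x) ->
  (fun n => Ex m (f n)) @ \oo --> Ex m h.
Proof.
move=> bf bh f1 cf.
have [] := @dominated_convergence _ _ _ m setT measurableT
  (fun n x => (f n x)%:E) (fun x => (h x)%:E) (fun=> 1%E).
- by move=> n; apply/measurable_EFinP; case: (bf n).
- by apply/measurable_EFinP; case: bh.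
- by apply: aeW => x _; apply: cvg_EFin; [near=> n|exact: cf].
- exact: (bmeas_integrable m (bmeas_cst 1)).
- by apply: aeW => x n _; rewrite lee_fin.
move=> _ _; rewrite -EFin_Ex//.
by under eq_fun do rewrite -EFin_Ex//; move=> /fine_cvgP[].
Unshelve. all: end_near.
Qed.

Section weak_limits.
Context {R : realType} {S : ptopologicalType}.
Variables (dist : borel S -> borel S -> R) (s : nat -> borel S).
Hypothesis met : sepmetric dist s.
Local Notation SS := (borel S * borel S)%type.

(** Multiplying the functions gives stability under intersection, and the indicators of these sets
    are limits of continuous functions. *)
Definition cozeros : set (set SS) :=
  [set A | exists t : SS -> R, [/\ continuous t, forall p, 0 <= t p <= 1
     & A = [set p | 0 < t p]]].

Lemma cozeros_setI : setI_closed cozeros.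
Proof.
move=> _ _ [t [ct t01 ->]] [t' [ct' t'01 ->]].
exists (fun p => t p * t' p); split.
- by move=> p; apply: cvgM; [exact: ct|exact: ct'].
- move=> p; have /andP[a b] := t01 p; have /andP[a' b'] := t'01 p.
  by rewrite mulr_ge0//= mulr_ile1.
- apply/seteqP; split => p /=; first by move=> [a b]; rewrite mulr_gt0.
  move=> H; have /andP[a b] := t01 p; have /andP[a' b'] := t'01 p.
  split; rewrite lt_neqAle ?a ?a' andbT eq_sym; apply/eqP => E.
    by rewrite E mul0r ltxx in H.
  by rewrite E mulr0 ltxx in H.
Qed.

Lemma cozeros_measurable : cozeros `<=` measurable.
Proof.
move=> _ [t [ct t01 ->]]; apply: measurable_superlevel.
exact: (measurable_continuous2 met).
Qed.

Lemma cozeros_ball (pr : SS -> borel S) a (r : R) :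
  (forall (p : SS) (e : R), 0 < e -> \forall q \near p, dist (pr p) (pr q) < e) ->
  cozeros [set p | dist a (pr p) < r].
Proof.
move=> Hpr; exists (fun p => Num.min 1 (Num.max 0 (r - dist a (pr p)))); split.
- move=> p; apply/cvgrPdist_lt => e e0; apply: filterS (Hpr p e e0) => q pq.
  apply: le_lt_trans pq; rewrite ler_norml.
  have := dist_tri met (pr p) a (pr q); have := dist_tri met (pr q) a (pr p).
  rewrite (distC met (pr q) (pr p)).
  have := dist_ge0 met (pr p) (pr q).
  set x := dist a (pr p); set y := dist a (pr q); set k := dist _ _ => h1 h2 h3.
  rewrite !maxEle !minEle.
  case: (leP 0 (r - x)) => ?; case: (leP 0 (r - y)) => ?; rewrite ?ler10;
  by case: (leP 1 (r - x)) => ?; case: (leP 1 (r - y)) => ?; lra.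
- by move=> p; rewrite le_min ler01 le_max lexx/= ge_min lexx.
- by apply/seteqP; split => p /=; rewrite lt_min ltr01 lt_max ltxx /= subr_gt0.
Qed.

Lemma near_fst_dist (p : SS) (e : R) : 0 < e -> \forall q \near p, dist p.1 q.1 < e.
Proof.
move=> e0; exists ([set y | dist p.1 y < e], setT); last by move=> q [].
by split; [apply/(nbhs_distP met); exists e|exact: filterT].
Qed.

Lemma near_snd_dist (p : SS) (e : R) : 0 < e -> \forall q \near p, dist p.2 q.2 < e.
Proof.
move=> e0; exists (setT, [set y | dist p.2 y < e]); last by move=> q [].
by split; [exact: filterT|apply/(nbhs_distP met); exists e].
Qed.

Lemma cozeros_gen A : measurable A -> <<s cozeros >> A.
Proof.
move=> mA; pose M := g_sigma_algebraType cozeros.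
have mpr (pr : SS -> borel S) :
    (forall (p : SS) (e : R), 0 < e -> \forall q \near p, dist (pr p) (pr q) < e) ->
    measurable_fun setT (pr : M -> borel S).
  (* Pair 0 and side [true] are an arbitrary choice: its balls generate the Borel sets, and their
     preimages are cozero sets. *)
  move=> Hpr; have E := psets_borel met 0%N true.
  apply: (@measurability _ _ M (borel S) setT pr (psets dist s 0%N true)); first exact: esym.
  move=> _ [_ [pi [L ->]] <-]; rewrite setTI.
  have mb i : measurable (pr @^-1` bitset dist s i : set M).
    by apply: sub_sigma_algebra; exact: cozeros_ball.
  have -> : pr @^-1` psel bitcopy bitside (bitset dist s) 0%N true pi L =
      psel bitcopy bitside (fun i => pr @^-1` bitset dist s i) 0%N true pi L by [].
  exact: (@measurable_psel _ M).
have mid : measurable_fun setT (fun p : M => (p.1, p.2) : SS).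
  apply: measurable_fun_pair; apply: mpr.
    exact: near_fst_dist.
  exact: near_snd_dist.
have := mid measurableT A mA; rewrite setTI.
by congr (<<s _ >> _); apply/seteqP; split => -[x y].
Qed.

Lemma weak_unique (m m' : probability SS R) :
  (forall f : SS -> R, continuous f -> (exists M : R, forall x, `|f x| <= M) ->
    Ex m f = Ex m' f) -> meas_eq m m'.
Proof.
move=> H A mA.
apply: (pi_lambda_eq (G := cozeros)).
- exact: cozeros_setI.
- exact: cozeros_measurable.
- by rewrite /= !probability_setT.
- move=> B cB; have mB := cozeros_measurable cB.
  have [t [ct t01 BE]] := cB.
  (* these continuous functions increase to the indicator of B *)
  pose f n p : R := 1 - (1 - t p) ^+ n.
  have ce n : continuous (fun p => (1 - t p) ^+ n).
    elim: n => [|n IH] p; first exact: cvg_cst.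
    rewrite (_ : (fun p => _) = (fun p => (1 - t p) * (1 - t p) ^+ n)); last first.
      by apply/funext => q; rewrite exprS.
    apply: cvgM; last exact: IH.
    by apply: cvgB; [exact: cvg_cst|exact: ct].
  have cf n : continuous (f n).
    by move=> p; apply: cvgB; [exact: cvg_cst|exact: ce].
  have f1 n p : `|f n p| <= 1.
    have /andP[a b] := t01 p.
    have h0 : 0 <= (1 - t p) ^+ n by apply: exprn_ge0; lra.
    have h1 : (1 - t p) ^+ n <= 1 by apply: exprn_ile1; lra.
    by rewrite ger0_norm /f; lra.
  have bf n : bmeas (f n).
    by split; [exact: (measurable_continuous2 met)|exists 1; exact: f1].
  have lim p : (fun n => f n p) @ \oo --> (\1_B p : R).
    have /andP[a b] := t01 p; rewrite indicE BE.
    have -> : (p \in [set p | 0 < t p]) = (0 < t p).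
      by apply/idP/idP; rewrite inE.
    have [t0|t0] := ltP 0 (t p).
      rewrite /f -[X in _ --> X]subr0; apply: cvgB; first exact: cvg_cst.
      by apply: cvg_expr; rewrite ger0_norm; lra.
    have -> : (fun n => f n p) = fun=> 0.
      have tp0 : t p = 0 by lra.
      by apply/funext => n; rewrite /f tp0 subr0 expr1n subrr.
    exact: cvg_cst.
  have c1 := Ex_cvg (m := m) bf (bmeas_indic mB) f1 lim.
  have c2 := Ex_cvg (m := m') bf (bmeas_indic mB) f1 lim.
  have E : Ex m (\1_B) = Ex m' (\1_B).
    have Ef : (fun n => Ex m (f n)) = (fun n => Ex m' (f n)).
      by apply/funext => n; apply: H => //; exists 1; exact: f1.
    by rewrite Ef in c1; exact: (cvg_unique _ c1 c2).
  rewrite !Ex_indic// in E.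
  by rewrite -(fineK (fin_num_measure m _ mB)) E fineK// fin_num_measure.
- exact: cozeros_gen.
Qed.

End weak_limits.

(** * From bivariate uniqueness to endogeny *)

Section bivariate_converse.
Context {R : realType} {dT : measure_display} {Theta : measurableType dT}
  {S : ptopologicalType} {dO : measure_display} {Omega : measurableType dO}.
Variables (nu : probability (Theta * natinf)%type R)
  (g : Theta -> natinf -> (nat -> borel S) -> borel S)
  (P : probability Omega R) (mu : probability (borel S) R)
  (xi : word -> Omega -> Theta) (N : word -> Omega -> natinf)
  (X : word -> Omega -> borel S).
Hypothesis mg : g_measurable g.
Hypothesis rtp : invariant_RTP P nu g mu xi N X.
Local Notation SS := (borel S * borel S)%type.
Local Notation z := (xiN xi N).
Variables (dist : borel S -> borel S -> R) (s : nat -> borel S).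
Hypothesis met : sepmetric dist s.
Hypothesis complete : forall u : nat -> borel S,
  (forall e : R, 0 < e -> exists M : nat, forall m n, (M <= m)%N ->
     (M <= n)%N -> dist (u m) (u n) < e) ->
  exists l : borel S, u @ \oo --> l.

(** T2 at the limit law requires an i.i.d. sequence of that law, which is why [limit_coupling]
    delivers one; the RTP contributes the innovations. *)
Lemma T2_image_exists {d} {T : measurableType d} (Q : probability T R)
    (Z : nat -> T -> SS) (m : probability SS R) :
  (forall j, has_law Q (Z j) m) -> mutual_indep Q (fun j => sigma_of (Z j)) ->
  exists m' : probability SS R, T2_image nu g m m'.
Proof.
move=> HZ IZ; have D := tree_data_attach (rtp_tree_data rtp 1) HZ IZ.
have [Hz Hy _] := D.
pose Y2 p := ev2 g 1 (fun w => z w p.1) (fun w : seq nat => Z (pickle w) p.2).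
have mY : measurable_fun setT Y2.
  apply: (measurable_ev2 mg (e := fun w (p : Omega * T) => z w p.1)
    (y := fun (w : seq nat) (p : Omega * T) => Z (pickle w) p.2)) => w wn.
    by have [] := Hz w wn.
  by have [] := Hy w wn.
have fY : Y2 \in @mfun _ _ (Omega * T)%type SS by rewrite inE.
exists (distribution ((P \x Q)%E : probability (Omega * T)%type R) (mfun_Sub fY)).
apply: (T2_image_step mg D); last by split.
move=> j; have [my ly] := Hy [:: j] erefl.
rewrite (_ : (fun om => _) = (fun p : Omega * T => Z (@pickle (seq nat) [:: j]) p.2)) //.
by apply/funext => p; rewrite /ev2 /= -surjective_pairing.
Qed.

Lemma bivariate_uniqueness_endogenous :
  bivariate_uniqueness nu g mu -> T2_weak_continuous nu g mu -> endogenous P xi N X.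
Proof.
move=> [_ BU] TC; pose ms := pair_chain mg rtp.
have mms n : marginals_eq mu (ms n).
  have L := pair_chain_law mg rtp n.
  have D := rtp_pair_tree_data rtp n.
  exact: (marginals_ev2 mg rtp (marginals_prod mu) D L).
have [d [T [Q [Z [m [HZ IZ mm cm]]]]]] :=
  limit_coupling met complete mms (@pair_chain_rect_cvg _ _ _ _ _ _ _ _ _ _ _ _ _ mg rtp).
have [m' Hm'] := T2_image_exists HZ IZ.
have W : weak_cvg ms m by exact: (weak_cvg_rect met).
(* Continuity gives the shifted sequence the limit T2 of [m]; it also tends to [m], which is
   therefore a fixed point. *)
have W' : weak_cvg (fun k => ms k.+1) m'.
  exact: TC mms mm (pair_chainS mg rtp) Hm' W.
have mm' : meas_eq m' m.
  apply: (weak_unique met) => f cf bf.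
  have bmf : bmeas f by split => //; exact: (measurable_continuous2 met).
  have h1 := W' f cf bf; have h2 := W f cf bf.
  rewrite -(cvg_shiftS) in h2; apply: EFin_inj; rewrite !EFin_Ex//.
  exact: (cvg_unique _ h1 h2).
have E : meas_eq m (diag_prob mu).
  apply: BU => //; exact: T2_image_meas_eq mm' Hm'.
apply: (chain_cvg_endogenous mg rtp met complete (pair_chain0 mg rtp) (pair_chainS mg rtp)).
change (weak_cvg ms (diag_prob mu)).
exact: weak_cvg_eq W.
Qed.

End bivariate_converse.

Unset Implicit Arguments.

Theorem theorem11 (R : realType) (S : ptopologicalType)
  (dT : measure_display) (Theta : measurableType dT)
  (nu : probability (Theta * natinf)%type R)
  (g : Theta -> natinf -> (nat -> borel S) -> borel S)
  (dO : measure_display) (Omega : measurableType dO) (P : probability Omega R)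
  (mu : probability (borel S) R)
  (xi : word -> Omega -> Theta) (N : word -> Omega -> natinf)
  (X : word -> Omega -> borel S) :
  polish R S -> g_local g -> g_measurable g ->
  invariant_RTP P nu g mu xi N X ->
  [/\ (endogenous P xi N X -> bivariate_uniqueness nu g mu),
      (bivariate_uniqueness nu g mu -> T2_weak_continuous nu g mu ->
         endogenous P xi N X)
    & (endogenous P xi N X <-> T2_iterates_cvg nu g mu)].
Proof.
move=> /polish_sepmetric[dist [s [met complete]]] _ mg rtp; split.
- exact: endogenous_bivariate_uniqueness mg rtp.
- exact (bivariate_uniqueness_endogenous mg rtp met complete).
- split; first exact (endogenous_T2_iterates_cvg mg rtp met).
  move=> H; apply: (chain_cvg_endogenous mg rtp met complete
    (pair_chain0 mg rtp) (pair_chainS mg rtp)).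
  by apply: H; [exact: pair_chain0|exact: pair_chainS].
Qed.
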